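(* Let $(X,0)$ be a $d$-dimensional germ of toric singularity whose normalization $(\overline{X},0)$ is smooth. Then the Lipschitz saturated germ $(X^s,0)$ is also a germ of toric singularity.
   Context: **Toric singularities.** Let $\Gamma\subset\mathbb{Z}^d$ be a finitely generated semigroup (containing $0$) with generators $\gamma_1,\dots,\gamma_n$, generating $\mathbb{Z}^d$ as a group and such that the cone $\mathbb{R}_{\ge 0}\Gamma$ is strongly convex. Let $X_\Gamma\subset\mathbb{C}^n$ be the affine toric variety defined by the kernel $I_\Gamma$ of $\mathbb{C}[z_1,\dots,z_n]\to\mathbb{C}[t_1^{\pm1},\dots,t_d^{\pm1}]$, $z_i\mapsto t^{\gamma_i}$; it contains the origin. $\mathbb{C}[[\Gamma]]$ denotes the ring of formal power series with exponents in $\Gamma$, and $\mathbb{C}\{\Gamma\}$ the subring of series convergent in a neighborhood of $0\in X_\Gamma$ (equivalently, the image of $\mathbb{C}\{z_1,\dots,z_n\}$ under $z_i\mapsto t^{\gamma_i}$); one has $\mathcal{O}_{X_\Gamma,0}\cong\mathbb{C}\{\Gamma\}\cong \mathbb{C}\{z_1,\dots,z_n\}/I_\Gamma\mathbb{C}\{z_1,\dots,z_n\}$. A germ of complex analytic space $(X,0)$ is a *germ of toric singularity* if there is a finitely generated semigroup $\Gamma\subset\mathbb{Z}^d$ contained in a strongly convex cone such that $\mathcal{O}_{X,0}\cong\mathbb{C}\{\Gamma\}$; equivalently, $(X,0)\cong(X_\Gamma,0)$ as germs. Such a germ is reduced and irreducible. **Lipschitz saturation.** Let $(X,0)$ be a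 reduced irreducible germ of complex analytic space, with algebra of germs of holomorphic functions $\mathcal{O}_{X,0}$. Let $\overline{\mathcal{O}_{X,0}}$ be the integral closure of $\mathcal{O}_{X,0}$ in its field of fractions; it is the analytic algebra of the normalization $n:(\overline{X},0)\to(X,0)$. Let $\widehat{\otimes}$ denote the analytic tensor product (corresponding to fibre product of analytic germs), so $\overline{\mathcal{O}_{X,0}}\widehat{\otimes}_{\mathbb{C}}\overline{\mathcal{O}_{X,0}}=\mathcal{O}_{\overline{X}\times\overline{X},(0,0)}$ and $\overline{\mathcal{O}_{X,0}}\widehat{\otimes}_{\mathcal{O}_{X,0}}\overline{\mathcal{O}_{X,0}}=\mathcal{O}_{\overline{X}\times_X\overline{X},(0,0)}$. Let $I_\Delta$ be the kernel of the natural surjection from the first algebra to the second. (If $(X,0)\subset(\mathbb{C}^n,0)$ and $n=(\eta_1,\dots,\eta_n)$, then $I_\Delta$ is generated by $\eta_i(x)-\eta_i(y)$, $i=1,\dots,n$.) For an ideal $I$, $\overline{I}$ denotes its integral closure. The Lipschitz saturation of $\mathcal{O}_{X,0}$ is $$\mathcal{O}_{X,0}^s=\{f\in\overline{\mathcal{O}_{X,0}} : f\widehat{\otimes}_{\mathbb{C}}1-1\widehat{\otimes}_{\mathbb{C}}f\in\overline{I_\Delta}\},$$ that is, those $f$ with $f(x)-f(y)\in\overline{I_\Delta}$. It is an analytic algebra with $\mathcal{O}_{X,0}\subset\mathcal{O}_{X,0}^s\subset\overline{\mathcal{O}_{X,0}}$, and the Lipschitz saturated germ $(X^s,0)$ (the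 Lipschitz saturation of $(X,0)$) is the germ of analytic space with algebra $\mathcal{O}_{X,0}^s$. *)

(* Defs.v *)
(* Germs of complex analytic spaces are represented by their analytic
   algebras. A C-algebra is a ring E together with a ring morphism C -> E, and
   its morphisms are the ring morphisms compatible with these structure maps;
   C is R[i] for R : realType. *)
From HB Require Import structures.
From mathcomp Require Import all_boot all_order all_algebra.
From mathcomp Require Import generic_quotient ring_quotient.
From mathcomp Require Import boolp classical_sets cardinality fsbigop reals.
From mathcomp Require Import mpoly complex.

Set Implicit Arguments.
Unset Strict Implicit.
Unset Printing Implicit Defensive.

Import Order.TTheory GRing.Theory Num.Theory.
Local Open Scope ring_scope.

Section ConvergentPowerSeries.
Context (K : numFieldType) (n : nat).
Implicit Types f g h : 'X_{1..n} -> K.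

(* Absolute convergence on a polydisc of radius r around the origin, as a
   bound on the finite sums. For K = R[i], 0 < r means that r is a positive
   real number. *)
Definition convergent f : Prop := exists r M : K, 0 < r /\
  forall N : nat, \sum_(k : 'X_{1..n < N}) `|f k| * r ^+ mdeg k <= M.

Record cps := Cps { cps_coef :> 'X_{1..n} -> K; cpsP : convergent cps_coef }.

HB.instance Definition _ := gen_eqMixin cps.
HB.instance Definition _ := gen_choiceMixin cps.

Lemma cps_ext (f g : cps) : (forall m, f m = g m) -> f = g.
Proof.
case: f g => [f pf] [g pg] /= fg; have {}fg : f = g by apply/funext.
by subst g; congr Cps; apply: Prop_irrelevance.
Qed.

Definition cauchy_prod f g (m : 'X_{1..n}) : K :=
  \sum_(k : 'X_{1..n < (mdeg m).+1} | (k <= m)%MM) f k * g (m - k)%MM.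

Let trunc N f : {mpoly K[n]} := \sum_(k : 'X_{1..n < N}) f k *: 'X_[k].

Lemma cauchy_prod_mpoly N f g (p q : {mpoly K[n]}) m :
    (forall k, (mdeg k < N)%N -> p@_k = f k) ->
    (forall k, (mdeg k < N)%N -> q@_k = g k) -> (mdeg m < N)%N ->
  (p * q)@_m = cauchy_prod f g m.
Proof.
move=> pf qg mN; rewrite (@mcoeff_poly_mul_lin _ _ p q m _ (ltnSn (mdeg m))).
apply: eq_bigr => k km; rewrite pf ?qg //.
  by rewrite (leq_ltn_trans _ mN) // mdegB.
by rewrite (leq_trans (bmdeg k)).
Qed.

Lemma cauchy_prod_trunc N f g m : (mdeg m < N)%N ->
  (trunc N f * trunc N g)@_m = cauchy_prod f g m.
Proof. by apply: cauchy_prod_mpoly => k kN; rewrite mcoeff_mpoly. Qed.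

Lemma cauchy_prodC f g : cauchy_prod f g = cauchy_prod g f.
Proof.
apply/funext => m.
by rewrite -!(@cauchy_prod_trunc (mdeg m).+1) // mulrC.
Qed.

Lemma cauchy_prodA f g h :
  cauchy_prod f (cauchy_prod g h) = cauchy_prod (cauchy_prod f g) h.
Proof.
apply/funext => m; set N := (mdeg m).+1.
transitivity ((trunc N f * (trunc N g * trunc N h))@_m).
  apply/esym/(@cauchy_prod_mpoly N) => // k kN.
    by rewrite mcoeff_mpoly.
  by rewrite cauchy_prod_trunc.
rewrite mulrA; apply: (@cauchy_prod_mpoly N) => // k kN.
  by rewrite cauchy_prod_trunc.
by rewrite mcoeff_mpoly.
Qed.

Definition const_coef (c : K) (m : 'X_{1..n}) : K := if m == 0%MM then c else 0.

Lemma cauchy_prod_const c f m :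
  cauchy_prod (const_coef c) f m = c * f m.
Proof.
rewrite -(@cauchy_prod_mpoly (mdeg m).+1 _ _ c%:MP
   (trunc (mdeg m).+1 f)) //.
- by rewrite mcoeffCM mcoeff_mpoly.
- by move=> k _; rewrite mcoeffC /const_coef; case: eqP; rewrite ?mulr1 ?mulr0.
- by move=> k kN; rewrite mcoeff_mpoly.
Qed.

Lemma cauchy_prodDl f g h m :
  cauchy_prod (f \+ g) h m = cauchy_prod f h m + cauchy_prod g h m.
Proof.
by rewrite /cauchy_prod -big_split; apply: eq_bigr => k _; rewrite mulrDl.
Qed.

Lemma sum_inj_le (I J : finType) (P : pred I) (h : I -> J) (b : J -> K) :
    {in P &, injective h} -> (forall j, 0 <= b j) ->
  \sum_(i | P i) b (h i) <= \sum_j b j.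
Proof.
move=> hI b0; rewrite -(big_imset b hI) /=.
by rewrite [leRHS](bigID (mem (h @: P))) /= lerDl sumr_ge0.
Qed.

Lemma convergent_const c : convergent (const_coef c).
Proof.
exists 1, `|c|; split=> // N; under eq_bigr do rewrite expr1n mulr1.
case: N => [|N].
  rewrite big1 // => k; by have := bmdeg k.
rewrite (bigD1 bm0) //= big1 ?addr0 /const_coef ?eqxx // => k.
by rewrite -val_eqE /= => /negPf ->; rewrite normr0.
Qed.

Lemma convergent_le f (r s M : K) : 0 < s -> s <= r ->
  (forall N, \sum_(k : 'X_{1..n < N}) `|f k| * r ^+ mdeg k <= M) ->
  (forall N, \sum_(k : 'X_{1..n < N}) `|f k| * s ^+ mdeg k <= M).
Proof.
move=> s0 sr fM N; apply: le_trans (fM N); apply: ler_sum => k _.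
have s0' := ltW s0; by apply: ler_wpM2l => //; apply: lerXn2r => //;
  rewrite nnegrE // (le_trans s0').
Qed.

Lemma convergent2 f g : convergent f -> convergent g ->
  exists r M1 M2 : K, [/\ 0 < r,
    forall N, \sum_(k : 'X_{1..n < N}) `|f k| * r ^+ mdeg k <= M1 &
    forall N, \sum_(k : 'X_{1..n < N}) `|g k| * r ^+ mdeg k <= M2].
Proof.
move=> [r1 [M1 [r10 fM]]] [r2 [M2 [r20 gM]]].
have r0 : 0 < r1 * r2 / (r1 + r2) by rewrite !(mulr_gt0, invr_gt0, addr_gt0).
have r12 : 0 < r1 + r2 by rewrite addr_gt0.
exists (r1 * r2 / (r1 + r2)), M1, M2; split=> //.
  apply: convergent_le fM => //.
  by rewrite ler_pdivrMr // ler_pM2l // lerDr ltW.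
apply: convergent_le gM => //.
by rewrite ler_pdivrMr // mulrC ler_pM2l // lerDl ltW.
Qed.

Lemma convergentD f g : convergent f -> convergent g -> convergent (f \+ g).
Proof.
move=> cf cg; have [r [M1 [M2 [r0 fM gM]]]] := convergent2 cf cg.
exists r, (M1 + M2); split=> // N.
apply: le_trans (lerD (fM N) (gM N)); rewrite -big_split /=.
apply: ler_sum => k _; rewrite -mulrDl ler_wpM2r ?exprn_ge0 ?ler_normD //.
exact: ltW.
Qed.

Lemma convergentN f : convergent f -> convergent (\- f).
Proof.
move=> [r [M [r0 fM]]]; exists r, M; split=> // N.
by under eq_bigr do rewrite /= normrN.
Qed.

Lemma convergentM f g :
  convergent f -> convergent g -> convergent (cauchy_prod f g).
Proof.
move=> cf cg; have [r [M1 [M2 [r0 fM gM]]]] := convergent2 cf cg.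
have rn0 k : 0 <= r ^+ k by rewrite exprn_ge0 // ltW.
pose a f (k : 'X_{1..n}) := `|f k| * r ^+ mdeg k.
have a0 f' k : 0 <= a f' k by rewrite mulr_ge0.
exists r, (M1 * M2); split=> // N.
apply: (@le_trans _ _ (\sum_(m : 'X_{1..n < N})
   \sum_(k : 'X_{1..n < N} | (k <= m)%MM) a f k * a g (m - k)%MM)).
  apply: ler_sum => m _.
  have -> : cauchy_prod f g m =
      \sum_(k : 'X_{1..n < N} | (k <= m)%MM) f k * g (m - k)%MM.
    rewrite -(@cauchy_prod_trunc N) ?bmdeg //.
    rewrite (@mcoeff_poly_mul_lin _ _ _ _ _ N) ?bmdeg //.
    apply: eq_bigr => k km; rewrite !mcoeff_mpoly ?bmdeg //.
    by rewrite (leq_ltn_trans _ (bmdeg m)) // mdegB.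
  apply: le_trans (ler_wpM2r (rn0 _) (ler_norm_sum _ _ _)) _.
  rewrite mulr_suml; apply: ler_sum => k km.
  rewrite -{2}(submK km) addmC mdegD exprD normrM /a.
  by rewrite mulrACA.
rewrite (exchange_big_dep xpredT) //=.
apply: (@le_trans _ _ (\sum_(k : 'X_{1..n < N}) a f k * M2)); last first.
  rewrite -mulr_suml ler_wpM2r ?fM //.
  by apply: le_trans (gM 0%N); apply: sumr_ge0 => j _; apply: a0.
apply: ler_sum => k _; rewrite -mulr_sumr ler_wpM2l //.
apply: le_trans (gM N).
have mB (m : 'X_{1..n < N}) : (mdeg (m - k)%MM < N)%N.
  by rewrite (leq_ltn_trans _ (bmdeg m)) // mdegB.
apply: (@sum_inj_le _ _ (fun m : 'X_{1..n < N} => (k <= m)%MM)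
  (fun m => BMultinom (mB m)) (fun m : 'X_{1..n < N} => a g m)) => // m1 m2.
rewrite !unfold_in => k1 k2 /(congr1 val) /= e.
by apply/val_inj => /=; rewrite -(submK k1) -(submK k2) e.
Qed.

Definition cps_const (c : K) := Cps (convergent_const c).
Definition cps_add (f g : cps) := Cps (convergentD (cpsP f) (cpsP g)).
Definition cps_opp (f : cps) := Cps (convergentN (cpsP f)).
Definition cps_mul (f g : cps) := Cps (convergentM (cpsP f) (cpsP g)).

Fact cps_addA : associative cps_add.
Proof. by move=> f g h; apply: cps_ext => m /=; rewrite addrA. Qed.
Fact cps_addC : commutative cps_add.
Proof. by move=> f g; apply: cps_ext => m /=; rewrite addrC. Qed.
Fact cps_add0 : left_id (cps_const 0) cps_add.
Proof.
by move=> f; apply: cps_ext => m /=; rewrite /const_coef if_same add0r.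
Qed.
Fact cps_addN : left_inverse (cps_const 0) cps_opp cps_add.
Proof.
by move=> f; apply: cps_ext => m /=; rewrite /const_coef if_same addNr.
Qed.

HB.instance Definition _ :=
  GRing.isZmodule.Build cps cps_addA cps_addC cps_add0 cps_addN.

Fact cps_mulA : associative cps_mul.
Proof. by move=> f g h; apply: cps_ext => m /=; rewrite cauchy_prodA. Qed.
Fact cps_mulC : commutative cps_mul.
Proof. by move=> f g; apply: cps_ext => m /=; rewrite cauchy_prodC. Qed.
Fact cps_mul1 : left_id (cps_const 1) cps_mul.
Proof.
by move=> f; apply: cps_ext => m /=; rewrite cauchy_prod_const mul1r.
Qed.
Fact cps_mulDl : left_distributive cps_mul +%R.
Proof. by move=> f g h; apply: cps_ext => m /=; rewrite cauchy_prodDl. Qed.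
Fact cps_1neq0 : cps_const 1 != 0.
Proof.
apply/eqP => /(congr1 (fun f : cps => f 0%MM)) /eqP /=.
by rewrite /const_coef eqxx oner_eq0.
Qed.

HB.instance Definition _ := GRing.Zmodule_isComNzRing.Build cps
  cps_mulA cps_mulC cps_mul1 cps_mulDl cps_1neq0.

Fact cps_const_is_zmod_morphism : zmod_morphism cps_const.
Proof.
move=> c d; apply: cps_ext => m /=; rewrite /const_coef.
by case: ifP => //; rewrite subr0.
Qed.
Fact cps_const_is_monoid_morphism : monoid_morphism cps_const.
Proof.
split=> // c d; apply: cps_ext => m /=; rewrite cauchy_prod_const /const_coef.
by case: ifP => //; rewrite mulr0.
Qed.
HB.instance Definition _ := GRing.isZmodMorphism.Build K cps cps_const
  cps_const_is_zmod_morphism.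
HB.instance Definition _ := GRing.isMonoidMorphism.Build K cps cps_const
  cps_const_is_monoid_morphism.

End ConvergentPowerSeries.

(* In C{x, y}, with x of length n1 and y of length n2: cps_inl f = f(x) and
   cps_inr g = g(y). *)
Section TwoGroupsOfVariables.
Context (K : numFieldType) (n1 n2 : nat).
Local Notation mon := 'X_{1..n1 + n2}.

Definition lmon (m : mon) : 'X_{1..n1} := [multinom m (lshift n2 i) | i < n1].
Definition rmon (m : mon) : 'X_{1..n2} := [multinom m (rshift n1 i) | i < n2].

Lemma mdeg_lrmon (m : mon) : mdeg m = (mdeg (lmon m) + mdeg (rmon m))%N.
Proof.
rewrite !mdegE big_split_ord /=; congr (_ + _)%N;
by apply: eq_bigr => i _; rewrite mnmE.
Qed.

Lemma lrmon_inj (m1 m2 : mon) :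
  lmon m1 = lmon m2 -> rmon m1 = rmon m2 -> m1 = m2.
Proof.
move=> /mnmP l /mnmP r; apply/mnmP => i; rewrite -(splitK i).
case: (split i) => j /=; first by have := l j; rewrite !mnmE.
by have := r j; rewrite !mnmE.
Qed.

Definition inl_coef (f : 'X_{1..n1} -> K) (m : mon) : K :=
  if rmon m == 0%MM then f (lmon m) else 0.
Definition inr_coef (g : 'X_{1..n2} -> K) (m : mon) : K :=
  if lmon m == 0%MM then g (rmon m) else 0.

Lemma convergent_inl (f : cps K n1) : convergent (inl_coef f).
Proof.
case: (cpsP f) => r [M [r0 fM]]; exists r, M; split=> // N.
apply: le_trans (fM N).
have lN (m : 'X_{1..(n1 + n2) < N}) : (mdeg (lmon m) < N)%N.
  by apply: leq_ltn_trans (bmdeg m); rewrite mdeg_lrmon leq_addr.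
rewrite (bigID (fun m : 'X_{1..(n1 + n2) < N} => rmon m == 0%MM)) /=.
rewrite [X in _ + X]big1 ?addr0; last first.
  by move=> m /negPf m0; rewrite /inl_coef m0 normr0 mul0r.
under eq_bigr => m m0 do
  rewrite /inl_coef m0 mdeg_lrmon (eqP m0) mdeg0 addn0.
apply: (@sum_inj_le _ _ _ (fun m : 'X_{1..(n1 + n2) < N} => rmon m == 0%MM)
  (fun m => BMultinom (lN m))
  (fun m : 'X_{1..n1 < N} => `|f m| * r ^+ mdeg m)) => [m1 m2|m].
  rewrite !unfold_in => /eqP k1 /eqP k2 /(congr1 val) /= e.
  by apply/val_inj/lrmon_inj => //; rewrite k1.
by rewrite mulr_ge0 // exprn_ge0 // ltW.
Qed.

Lemma convergent_inr (g : cps K n2) : convergent (inr_coef g).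
Proof.
case: (cpsP g) => r [M [r0 fM]]; exists r, M; split=> // N.
apply: le_trans (fM N).
have lN (m : 'X_{1..(n1 + n2) < N}) : (mdeg (rmon m) < N)%N.
  by apply: leq_ltn_trans (bmdeg m); rewrite mdeg_lrmon leq_addl.
rewrite (bigID (fun m : 'X_{1..(n1 + n2) < N} => lmon m == 0%MM)) /=.
rewrite [X in _ + X]big1 ?addr0; last first.
  by move=> m /negPf m0; rewrite /inr_coef m0 normr0 mul0r.
under eq_bigr => m m0 do
  rewrite /inr_coef m0 mdeg_lrmon (eqP m0) mdeg0 add0n.
apply: (@sum_inj_le _ _ _ (fun m : 'X_{1..(n1 + n2) < N} => lmon m == 0%MM)
  (fun m => BMultinom (lN m))
  (fun m : 'X_{1..n2 < N} => `|g m| * r ^+ mdeg m)) => [m1 m2|m].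
  rewrite !unfold_in => /eqP k1 /eqP k2 /(congr1 val) /= e.
  by apply/val_inj/lrmon_inj => //; rewrite k1.
by rewrite mulr_ge0 // exprn_ge0 // ltW.
Qed.

Definition cps_inl (f : cps K n1) : cps K (n1 + n2) := Cps (convergent_inl f).
Definition cps_inr (g : cps K n2) : cps K (n1 + n2) := Cps (convergent_inr g).

End TwoGroupsOfVariables.

Section Ideals.
Context (E : comPzRingType).
Implicit Types I J S : set E.
Local Open Scope classical_set_scope.

Definition ideal_gen S : set E := [set f | exists k (a g : 'I_k -> E),
  (forall i, S (g i)) /\ f = \sum_(i < k) a i * g i].

Fixpoint ideal_pow I (k : nat) : set E :=
  if k is k'.+1 then ideal_gen [set f * g | f in I & g in ideal_pow I k']
  else setT.

Definition ideal_int_closure I : set E := [set f | exists n (a : nat -> E),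
  [/\ (0 < n)%N, forall i, (0 < i <= n)%N -> ideal_pow I i (a i) &
      f ^+ n + \sum_(1 <= i < n.+1) a i * f ^+ (n - i) = 0]].

Definition is_prime_ideal (P : set E) : Prop :=
  [/\ ideal_gen P `<=` P, ~ P 1 & forall a b, P (a * b) -> P a \/ P b].

Definition prime_chain (l : nat) (P : nat -> set E) : Prop :=
  (forall i, (i <= l)%N -> is_prime_ideal (P i)) /\
  (forall i, (i < l)%N -> P i `<` P i.+1).

Definition krull_dim (d : nat) : Prop :=
  (exists P, prime_chain d P) /\ forall l P, prime_chain l P -> (l <= d)%N.

End Ideals.

(* The quotient of a commutative ring by the ideal generated by a set S; it
   may be the zero ring. *)
Section QuotientRing.
Context (E : comNzRingType) (S : set E).
Local Open Scope quotient_scope.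

Lemma ideal_genD f g : ideal_gen S f -> ideal_gen S g -> ideal_gen S (f + g).
Proof.
move=> [k [a [s [Ss ->]]]] [l [b [t [St ->]]]].
exists (k + l)%N.
exists (fun i => match split i with inl j => a j | inr j => b j end).
exists (fun i => match split i with inl j => s j | inr j => t j end).
split=> [i|]; first by case: (split i).
rewrite big_split_ord /=; congr (_ + _); apply: eq_bigr => i _.
  by case: splitP => j e; [congr (a _ * s _); apply: val_inj|
    have := ltn_ord i; rewrite [X in (X < _)%N]e ltnNge leq_addr].
case: splitP => j /= e; first by have := ltn_ord j; rewrite -e ltnNge leq_addr.
by congr (b _ * t _); apply/val_inj/(@addnI k).
Qed.

Lemma ideal_genMl x f : ideal_gen S f -> ideal_gen S (x * f).
Proof.
move=> [k [a [s [Ss ->]]]]; exists k, (fun i => x * a i), s; split=> //.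
by rewrite mulr_sumr; apply: eq_bigr => i _; rewrite mulrA.
Qed.

Definition gen_pred : {pred E} := fun f => `[< ideal_gen S f >].

Lemma gen_predP f : reflect (ideal_gen S f) (f \in gen_pred).
Proof. exact: asboolP. Qed.

Fact gen_pred_zmod_closed : zmod_closed gen_pred.
Proof.
split=> [|f g /gen_predP Sf /gen_predP Sg]; apply/gen_predP.
  by exists 0%N, (fun=> 0), (fun=> 0); split=> [[]//|]; rewrite big_ord0.
by apply: ideal_genD => //; rewrite -mulN1r; apply: ideal_genMl.
Qed.
HB.instance Definition _ := GRing.isZmodClosed.Build E gen_pred
  gen_pred_zmod_closed.

Definition quot_ring := Quotient.quot (GRing.ZmodClosed.clone E gen_pred _).
HB.instance Definition _ := EqQuotient.on quot_ring.
HB.instance Definition _ := GRing.Zmodule.on quot_ring.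

Definition quot_proj (f : E) : quot_ring := \pi f.

Lemma quot_projE f g : quot_proj f = quot_proj g <-> ideal_gen S (f - g).
Proof.
split=> [/eqP|Sfg]; last apply/eqP.
  by rewrite -Quotient.idealrBE => /gen_predP.
by rewrite -Quotient.idealrBE; apply/gen_predP.
Qed.

Lemma quot_proj_repr (t : quot_ring) : quot_proj (repr t) = t.
Proof. exact: reprK. Qed.

Definition quot_one : quot_ring := quot_proj 1.
Definition quot_mul (s t : quot_ring) : quot_ring :=
  quot_proj (repr s * repr t).

Fact quot_projB : zmod_morphism quot_proj.
Proof.
move=> f g; rewrite /quot_proj (Quotient.pi_add _ f (- g)).
by rewrite (Quotient.pi_opp _ g).
Qed.
HB.instance Definition _ := GRing.isZmodMorphism.Build E quot_ring quot_proj
  quot_projB.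

Lemma quot_projM f g : quot_proj (f * g) = quot_mul (quot_proj f) (quot_proj g).
Proof.
set f' := repr (quot_proj f); set g' := repr (quot_proj g).
have Sf : ideal_gen S (f - f') by apply/quot_projE; rewrite quot_proj_repr.
have Sg : ideal_gen S (g - g') by apply/quot_projE; rewrite quot_proj_repr.
apply/quot_projE.
have -> : f * g - f' * g' = g * (f - f') + f' * (g - g').
  by rewrite !mulrBr addrA [g * f' ]mulrC subrK [g * f]mulrC.
by apply: ideal_genD; apply: ideal_genMl.
Qed.

Fact quot_mulA : associative quot_mul.
Proof.
move=> x y z; rewrite -(quot_proj_repr x) -(quot_proj_repr y).
by rewrite -(quot_proj_repr z) -!quot_projM mulrA.
Qed.
Fact quot_mulC : commutative quot_mul.
Proof. by move=> x y; rewrite /quot_mul mulrC. Qed.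
Fact quot_mul1 : left_id quot_one quot_mul.
Proof.
by move=> x; rewrite -(quot_proj_repr x) /quot_one -quot_projM mul1r.
Qed.
Fact quot_mulDl : left_distributive quot_mul +%R.
Proof.
move=> x y z; rewrite -(quot_proj_repr x) -(quot_proj_repr y).
by rewrite -(quot_proj_repr z) -raddfD -!quot_projM mulrDl raddfD.
Qed.
HB.instance Definition _ := GRing.Zmodule_isComPzRing.Build quot_ring
  quot_mulA quot_mulC quot_mul1 quot_mulDl.

Fact quot_proj_is_monoid_morphism : monoid_morphism quot_proj.
Proof. by split=> // f g; rewrite quot_projM. Qed.
HB.instance Definition _ := GRing.isMonoidMorphism.Build E quot_ring quot_proj
  quot_proj_is_monoid_morphism.

End QuotientRing.

(* phi : C{x_1, .., x_n} -> E is a morphism of C-algebras with image B; it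
   presents B as the analytic algebra C{x_1, .., x_n} / ker phi. *)
Definition presents (K : numFieldType) (E : nzRingType) (iota : K -> E)
    (n : nat) (phi : cps K n -> E) (B : set E) : Prop :=
  (forall c, phi (cps_const n c) = iota c) /\ range phi = B.

(* Given presentations psi1, psi2 of analytic algebras B1, B2 and morphisms
   p : D -> B1, q : D -> B2, this is the analytic tensor product of B1 and B2
   over D, i.e. the algebra of the fibre product of the germs: the quotient of
   C{x, y} by the ideal generated by all h1(x) - h2(y) such that h1 and h2
   represent p a and q a for the same a in D. For a = 0 one obtains all h1(x)
   and h2(y) with h1 in ker psi1 and h2 in ker psi2. *)
Section AnalyticTensor.
Context (K : numFieldType) (E1 E2 : nzRingType) (n1 n2 : nat).
Context (psi1 : cps K n1 -> E1) (psi2 : cps K n2 -> E2).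
Context (D : Type) (p : D -> E1) (q : D -> E2).
Local Open Scope classical_set_scope.

Definition antensor_rel : set (cps K (n1 + n2)) :=
  [set F | exists a h1 h2,
    [/\ psi1 h1 = p a, psi2 h2 = q a & F = cps_inl n2 h1 - cps_inr n1 h2]].

Definition antensor := quot_ring antensor_rel.

End AnalyticTensor.

HB.instance Definition _ (K : numFieldType) (E1 E2 : nzRingType) (n1 n2 : nat)
    (psi1 : cps K n1 -> E1) (psi2 : cps K n2 -> E2) (D : Type)
    (p : D -> E1) (q : D -> E2) :=
  GRing.ComPzRing.on (antensor psi1 psi2 p q).

Section LipschitzSaturation.
Context (R : realType) (A : idomainType) (iota : {rmorphism R[i] -> A}).
Local Open Scope classical_set_scope.
Local Notation Kfrac := {fraction A}.

Definition iota_frac : R[i] -> Kfrac := @tofrac A \o iota.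
HB.instance Definition _ := GRing.RMorphism.copy iota_frac (@tofrac A \o iota).

Definition normalization : set Kfrac :=
  [set f | integralOver (@tofrac A) f].

Definition smooth_normalization : Prop :=
  exists e (phi : {rmorphism cps R[i] e -> Kfrac}),
    presents iota_frac phi normalization /\ injective phi.

Section Double.
Context (n : nat) (psi : {rmorphism cps R[i] n -> Kfrac}).

Definition tensorC := antensor psi psi iota_frac iota_frac.
Definition tensorA := antensor psi psi (@tofrac A) (@tofrac A).

(* Induced by the identity of C{x, y}, see tensor_surjE. *)
Definition tensor_surj (t : tensorC) : tensorA :=
  quot_proj (antensor_rel psi psi (@tofrac A) (@tofrac A)) (repr t).

Definition I_Delta : set tensorC := [set t | tensor_surj t = 0].

(* For f = psi h, the class of h(x) - h(y) is f (x) 1 - 1 (x) f. *)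
Definition diff_tensor (h : cps R[i] n) : tensorC :=
  quot_proj (antensor_rel psi psi iota_frac iota_frac)
    (cps_inl n h - cps_inr n h).

Lemma tensor_surjE F :
  tensor_surj (quot_proj (antensor_rel psi psi iota_frac iota_frac) F) =
  quot_proj (antensor_rel psi psi (@tofrac A) (@tofrac A)) F.
Proof.
apply/quot_projE.
have [k [a [g [Sg ->]]]] : ideal_gen (antensor_rel psi psi iota_frac iota_frac)
    (repr (quot_proj (antensor_rel psi psi iota_frac iota_frac) F) - F).
  by apply/quot_projE; rewrite quot_proj_repr.
exists k, a, g; split=> // i.
by have [c [h1 [h2 [e1 e2 ->]]]] := Sg i; exists (iota c), h1, h2.
Qed.

End Double.
Arguments diff_tensor {n} psi h.
Arguments I_Delta {n} psi _.

(* The condition on f does not depend on the presentation psi of the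
   normalization. *)
Definition lipschitz_saturation : set Kfrac :=
  [set f | normalization f /\
    exists n (psi : {rmorphism cps R[i] n -> Kfrac}) h,
      [/\ presents iota_frac psi normalization, psi h = f &
          ideal_int_closure (I_Delta psi) (diff_tensor psi h)]].

End LipschitzSaturation.
Arguments diff_tensor {R A iota n} psi h.
Arguments I_Delta {R A iota n} psi _.

Section Toric.
Context (R : realType) (d n : nat) (gamma : 'I_n -> 'rV[int]_d).
Local Open Scope classical_set_scope.

Definition real_cone (v : 'rV[R]_d) : Prop := exists r : 'I_n -> R,
  (forall i, 0 <= r i) /\ v = \sum_(i < n) r i *: map_mx intr (gamma i).

(* The gamma_i generate a semigroup as required of Gamma. They are nonzero,
   so that z_i |-> t^gamma_i is defined on power series (the origin belongs to
   X_Gamma); every such semigroup has nonzero generators. *)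
Definition toric_generators : Prop :=
  [/\ forall i, gamma i != 0,
      forall e : 'rV[int]_d, exists k : 'I_n -> int,
        e = \sum_(i < n) k i *: gamma i &
      forall v : 'rV[R]_d, real_cone v -> real_cone (- v) -> v = 0].

(* The coefficients of the image of f in C[[Gamma]] under z_i |-> t^gamma_i,
   extended by zero to Z^d. The sum is finite under toric_generators. *)
Definition toric_series (f : cps R[i] n) (e : 'rV[int]_d) : R[i] :=
  \sum_(m \in [set m : 'X_{1..n} | \sum_(i < n) gamma i *+ m i = e]) f m.

End Toric.

(* B, a subalgebra of the C-algebra E, is isomorphic to C{Gamma} for some
   Gamma: there is a surjection phi : C{z_1, .., z_n} -> B with the same fibres
   as the surjection C{z_1, .., z_n} -> C{Gamma}, z_i |-> t^gamma_i. *)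
Definition toric_algebra (R : realType) (E : nzRingType) (iota : R[i] -> E)
    (B : set E) : Prop :=
  exists d n (gamma : 'I_n -> 'rV[int]_d) (phi : {rmorphism cps R[i] n -> E}),
    [/\ toric_generators R gamma, presents iota phi B &
        forall f g, phi f = phi g <-> toric_series gamma f = toric_series gamma g].

(* Main.v *)
Require Import Defs.
From mathcomp Require Import all_boot all_order all_algebra.
From mathcomp Require Import generic_quotient cyclic separable cyclotomic.
From mathcomp Require Import boolp classical_sets fsbigop reals complex mpoly.
From mathcomp Require Import zify ring.
From HB Require Import structures.

(** Let [A = C{Gamma}] be the given algebra. The proof shows that in suitable
    coordinates the normalization is [C{t}], with [t = (t_1, .., t_k)] and
    [Gamma] inside [N^k], that membership of a series in the Lipschitz
    saturation can be tested monomial by monomial, and that the monomials in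
    it form a finitely generated semigroup.

    Coordinates. A strongly convex cone has a linear form positive on its
    generators ([gordan]), so [Gamma] embeds in some [N^q] and [A] becomes the
    ring of convergent power series in [C{y_1, .., y_q}] supported on [Gamma]
    ([toric_embedding], [monomial_subst_lift]). The ring [C{y}] is completely
    integrally closed: this follows from division with remainder by one power
    series ([division], [cps_normal]). Hence the normalization of [A] also
    consists of power series in [y], and a leading-term argument with Dickson's
    lemma bounds their supports by the saturation [S] of [Gamma]
    ([integral_series]).

    Smoothness makes [S] free. If the normalization is [C{x_1, .., x_e}], the
    monomials [y^h] with [h] irreducible in [S] are power series in [x] whose
    linear parts are linearly independent, because no [y^h] occurs in a product
    of two elements of the maximal ideal. So there are at most [e] of them, and
    a relation between irreducible elements would give two equal products of
    these power series, which is refuted by comparing orders of vanishing along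
    a line ([free_monoid]). Thus [S] is [N^k], the normalization is [C{t}], and
    [Gamma] contains all multiples of some [N] in [N^k]
    ([normalization_coordinates], [common_multiple]).

    Homogeneity. Let [J] be the ideal of [C{t, t'}] generated by the
    [a(t) - a(t')] with [a] in [A]. By substitution of power series, the
    condition defining the saturation, for whatever presentation of the
    normalization, says that [f(t) - f(t')] is integral over [J]
    ([lipschitz_sub_saturation], [saturation_sub_lipschitz]). The integral
    closure of [J] is an ideal, by the Rees algebra ([int_closure_rees]), and
    it is stable under the diagonal action of the torus. Averaging [f] over the
    [p]-th roots of unity, with [p] a large multiple of [N], isolates a part
    [f_m t^m + ..] that equals [t^m u] for a unit [u] of [A]; hence [t^m] is in
    the saturation whenever it occurs in [f] ([lipschitz_monomial]). Dickson's
    lemma yields finitely many monomials generating all of them over the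
    multiples of [N], which gives the converse ([lipschitzE]) and a finite set
    of generators ([lipschitz_semigroup_generated]). *)

Set Implicit Arguments.
Unset Strict Implicit.
Unset Printing Implicit Defensive.

Import Order.TTheory GRing.Theory Num.Theory.
Local Open Scope ring_scope.

(** * Coefficients of convergent power series *)

Section Coefficients.
Context (K : numFieldType) (n : nat).
Implicit Types (f g h : cps K n) (a b m : 'X_{1..n}).

Lemma cps0E m : (0 : cps K n) m = 0.
Proof. by rewrite /= /const_coef if_same. Qed.

Lemma cps1E m : (1 : cps K n) m = (m == 0%MM)%:R.
Proof. by rewrite /= /const_coef; case: ifP. Qed.

Lemma cpsDE f g m : (f + g) m = f m + g m. Proof. by []. Qed.
Lemma cpsNE f m : (- f) m = - f m. Proof. by []. Qed.
Lemma cpsBE f g m : (f - g) m = f m - g m. Proof. by []. Qed.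

Lemma cps_sumE (I : Type) (r : seq I) (P : pred I) (F : I -> cps K n) m :
  (\sum_(i <- r | P i) F i) m = \sum_(i <- r | P i) F i m.
Proof.
by elim/big_rec2: _ => [|i x y _ <-]; rewrite ?cps0E.
Qed.

Lemma cpsME f g m : (f * g) m =
  \sum_(k : 'X_{1..n < (mdeg m).+1} | (k <= m)%MM) f k * g (m - k)%MM.
Proof. by []. Qed.

Lemma cps_constE c m : cps_const n c m = if m == 0%MM then c else 0 :> K.
Proof. by []. Qed.

Lemma cps_constME c f m : (cps_const n c * f) m = c * f m.
Proof. exact: cauchy_prod_const. Qed.

Lemma cpsM0E f g : (f * g) 0%MM = f 0%MM * g 0%MM.
Proof.
rewrite cpsME (bigD1 (BMultinom (bm0_proof n (mdeg (0%MM : 'X_{1..n}))))) /=.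
  rewrite subm0 big1 ?addr0 // => k /andP[k0].
  rewrite -val_eqE /= => /eqP []; apply/mnmP => i.
  by have /mnm_lepP/(_ i) := k0; rewrite mnm0E leqn0 => /eqP ->.
exact: lepm_refl.
Qed.

Lemma cpsX0E f (k : nat) : (f ^+ k) 0%MM = f 0%MM ^+ k.
Proof. by elim: k => [|k IH]; rewrite ?cps1E ?eqxx // !exprS cpsM0E IH. Qed.

Lemma convergent_dominated (f g : 'X_{1..n} -> K) :
  (forall m, `|g m| <= `|f m|) -> convergent f -> convergent g.
Proof.
move=> gf [r [M [r0 fM]]]; exists r, M; split=> // N.
apply: le_trans (fM N); apply: ler_sum => k _.
by rewrite ler_wpM2r // exprn_ge0 // ltW.
Qed.

Lemma convergent_delta a : convergent (fun m => (m == a)%:R : K).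
Proof.
exists 1, 1; split=> // N; under eq_bigr do rewrite expr1n mulr1.
have [aN|aN] := boolP (mdeg a < N)%N.
  rewrite (bigD1 (BMultinom aN)) //= eqxx normr1 big1 ?addr0 // => k.
  by rewrite -val_eqE /= => /negPf ->; rewrite normr0.
rewrite big1 // => k _; case: eqP => [e|_]; last by rewrite normr0.
by have := bmdeg k; rewrite e (negPf aN).
Qed.

Definition cpsX a : cps K n := Cps (convergent_delta a).

Lemma cpsXE a m : cpsX a m = (m == a)%:R. Proof. by []. Qed.

Lemma cpsXME a f m : (cpsX a * f) m = if (a <= m)%MM then f (m - a)%MM else 0.
Proof.
rewrite cpsME; case: ifP => am; last first.
  rewrite big1 // => k km; rewrite cpsXE; case: eqP => [e|]; last by rewrite mul0r.
  by rewrite e am in km.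
have aN : (mdeg a < (mdeg m).+1)%N by rewrite ltnS -(submK am) mdegD leq_addl.
rewrite (bigD1 (BMultinom aN)) //= eqxx mul1r big1 ?addr0 // => k /andP[_].
by rewrite -val_eqE /= => /negPf ->; rewrite mul0r.
Qed.

Lemma cpsX_add a b : cpsX (a + b)%MM = cpsX a * cpsX b.
Proof.
apply: cps_ext => m; rewrite cpsXME !cpsXE; case: ifP => am.
  by rewrite -(eqm_add2l a (m - a)%MM b) [(a + (m - a))%MM]addmC submK.
by case: eqP => // e; rewrite e lem_addr in am.
Qed.

Lemma cpsX0 : cpsX 0%MM = 1.
Proof. by apply: cps_ext => m; rewrite cps1E. Qed.

Lemma cpsX_sum (I : finType) (a : I -> nat) (b : I -> 'X_{1..n}) :
  cpsX (\sum_i b i *+ a i)%MM = \prod_i cpsX (b i) ^+ a i.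
Proof.
have XMn (c : 'X_{1..n}) k : cpsX (c *+ k)%MM = cpsX c ^+ k.
  elim: k => [|k IH]; first by rewrite mulm0n cpsX0.
  by rewrite mulmS cpsX_add IH exprS.
elim/big_rec2: _ => [|i x y _ <-]; first exact: cpsX0.
by rewrite cpsX_add XMn.
Qed.

Lemma convergent_restrict (P : 'X_{1..n} -> Prop) f :
  convergent (fun m => if `[< P m >] then f m else 0).
Proof.
apply: convergent_dominated (cpsP f) => m.
by case: asboolP => // _; rewrite normr0.
Qed.
Definition cps_restrict P f := Cps (convergent_restrict P f).

Lemma convergent_shift a f : convergent (fun m => f (a + m)%MM).
Proof.
case: (cpsP f) => r [M [r0 fM]]; have ra : 0 < r ^+ mdeg a by rewrite exprn_gt0.
exists r, (M / r ^+ mdeg a); split=> // N; rewrite ler_pdivlMr //.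
apply: le_trans (fM (mdeg a + N)%N); rewrite mulr_suml.
have aN (m : 'X_{1..n < N}) : (mdeg (a + m)%MM < mdeg a + N)%N.
  by rewrite mdegD ltn_add2l bmdeg.
pose b (m : 'X_{1..n < mdeg a + N}) := `|f m| * r ^+ mdeg m.
apply: (@le_trans _ _ (\sum_(m : 'X_{1..n < N}) b (BMultinom (aN m)))).
  by apply: ler_sum => m _; rewrite /b /= mdegD exprD mulrA mulrAC.
apply: sum_inj_le => [m1 m2 _ _ /(congr1 val)/= /addmI e|m].
  exact: val_inj.
by rewrite mulr_ge0 // exprn_ge0 // ltW.
Qed.
Definition cps_shift a f := Cps (convergent_shift a f).

Lemma cps_shiftE a f m : cps_shift a f m = f (a + m)%MM. Proof. by []. Qed.

Definition supported (f : cps K n) (S : set 'X_{1..n}) : Prop :=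
  forall m, f m != 0 -> S m.

Lemma supportedD f g S : supported f S -> supported g S -> supported (f + g) S.
Proof.
move=> fS gS m; rewrite cpsDE.
have [f0|/fS//] := eqVneq (f m) 0; rewrite f0 add0r; exact: gS.
Qed.

Lemma supportedM f g (S T U : set 'X_{1..n}) :
    (forall a b, S a -> T b -> U (a + b)%MM) ->
  supported f S -> supported g T -> supported (f * g) U.
Proof.
move=> ST fS gT m; rewrite cpsME => /eqP fg.
apply: contrapT => Um; apply: fg; rewrite big1 // => k km.
have [->|/fS Sk] := eqVneq (f k) 0; first by rewrite mul0r.
have [->|/gT Tk] := eqVneq (g (m - k)%MM) 0; first by rewrite mulr0.
by case: Um; rewrite -(submK km) addmC; apply: ST.
Qed.

(** Every exponent of [f] is charged to the first [u_j] such that it lies in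
    [u_j + Q]. With the variables for [u] this factors a series through the
    maximal ideal; with a finite part of a semigroup it makes a ring of series
    a finite module. *)
Lemma split_support (u : seq 'X_{1..n}) (Q : set 'X_{1..n}) f :
    supported f [set m | exists2 a, a \in u & (a <= m)%MM /\ Q (m - a)%MM]%classic ->
  exists F : nat -> cps K n, (forall j, supported (F j) Q) /\
    f = \sum_(j < size u) cpsX (nth 0%MM u j) * F j.
Proof.
elim: u f => [|a u IH] f fu.
  exists (fun=> 0); split=> [a m|]; first by rewrite cps0E eqxx.
  rewrite big_ord0; apply: cps_ext => m; rewrite cps0E; apply/eqP/negP => /negP.
  by move/fu => [].
pose P m := (a <= m)%MM /\ Q (m - a)%MM.
have [] := IH (cps_restrict (fun m => ~ P m) f).
  move=> m /=; case: asboolP => [nP|_]; last by rewrite eqxx.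
  by case/fu => b; rewrite inE => /predU1P[->|bu] // Pb; exists b.
move=> F [FQ fE].
exists (fun j => if j is j'.+1 then F j' else cps_restrict Q (cps_shift a f)).
split=> [[|j]|]; last 1 first.
- rewrite big_ord_recl /= -fE; apply: cps_ext => m; rewrite cpsDE cpsXME /=.
  rewrite /P; case: ifP => am /=.
    rewrite [(a + _)%MM]addmC submK //.
    case: (asboolP (Q _)) => Qm; case: asboolP => // nP; rewrite ?addr0 ?add0r //.
      by case: nP.
    by case: nP => -[].
  by case: asboolP => [_|[]]; rewrite ?add0r // => -[].
- by move=> m /=; case: asboolP => // _; rewrite eqxx.
- exact: FQ.
Qed.

(** The order of the exponents compares degrees first, so it is well-founded
    with finite initial segments, and it is compatible with addition. *)
Definition lead f m := f m != 0 /\ forall k, (k < m)%O -> f k = 0.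

Lemma lead_exists f : f <> 0 -> exists m, lead f m.
Proof.
move=> f0; apply: contrapT => nol; apply: f0; apply: cps_ext => m.
rewrite cps0E; move: m.
apply: (@ltmwf n (fun m => f m = 0)) => m IH.
apply/eqP; apply: contrapT => /negP fm.
by apply: nol; exists m.
Qed.

Lemma leadM f g a b : lead f a -> lead g b ->
  (f * g) (a + b)%MM = f a * g b /\ lead (f * g) (a + b)%MM.
Proof.
move=> [fa fl] [gb gl].
have coefE m : (m <= (a + b)%MM)%O -> (f * g) m = (m == (a + b)%MM)%:R * (f a * g b).
  move=> mab; rewrite cpsME.
  have z (k : 'X_{1..n < (mdeg m).+1}) : (k <= m)%MM ->
      ~ (k = a :> 'X_{1..n} /\ (m - k)%MM = b) -> f k * g (m - k)%MM = 0.
    move=> km kab; have [/fl->|ak] := ltP (k : 'X_{1..n}) a; first by rewrite mul0r.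
    have [/gl->|bk] := ltP (m - k)%MM b; first by rewrite mulr0.
    case: kab; have e : (k + (m - k))%MM = m by rewrite addmC submK.
    have := ak; rewrite le_eqVlt => /predU1P[ea|ak'].
      split=> //; move: bk; rewrite le_eqVlt => /predU1P[//|bk].
      by have := lemc_lt_add ak bk; rewrite e ltNge mab.
    by have := ltmc_le_add ak' bk; rewrite e ltNge mab.
  case: eqP => [e|ne]; last first.
    rewrite mul0r big1 // => k km; apply: z => // -[ka mk]; apply: ne.
    by rewrite -ka -mk addmC submK.
  have aN : (mdeg a < (mdeg m).+1)%N by rewrite ltnS e mdegD leq_addr.
  rewrite (bigD1 (BMultinom aN)) /=; last by rewrite e lem_addr.
  have -> : (m - a)%MM = b by rewrite e addmC addmK.
  rewrite mul1r big1 ?addr0 // => k /andP[km].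
  by rewrite -val_eqE /= => /eqP ka; apply: z => // -[].
split; first by rewrite coefE // eqxx mul1r.
split; first by rewrite coefE // eqxx mul1r mulf_neq0.
by move=> k kab; rewrite coefE ?ltW // lt_eqF // mul0r.
Qed.

Lemma lead1 : lead 1 0%MM.
Proof.
split=> [|k]; first by rewrite cps1E eqxx oner_neq0.
by rewrite ltNge le0m.
Qed.

Lemma leadX f a k : lead f a -> lead (f ^+ k) (a *+ k)%MM.
Proof.
move=> fa; elim: k => [|k IH]; first by rewrite mulm0n; exact: lead1.
by rewrite mulmS exprS; case: (leadM fa IH).
Qed.

Lemma lead_neq0 f a : lead f a -> f <> 0.
Proof. by case=> /eqP fa _ f0; apply: fa; rewrite f0 cps0E. Qed.

Lemma lead_uniq f a b : lead f a -> lead f b -> a = b.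
Proof.
move=> [fa fl] [gb gl]; case: (ltgtP a b) => // [/gl/eqP|/fl/eqP].
  by rewrite (negPf fa).
by rewrite (negPf gb).
Qed.

Lemma cps_mul_neq0 f g : f <> 0 -> g <> 0 -> f * g <> 0.
Proof.
move=> /lead_exists[a fa] /lead_exists[b gb].
by case: (leadM fa gb) => _ /lead_neq0.
Qed.

Lemma cps_mulfI f g h : f <> 0 -> f * g = f * h -> g = h.
Proof.
move=> f0 /eqP; rewrite -subr_eq0 -mulrBr => /eqP e; apply/eqP.
rewrite -subr_eq0; apply/eqP; apply: contrapT => gh.
exact: cps_mul_neq0 f0 gh e.
Qed.

End Coefficients.

(** * Division with remainder and complete integral closedness *)

Section WeightedNorm.
Context (K : numFieldType) (n : nat) (l : 'I_n -> nat).
Implicit Types (f g h : cps K n) (a b m : 'X_{1..n}).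

Definition weight m := (\sum_i m i * l i)%N.

Lemma weightD a b : weight (a + b)%MM = (weight a + weight b)%N.
Proof.
by rewrite /weight -big_split; apply: eq_bigr => i _; rewrite mnmDE mulnDl.
Qed.

(** Partial sums of the norm of [f] on the polydisc of polyradius
    [(s ^ l_1, .., s ^ l_n)]. *)
Definition wsum (s : K) (N : nat) f :=
  \sum_(k : 'X_{1..n < N}) `|f k| * s ^+ weight k.

Lemma wsum_ge0 s N f : 0 <= s -> 0 <= wsum s N f.
Proof. by move=> s0; apply: sumr_ge0 => k _; rewrite mulr_ge0 ?exprn_ge0. Qed.

Lemma wsumD s N f g : 0 <= s -> wsum s N (f + g) <= wsum s N f + wsum s N g.
Proof.
move=> s0; rewrite -big_split /=; apply: ler_sum => k _.
by rewrite -mulrDl ler_wpM2r ?exprn_ge0 ?ler_normD.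
Qed.

Lemma wsumN s N f : wsum s N (- f) = wsum s N f.
Proof. by apply: eq_bigr => k _; rewrite cpsNE normrN. Qed.

Lemma wsum_const s N c f : wsum s N (cps_const n c * f) = `|c| * wsum s N f.
Proof.
by rewrite mulr_sumr; apply: eq_bigr => k _; rewrite cps_constME normrM mulrA.
Qed.

Lemma wsumM s N f g : 0 <= s -> wsum s N (f * g) <= wsum s N f * wsum s N g.
Proof.
move=> s0; have sn0 k : 0 <= s ^+ k by rewrite exprn_ge0.
pose t (f : cps K n) m := `|f m| * s ^+ weight m.
have t0 f' k : 0 <= t f' k by rewrite mulr_ge0.
apply: (@le_trans _ _ (\sum_(m : 'X_{1..n < N})
   \sum_(k : 'X_{1..n < N} | (k <= m)%MM) t f k * t g (m - k)%MM)).
  apply: ler_sum => m _.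
  have -> : (f * g) m = \sum_(k : 'X_{1..n < N} | (k <= m)%MM) f k * g (m - k)%MM.
    pose tr (f : cps K n) : {mpoly K[n]} := \sum_(k : 'X_{1..n < N}) f k *: 'X_[k].
    have trE (f' : cps K n) k : (mdeg k < N)%N -> (tr f')@_k = f' k.
      by move=> kN; rewrite mcoeff_mpoly.
    rewrite -[LHS](@cauchy_prod_mpoly _ _ N _ _ (tr f) (tr g)) ?bmdeg //;
      try by move=> k; apply: trE.
    rewrite (@mcoeff_poly_mul_lin _ _ _ _ _ N) ?bmdeg //.
    apply: eq_bigr => k km; rewrite !trE ?bmdeg //.
    by rewrite (leq_ltn_trans _ (bmdeg m)) // mdegB.
  apply: le_trans (ler_wpM2r (sn0 _) (ler_norm_sum _ _ _)) _.
  rewrite mulr_suml; apply: ler_sum => k km.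
  by rewrite -{2}(submK km) addmC weightD exprD normrM /t mulrACA.
rewrite (exchange_big_dep xpredT) //= [leRHS]mulr_suml.
apply: ler_sum => k _; rewrite -mulr_sumr ler_wpM2l // /wsum.
have mB (m : 'X_{1..n < N}) : (mdeg (m - k)%MM < N)%N.
  by rewrite (leq_ltn_trans _ (bmdeg m)) // mdegB.
apply: (@sum_inj_le _ _ _ (fun m : 'X_{1..n < N} => (k <= m)%MM)
  (fun j => BMultinom (mB j)) (fun m : 'X_{1..n < N} => t g m)) => // m1 m2.
rewrite !unfold_in => k1 k2 /(congr1 val) /= e.
by apply/val_inj => /=; rewrite -(submK k1) -(submK k2) e.
Qed.

Lemma wsum_shift s N a f : 0 <= s ->
  wsum s N (cps_shift a f) * s ^+ weight a <= wsum s (mdeg a + N) f.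
Proof.
move=> s0; rewrite mulr_suml.
have aN (m : 'X_{1..n < N}) : (mdeg (a + m)%MM < mdeg a + N)%N.
  by rewrite mdegD ltn_add2l bmdeg.
pose b (m : 'X_{1..n < mdeg a + N}) := `|f m| * s ^+ weight m.
apply: (@le_trans _ _ (\sum_(m : 'X_{1..n < N}) b (BMultinom (aN m)))).
  by apply: ler_sum => m _; rewrite /b /= weightD exprD mulrA mulrAC.
apply: sum_inj_le => [m1 m2 _ _ /(congr1 val)/= /addmI e|m].
  exact: val_inj.
by rewrite mulr_ge0 // exprn_ge0.
Qed.

Lemma convergent_wsum (s B : K) (f : 'X_{1..n} -> K) : 0 < s -> s <= 1 ->
    (forall N, \sum_(k : 'X_{1..n < N}) `|f k| * s ^+ weight k <= B) ->
  convergent f.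
Proof.
move=> s0 s1 fB; pose L := (\sum_i l i)%N.
exists (s ^+ L), B; split=> [|N]; first by rewrite exprn_gt0.
apply: le_trans (fB N); apply: ler_sum => k _; rewrite ler_wpM2l //.
rewrite -exprM; apply: ler_wiXn2l => //; first exact: ltW.
rewrite /weight mdegE big_distrr; apply: leq_sum => i _ /=.
by rewrite mulnC leq_mul2r /L (bigD1 i) //= leq_addr orbT.
Qed.

End WeightedNorm.

Lemma wsum_mdeg (K : numFieldType) n (s : K) N (f : cps K n) :
  \sum_(k : 'X_{1..n < N}) `|f k| * s ^+ mdeg k = wsum (fun=> 1%N) s N f.
Proof.
apply: eq_bigr => k _; rewrite /weight mdegE; congr (_ * _ ^+ _).
by apply: eq_bigr => i _; rewrite muln1.
Qed.

(** The summand [L] of the weights makes the degree dominate; among the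
    monomials of the degree of [a], powers of a base larger than this degree
    compare lexicographically. *)
Lemma separating_weight n (a : 'X_{1..n}) : exists l : 'I_n -> nat,
  (forall i, 0 < l i)%N /\ forall b, (a < b)%O -> (weight l a < weight l b)%N.
Proof.
pose B := (mdeg a).+1; pose L := (mdeg a * B ^ n).+1.
exists (fun i : 'I_n => L + B ^ (n - i))%N; split=> [i|b ab]; first by [].
have wE (m : 'X_{1..n}) : weight (fun i : 'I_n => L + B ^ (n - i))%N m =
    (L * mdeg m + \sum_i m i * B ^ (n - i))%N.
  rewrite /weight mdegE big_distrr -big_split; apply: eq_bigr => i _ /=.
  by rewrite mulnDr mulnC.
have := lemc_mdeg (ltW ab); rewrite !wE leq_eqVlt => /predU1P[e|lt_ab].
  have [i ji ai] := ltmcP e ab.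
  rewrite e ltn_add2l.
  rewrite [X in (X < _)%N](bigID (fun j : 'I_n => (j < i)%N)) /=.
  rewrite [X in (_ < X)%N](bigID (fun j : 'I_n => (j < i)%N)) /=.
  rewrite -(eq_bigr _ (fun j ji' => congr1 (muln^~ _) (ji j ji'))) ltn_add2l.
  rewrite [X in (_ < X)%N](bigD1 i) ?ltnn //=.
  rewrite [X in (X < _)%N](bigD1 i) ?ltnn //=.
  apply: leq_trans (leq_addr _ _).
  apply: (@leq_trans ((a i).+1 * B ^ (n - i))); last by rewrite leq_mul2r ai orbT.
  rewrite mulSn addnC ltn_add2r.
  apply: (@leq_ltn_trans (mdeg a * B ^ (n - i).-1)).
    rewrite mdegE big_distrl /= [leqRHS](bigID (fun j : 'I_n => ~~ (j < i)%N && (j != i))) /=.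
    apply: leq_trans (leq_addr _ _); apply: leq_sum => j /andP[ij nij].
    rewrite leq_mul2l; apply/orP; right; apply: leq_pexp2l => //.
    have : (i < j)%N by rewrite ltn_neqAle eq_sym nij leqNgt.
    by have := ltn_ord j; lia.
  have -> : (n - i)%N = ((n - i).-1).+1 by have := ltn_ord i; lia.
  by rewrite expnS /= ltn_mul2r /B ltnSn expn_gt0.
apply: (@leq_trans (L * (mdeg a).+1)); last first.
  by apply: leq_trans (leq_addr _ _); rewrite leq_mul2l lt_ab orbT.
rewrite mulnS addnC ltn_add2r /L ltnS mdegE big_distrl; apply: leq_sum => i _ /=.
by rewrite leq_mul2l leq_pexp2l ?leq_subr ?orbT.
Qed.

Section Division.
Context (K : numFieldType) (n : nat).
Implicit Types (f g p q r c : cps K n) (a b m : 'X_{1..n}).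

(** Shrinking the polyradius [(s ^ l_1, .., s ^ l_n)] by a factor [th] on [s]
    multiplies the leading term by [th ^ weight l a] and every other term by
    at least one more factor [th]. *)
Lemma lead_dominates p q a : lead q a -> exists (l : 'I_n -> nat) (s P : K),
  [/\ 0 < s, s <= 1, forall N, wsum l s N p <= P,
    (forall b, q b != 0 -> b != a -> (weight l a < weight l b)%N) &
    forall N, wsum l s N (q - cps_const n (q a) * cpsX K a) <=
      `|q a| * s ^+ weight l a / 2].
Proof.
move=> [qa ql].
have [r [P [M [r0 pP qM]]]] := convergent2 (cpsP p) (cpsP q).
have [l [l0 lab]] := separating_weight a.
have la b : q b != 0 -> b != a -> (weight l a < weight l b)%N.
  move=> qb ba; apply: lab; rewrite lt_neqAle eq_sym ba leNgt.
  by apply/negP => /ql /eqP; rewrite (negPf qb).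
have wl m : (mdeg m <= weight l m)%N.
  by rewrite mdegE; apply: leq_sum => i _; rewrite leq_pmulr.
pose s0 := r / (1 + r).
have r1 : 0 < 1 + r by rewrite addr_gt0.
have s00 : 0 < s0 by rewrite divr_gt0.
have s01 : s0 <= 1 by rewrite ler_pdivrMr // mul1r lerDr.
have s0r : s0 <= r by rewrite ler_pdivrMr // ler_peMr ?lerDl // ltW.
have ws (s : K) N f : 0 < s -> s <= s0 ->
    wsum l s N f <= \sum_(k : 'X_{1..n < N}) `|f k| * r ^+ mdeg k.
  move=> sp ss; apply: ler_sum => k _; rewrite ler_wpM2l //.
  apply: (@le_trans _ _ (s ^+ mdeg k)).
    by apply: ler_wiXn2l; rewrite ?wl ?(le_trans ss) //; apply: ltW.
  by apply: lerXn2r; rewrite ?nnegrE ?(le_trans ss) //; apply: ltW.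
pose C := `|q a| * s0 ^+ weight l a.
have C0 : 0 < C by rewrite mulr_gt0 ?normr_gt0 ?exprn_gt0.
have M0 : 0 <= M.
  apply: le_trans (qM 0%N); apply: sumr_ge0 => k _.
  by rewrite mulr_ge0 ?exprn_ge0 //; apply: ltW.
pose th := C / (2 * (M + C)).
have MC : 0 < M + C by rewrite ltr_wpDl.
have MC2 : 0 < 2 * (M + C) by rewrite mulr_gt0.
have th0 : 0 < th by rewrite divr_gt0.
have th1 : th <= 1.
  rewrite ler_pdivrMr // mul1r mulr_natl mulr2n.
  by rewrite (le_trans _ (_ : M + C <= _)) ?lerDr ?lerDl // ltW.
have thM : th * M <= C / 2.
  rewrite /th invfM mulrA mulrAC ler_pdivrMr // ler_wpM2l ?divr_ge0 ?ltW //.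
  by rewrite ltrDl.
have ss0 : s0 * th <= s0 by rewrite ler_piMr // ltW.
clearbody th; exists l, (s0 * th), P; split=> //.
- by rewrite mulr_gt0.
- by rewrite (le_trans ss0).
- by move=> N; apply: le_trans (ws _ _ _ _ ss0) (pP N); rewrite mulr_gt0.
move=> N; rewrite exprMn mulrA -/C.
apply: (@le_trans _ _ (th ^+ (weight l a).+1 * wsum l s0 N q)).
  rewrite mulr_sumr; apply: ler_sum => k _.
  rewrite cpsBE cps_constME cpsXE.
  have [ka|ka] := eqVneq (k : 'X_{1..n}) a.
    rewrite ka mulr1 subrr normr0 mul0r.
    apply: mulr_ge0; first exact/exprn_ge0/ltW.
    by apply: mulr_ge0 => //; apply/exprn_ge0/ltW.
  rewrite mulr0 subr0 exprMn; have [->|qk] := eqVneq (q k) 0.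
    by rewrite normr0 !mul0r mulr0.
  rewrite [leRHS]mulrCA ler_wpM2l // mulrC ler_wpM2r ?exprn_ge0 ?(ltW s00) //.
  by apply: ler_wiXn2l; rewrite ?(ltW th0) ?la.
apply: (@le_trans _ _ (th ^+ (weight l a).+1 * M)).
  rewrite ler_wpM2l ?exprn_ge0 ?(ltW th0) //.
  exact: le_trans (ws _ _ _ s00 (lexx _)) (qM N).
by rewrite exprSr -mulrA [leRHS]mulrAC [leRHS]mulrC ler_wpM2l ?exprn_ge0 ?(ltW th0).
Qed.

(** The quotient is the fixed point of [r = (p - q' r) / (q_a x^a)], where [q']
    is [q] without its leading term and division by [x^a] drops the monomials
    that are not multiples of [x^a]. This operator is a contraction for the
    weights of [lead_dominates], so its iterates stabilize coefficient by
    coefficient, and it preserves a bound on the norm, so their limit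
    converges. *)
Lemma division p q a : lead q a ->
  exists r, forall m, (a <= m)%MM -> (p - q * r) m = 0.
Proof.
move=> qa; have [l [s [P [s0 s1 pP la qs]]]] := lead_dominates p qa.
have qa0 : q a != 0 by case: qa.
set q' := q - _ in qs.
have q'E b : q' b != 0 -> (weight l a < weight l b)%N.
  rewrite cpsBE cps_constME cpsXE; have [->|ba] := eqVneq b a.
    by rewrite mulr1 subrr eqxx.
  by rewrite mulr0 subr0 => qb; apply: la.
pose F r := cps_const n (q a)^-1 * cps_shift a (p - q' * r).
(* A higher weight in [q'] means that [F r] at weight [k] only sees [r] below [k]. *)
have F_agree r r' k : (forall b, (weight l b < k)%N -> r b = r' b) ->
    forall b, (weight l b < k.+1)%N -> F r b = F r' b.
  move=> rr' b bk; rewrite /F !cps_constME !cps_shiftE !cpsBE; congr (_ * (_ - _)).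
  rewrite !cpsME; apply: eq_bigr => j jm.
  have [->|q'j] := eqVneq (q' j) 0; first by rewrite !mul0r.
  congr (_ * _); apply: rr'; have /q'E := q'j.
  have := weightD l (a + b - j)%MM j; rewrite submK // weightD; lia.
(* The fixed point of the bound [x |-> P / (|q_a| s ^ weight l a) + x / 2] on norms. *)
pose B := 2 * P / (`|q a| * s ^+ weight l a).
have qas : 0 < `|q a| * s ^+ weight l a by rewrite mulr_gt0 ?normr_gt0 ?exprn_gt0.
have P0 : 0 <= P by apply: le_trans (pP 0%N); apply: wsum_ge0; exact: ltW.
have F_bound r : (forall N, wsum l s N r <= B) -> forall N, wsum l s N (F r) <= B.
  move=> rB N; rewrite wsum_const normfV.
  rewrite -[leLHS](mulfK (lt0r_neq0 qas)) /B ler_pM2r ?invr_gt0 //.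
  rewrite mulrACA mulVf ?normr_eq0 // mul1r.
  apply: le_trans (wsum_shift _ _ _ _ (ltW s0)) _.
  apply: le_trans (wsumD _ _ _ _ (ltW s0)) _; rewrite wsumN.
  rewrite mulr_natl mulr2n lerD ?pP //.
  apply: le_trans (wsumM _ _ _ _ (ltW s0)) _.
  apply: le_trans (ler_pM _ _ (qs _) (rB _)) _; try exact/wsum_ge0/ltW.
  have e (X : K) : X != 0 -> X / 2 * (2 * P / X) = P by move=> X0; field.
  by rewrite (e _ (lt0r_neq0 qas)).
pose it k := iter k F 0.
have it_bound k N : wsum l s N (it k) <= B.
  elim: k N => [|k IH] N; last exact: F_bound.
  rewrite /= /wsum big1 => [|b _]; last by rewrite cps0E normr0 mul0r.
  by apply: divr_ge0; [apply: mulr_ge0 | apply: ltW].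
have it_agree k : forall b, (weight l b < k)%N -> it k b = it k.+1 b.
  by elim: k => [//|k IH] b bk; apply: (F_agree _ _ k).
have it_lim j k b : (weight l b < k)%N -> it (k + j)%N b = it k b.
  move=> bk; elim: j => [|j IH]; rewrite ?addn0 // addnS -it_agree //.
  by rewrite (leq_trans bk) ?leq_addr.
pose R b := it (weight l b).+1 b.
have RE k b : (weight l b < k)%N -> R b = it k b.
  by move=> bk; rewrite -(subnKC bk) it_lim.
have cR : convergent R.
  apply: (convergent_wsum s0 s1 (l := l) (B := B)) => N.
  pose k := (\max_(b : 'X_{1..n < N}) weight l b).+1.
  apply: le_trans (it_bound k N); apply: ler_sum => b _.
  by rewrite (RE k) // ltnS (leq_bigmax b).
exists (Cps cR) => m am.
have FR : forall b, F (Cps cR) b = R b.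
  move=> b; rewrite (F_agree _ (it (weight l b).+1) (weight l b)) //.
    by rewrite (RE (weight l b).+2).
  by move=> b' bb'; apply: RE; rewrite (leq_trans bb').
have -> : q = q' + cps_const n (q a) * cpsX K a by rewrite subrK.
rewrite mulrDl opprD addrA cpsBE -mulrA cps_constME cpsXME am /= -FR.
rewrite cps_constME mulrA mulfV // mul1r cps_shiftE [(a + _)%MM]addmC submK //.
by rewrite subrr.
Qed.

(** Division by a series with leading exponent [0] leaves no remainder. *)
Lemma cps_unit f : f 0%MM != 0 -> exists g, f * g = 1.
Proof.
move=> f0; have [|g fg] := @division 1 f 0%MM.
  by split=> // k; rewrite ltNge le0m.
exists g; apply/esym/eqP; rewrite -subr_eq0; apply/eqP/cps_ext => m.
by rewrite cps0E fg //; apply/mnm_lepP => i; rewrite mnm0E.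
Qed.

(** Complete integral closedness. The remainder of [p] modulo [q] satisfies the
    hypothesis as well as [p], which makes its leading exponent a multiple of
    the leading exponent of [q]; so the remainder is zero. *)
Lemma cps_normal p q c : q <> 0 -> c <> 0 ->
  (forall k, exists w, c * p ^+ k = w * q ^+ k) -> exists r, p = q * r.
Proof.
move=> /lead_exists[a qa] /lead_exists[e ce] cpq.
have [r pqr] := division p qa; exists r; apply/eqP; rewrite -subr_eq0.
apply/eqP; apply: contrapT => /lead_exists[b rb].
have ab : (a <= b)%MM; last by case: rb => /eqP; rewrite pqr.
(* The exponent only has to exceed all coordinates of [e]. *)
have [w cw] : exists w, c * (p - q * r) ^+ (mdeg e).+1 = w * q ^+ (mdeg e).+1.
  have [W cW] := choice cpq.
  rewrite exprBn mulr_sumr.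
  exists (\sum_(i < (mdeg e).+2) W ((mdeg e).+1 - i)%N *
     ((-1) ^+ i * r ^+ i *+ 'C((mdeg e).+1, i))).
  rewrite mulr_suml; apply: eq_bigr => i _.
  rewrite !mulrnAr !mulrnAl; congr (_ *+ _).
  have -> : q ^+ (mdeg e).+1 = q ^+ ((mdeg e).+1 - i) * q ^+ i.
    by rewrite -exprD subnK // -ltnS.
  rewrite exprMn [_ * p ^+ _]mulrC !mulrA [c * _]cW. ring.
have w0 : w <> 0.
  move=> w0; rewrite w0 mul0r in cw.
  apply: (cps_mul_neq0 (lead_neq0 ce)) cw; exact: lead_neq0 (leadX _ rb).
have [d wd] := lead_exists w0.
have [_ le1] := leadM ce (leadX (mdeg e).+1 rb).
have [_ le2] := leadM wd (leadX (mdeg e).+1 qa).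
rewrite cw in le1; have /mnmP ed := lead_uniq le1 le2.
apply/mnm_lepP => i; rewrite leqNgt; apply/negP => bai.
have := ed i; rewrite !mnmDE !mulmnE.
have : (e i <= mdeg e)%N by rewrite mdegE (bigD1 i) //= leq_addr.
nia.
Qed.

End Division.

(** * Substitution of power series *)

Section Order.
Context (K : numFieldType) (n : nat).
Implicit Types (f g : cps K n).

Definition order_ge (N : nat) f := forall m, (mdeg m < N)%N -> f m = 0.

Lemma order_ge1 f : f 0%MM = 0 -> order_ge 1 f.
Proof. by move=> f0 m; rewrite ltnS leqn0 mdeg_eq0 => /eqP ->. Qed.

Lemma order_geM M N f g : order_ge M f -> order_ge N g -> order_ge (M + N) (f * g).
Proof.
move=> fM gN m mMN; rewrite cpsME big1 // => k km.
have [/fM->|Mk] := ltnP (mdeg k) M; first by rewrite mul0r.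
rewrite gN ?mulr0 //; have := congr1 mdeg (submK km); rewrite mdegD; lia.
Qed.

Lemma order_geX N f k : order_ge N f -> order_ge (N * k) (f ^+ k).
Proof.
move=> fN; elim: k => [|k IH]; first by rewrite muln0.
by rewrite mulnS exprS; apply: order_geM.
Qed.

Lemma order_ge_sum N (I : Type) (r : seq I) (P : pred I) (F : I -> cps K n) :
  (forall i, P i -> order_ge N (F i)) -> order_ge N (\sum_(i <- r | P i) F i).
Proof. by move=> FN m mN; rewrite cps_sumE big1 // => i /FN ->. Qed.

Lemma order_ge_split N f : order_ge N.+1 f -> exists F : nat -> cps K n,
  (forall j, order_ge N (F j)) /\
  f = \sum_(j < n) cpsX K U_(j)%MM * F j.
Proof.
move=> fN; pose u := [seq U_(j)%MM | j : 'I_n] : seq 'X_{1..n}.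
have [|F [FQ fE]] := @split_support K n u [set m | N <= mdeg m]%N%classic f.
  move=> m fm; have Nm : (N < mdeg m)%N.
    by rewrite ltnNge; apply/negP => /fN/eqP; rewrite (negPf fm).
  have /existsP[i mi] : [exists i, m i != 0%N].
    apply: contraTT Nm; rewrite negb_exists => /forallP m0.
    by rewrite mdegE big1 // => i _; apply/eqP; have := m0 i; rewrite negbK.
  exists U_(i)%MM; first by apply/map_f; rewrite mem_enum.
  have Ui : (U_(i) <= m)%MM by rewrite lep1mP.
  by split=> //=; have := congr1 mdeg (submK Ui); rewrite mdegD mdeg1; lia.
exists F; split=> [j m mN|].
  by apply/eqP; apply: contraTT mN => /FQ; rewrite -leqNgt.
have su : size u = n by rewrite size_map size_enum_ord.
rewrite fE su; apply: eq_bigr => j _; congr (cpsX _ _ * _).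
by rewrite (nth_map j) ?size_enum_ord // nth_ord_enum.
Qed.

End Order.

Section Substitution.
Context (K : numFieldType) (n q : nat).
Implicit Types (F : 'I_n -> cps K q) (f : cps K n) (a : 'X_{1..n}) (e : 'X_{1..q}).

Lemma mmap1_order F a : (forall i, F i 0%MM = 0) -> order_ge (mdeg a) (mmap1 F a).
Proof.
move=> F0; rewrite /mmap1 mdegE.
elim/big_rec2: _ => [//|i N x _ xN]; apply: order_geM => //.
by rewrite -[X in order_ge X]mul1n; apply/order_geX/order_ge1.
Qed.

Lemma sum_bmultinom_widen (M N : nat) (h : 'X_{1..n} -> K) : (M <= N)%N ->
    (forall m, (M <= mdeg m)%N -> h m = 0) ->
  \sum_(m : 'X_{1..n < N}) h m = \sum_(m : 'X_{1..n < M}) h m.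
Proof.
move=> MN hM.
pose w (m : 'X_{1..n < M}) := BMultinom (leq_trans (bmdeg m) MN).
rewrite (bigID (fun m : 'X_{1..n < N} => mdeg m < M)%N) /=.
rewrite [X in _ + X]big1 ?addr0; last by move=> m; rewrite -leqNgt => /hM.
rewrite (reindex_omap w (fun m : 'X_{1..n < N} => insub (m : 'X_{1..n}))) /=.
  apply: eq_bigl => m; rewrite bmdeg /=.
  by rewrite (insubT (fun m => mdeg m < M)%N (bmdeg m)) /=; apply/eqP; congr Some; apply: val_inj.
move=> m mM; rewrite (insubT (fun m => mdeg m < M)%N mM) /=; congr Some.
exact: val_inj.
Qed.

Lemma wsum_small (g : cps K q) (r : K) : g 0%MM = 0 -> 0 < r ->
  exists t0 : K, 0 < t0 /\ forall t, 0 < t -> t <= t0 ->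
    forall N, wsum (fun=> 1%N) t N g <= r.
Proof.
move=> g0 r0; have [r1 [M [r10 gM]]] := cpsP g.
have M0 : 0 <= M.
  apply: le_trans (gM 0%N); apply: sumr_ge0 => k _.
  by rewrite mulr_ge0 ?exprn_ge0 //; apply: ltW.
have rM : 0 < r + M by rewrite ltr_wpDr.
pose th := r / (r + M); have th0 : 0 < th by rewrite divr_gt0.
have th1 : th <= 1 by rewrite ler_pdivrMr // mul1r lerDl.
exists (r1 * th); split; first by rewrite mulr_gt0.
move=> t t0 tth N; apply: (@le_trans _ _ (th * M)); last first.
  by rewrite mulrAC ler_pdivrMr // ler_wpM2l ?ltW // ltrDr.
apply: le_trans (ler_wpM2l (ltW th0) (gM N)).
rewrite -wsum_mdeg mulr_sumr; apply: ler_sum => k _.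
have [k0|k0] := eqVneq (mdeg k) 0%N.
  by move/eqP: k0; rewrite mdeg_eq0 => /eqP ->; rewrite g0 normr0 !mul0r mulr0.
rewrite mulrCA ler_wpM2l //; apply: (@le_trans _ _ ((r1 * th) ^+ mdeg k)).
  by apply: lerXn2r; rewrite // nnegrE ltW // mulr_gt0.
rewrite exprMn mulrC ler_wpM2r ?exprn_ge0 ?(ltW r10) //.
by rewrite -[leRHS]expr1; apply: ler_wiXn2l; rewrite ?(ltW th0) // lt0n.
Qed.

Lemma mmap1_wsum F (t r : K) N a : 0 <= t -> 0 <= r ->
    (forall i, wsum (fun=> 1%N) t N (F i) <= r) ->
  wsum (fun=> 1%N) t N (mmap1 F a) <= r ^+ mdeg a.
Proof.
move=> t0 r0 Fr; rewrite /mmap1 mdegE.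
have w1 : wsum (fun=> 1%N) t N (1 : cps K q) <= 1.
  case: N {Fr} => [|N].
    by rewrite /wsum big1 // => k; have := bmdeg k.
  rewrite -wsum_mdeg (bigD1 bm0) //= big1 => [|k].
    by rewrite addr0 /const_coef eqxx normr1 mdeg0 expr0 mulr1.
  by rewrite -val_eqE /const_coef /= => /negPf ->; rewrite normr0 mul0r.
have wX (g : cps K q) k : wsum (fun=> 1%N) t N g <= r -> wsum (fun=> 1%N) t N (g ^+ k) <= r ^+ k.
  move=> gr; elim: k => [|k IH]; [exact: w1 | rewrite !exprS].
  apply: le_trans (wsumM _ _ _ _ t0) _.
  by apply: ler_pM; rewrite ?wsum_ge0.
elim/big_rec2: _ => [|i N' x _ xN]; [exact: w1 | rewrite exprD].
apply: le_trans (wsumM _ _ _ _ t0) _.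
by apply: ler_pM; rewrite ?wsum_ge0 ?wX.
Qed.

Definition subst_coef F f e : K :=
  \sum_(a : 'X_{1..n < (mdeg e).+1}) f a * mmap1 F a e.

Lemma subst_coefE F f e N : (forall i, F i 0%MM = 0) -> (mdeg e < N)%N ->
  subst_coef F f e = \sum_(a : 'X_{1..n < N}) f a * mmap1 F a e.
Proof.
move=> F0 eN; rewrite /subst_coef.
rewrite (@sum_bmultinom_widen (mdeg e).+1 N (fun a => f a * mmap1 F a e)) //.
by move=> m em; rewrite (mmap1_order (a := m) F0) ?mulr0.
Qed.

(** On a small polydisc all [F_i] have norm at most a radius of
    convergence of [f]. *)
Lemma convergent_subst F f : (forall i, F i 0%MM = 0) -> convergent (subst_coef F f).
Proof.
move=> F0; have [r [M [r0 fM]]] := cpsP f.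
have [t tP] := choice (fun i => wsum_small (F0 i) r0).
have t0 i : 0 < t i by case: (tP i).
(* A common positive lower bound of the [t_i]. *)
pose t1 := (1 + \sum_i (t i)^-1)^-1.
have S0 : 0 <= \sum_i (t i)^-1 by apply: sumr_ge0 => i _; rewrite invr_ge0 ltW.
have t10 : 0 < t1 by rewrite invr_gt0 ltr_pwDl.
have t1t i : t1 <= t i.
  rewrite -[t i]invrK lef_pV2 ?posrE ?invr_gt0 ?ltr_pwDl //.
  rewrite (bigD1 i) //= addrCA lerDl addr_ge0 // sumr_ge0 // => j _.
  by rewrite invr_ge0 ltW.
have Ft i N : wsum (fun=> 1%N) t1 N (F i) <= r.
  by case: (tP i) => _; apply.
exists t1, M; split=> // N; apply: le_trans (fM N).
apply: (@le_trans _ _ (\sum_(e : 'X_{1..q < N}) \sum_(a : 'X_{1..n < N})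
    `|f a| * (`|mmap1 F a e| * t1 ^+ mdeg e))).
  apply: ler_sum => e _; rewrite (subst_coefE f F0 (bmdeg e)).
  apply: le_trans (ler_wpM2r (exprn_ge0 _ (ltW t10)) (ler_norm_sum _ _ _)) _.
  by rewrite mulr_suml; apply: ler_sum => a _; rewrite normrM mulrA.
rewrite exchange_big /=; apply: ler_sum => a _.
rewrite -mulr_sumr ler_wpM2l // wsum_mdeg.
by apply: mmap1_wsum => //; apply: ltW.
Qed.

(** As [F_i] has no constant term, [F^a] has order at least [mdeg a]: the
    coefficients of the composite are finite sums, and in low degrees they are
    those obtained from a truncation of [f] to a polynomial, which reduces
    multiplicativity to polynomials. *)
Lemma subst_exists F : (forall i, F i 0%MM = 0) ->
  exists Phi : {rmorphism cps K n -> cps K q},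
    (forall c, Phi (cps_const n c) = cps_const q c) /\
    forall f e N, (mdeg e < N)%N ->
      Phi f e = \sum_(a : 'X_{1..n < N}) f a * mmap1 F a e.
Proof.
move=> F0; pose Phi f := Cps (convergent_subst f F0).
have PhiE f e N : (mdeg e < N)%N -> Phi f e = \sum_(a : 'X_{1..n < N}) f a * mmap1 F a e.
  exact: subst_coefE.
pose tr N f : {mpoly K[n]} := \sum_(k : 'X_{1..n < N}) f k *: 'X_[k].
have trE N f k : (mdeg k < N)%N -> (tr N f)@_k = f k.
  by move=> kN; rewrite mcoeff_mpoly.
pose ev := mmap (cps_const q) F.
have ev0 N (D : {mpoly K[n]}) e : (forall k, (mdeg k < N)%N -> D@_k = 0) ->
    (mdeg e < N)%N -> ev D e = 0.
  move=> D0 eN; rewrite /ev (mmapE (msize D)) // cps_sumE big1 // => k _.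
  rewrite cps_constME; have [/D0->|Nk] := ltnP (mdeg k) N; first by rewrite mul0r.
  by rewrite (mmap1_order (a := k) F0) ?mulr0 // (leq_trans eN).
have Phi_ev N f e : (mdeg e < N)%N -> Phi f e = ev (tr N f) e.
  move=> eN; rewrite (PhiE _ _ N) // /ev /tr raddf_sum cps_sumE /=.
  by apply: eq_bigr => a _; rewrite mmapZ cps_constME mmapX.
have PhiZ : zmod_morphism Phi.
  move=> f g; apply: cps_ext => e; rewrite cpsBE !(PhiE _ _ (mdeg e).+1) // -sumrB.
  by apply: eq_bigr => a _; rewrite cpsBE mulrBl.
have PhiC c : Phi (cps_const n c) = cps_const q c.
  apply: cps_ext => e; rewrite (PhiE _ _ (mdeg e).+1) //.
  rewrite (bigD1 bm0) //= big1 => [|k].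
    by rewrite addr0 /const_coef eqxx mmap11 cps1E mulr_natr mulrb.
  by rewrite -val_eqE /const_coef /= => /negPf ->; rewrite mul0r.
have PhiM : monoid_morphism Phi.
  split=> [|f g]; first exact: PhiC.
  apply: cps_ext => e; pose N := (mdeg e).+1.
  transitivity (ev (tr N f * tr N g) e).
    rewrite (Phi_ev N) //; apply/eqP; rewrite -subr_eq0 -cpsBE -raddfB.
    rewrite (ev0 N) // => k kN; rewrite mcoeffB trE //.
    rewrite (@cauchy_prod_mpoly _ _ N f g) ?subrr // => j jN; exact: trE.
  rewrite /ev rmorphM !cpsME; apply: eq_bigr => k _.
  have kN : (mdeg (val k) < N)%N by exact: bmdeg.
  by rewrite -!(Phi_ev N) //; rewrite (leq_ltn_trans (mdegB _ _)).
pose P : {rmorphism cps K n -> cps K q} := HB.pack Phi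
  (GRing.isZmodMorphism.Build _ _ Phi PhiZ) (GRing.isMonoidMorphism.Build _ _ Phi PhiM).
by exists P; split=> // f e N; apply: PhiE.
Qed.

Lemma subst_X F (Phi : cps K n -> cps K q) :
    (forall f e N, (mdeg e < N)%N ->
      Phi f e = \sum_(a : 'X_{1..n < N}) f a * mmap1 F a e) ->
  forall b, Phi (cpsX K b) = mmap1 F b.
Proof.
move=> PhiE b; apply: cps_ext => e.
rewrite (PhiE _ _ (maxn (mdeg b) (mdeg e)).+1) ?ltnS ?leq_maxr //.
have bN : (mdeg b < (maxn (mdeg b) (mdeg e)).+1)%N by rewrite ltnS leq_maxl.
rewrite (bigD1 (BMultinom bN)) //= big1 => [|a].
  by rewrite addr0 eqxx mul1r.
by rewrite -val_eqE /= => /negPf ->; rewrite mul0r.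
Qed.

End Substitution.

Section Morphisms.
Context (K : numFieldType) (n q : nat).
Implicit Types Phi : {rmorphism cps K n -> cps K q}.

Definition const_compat (E : Type) (iota : K -> E) m (Phi : cps K m -> E) :=
  forall c, Phi (cps_const m c) = iota c.

(** If the image [Phi f] had a nonzero constant term [c], then the unit [f - c]
    would be sent to the non-unit [Phi f - c]. *)
Lemma hom_local Phi (f : cps K n) : const_compat (cps_const q) Phi ->
  f 0%MM = 0 -> Phi f 0%MM = 0.
Proof.
move=> PhiC f0; apply/eqP; apply: contrapT => /negP c0.
set c := Phi f 0%MM in c0; have [|g fg] := @cps_unit K n (f - cps_const n c).
  by rewrite cpsBE f0 sub0r cps_constE eqxx oppr_eq0.
have : (Phi (f - cps_const n c) * Phi g) 0%MM = 1.
  by rewrite -rmorphM fg rmorph1 cps1E eqxx.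
rewrite rmorphB PhiC cpsM0E cpsBE cps_constE eqxx subrr mul0r => /esym/eqP.
by rewrite oner_eq0.
Qed.

Lemma hom_order Phi N (f : cps K n) : const_compat (cps_const q) Phi ->
  order_ge N f -> order_ge N (Phi f).
Proof.
move=> PhiC; elim: N f => [|N IH] f; first by [].
move=> /order_ge_split[F [FN ->]]; rewrite rmorph_sum.
apply: order_ge_sum => j _; rewrite rmorphM -add1n; apply: order_geM; last exact: IH.
apply: order_ge1; apply: hom_local => //; rewrite cpsXE eq_sym mnm1_eq0 //.
Qed.

(** The difference of two such morphisms kills polynomials and increases no
    order of vanishing. *)
Lemma hom_uniq Phi1 Phi2 :
    const_compat (cps_const q) Phi1 -> const_compat (cps_const q) Phi2 ->
    (forall i, Phi1 (cpsX K U_(i)%MM) = Phi2 (cpsX K U_(i)%MM)) ->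
  forall f, Phi1 f = Phi2 f.
Proof.
move=> C1 C2 P12 f; apply: cps_ext => e; pose N := (mdeg e).+1.
pose p := \sum_(k : 'X_{1..n < N}) cps_const n (f k) * cpsX K k.
have fpN : order_ge N (f - p).
  move=> m mN; rewrite cpsBE cps_sumE; under eq_bigr do rewrite cps_constME cpsXE.
  rewrite (bigD1 (BMultinom mN)) //= big1 => [|k].
    by rewrite addr0 eqxx mulr1 subrr.
  by rewrite -val_eqE /= eq_sym => /negPf ->; rewrite mulr0.
have -> : f = p + (f - p) by rewrite addrC subrK.
rewrite (rmorphD Phi1) (rmorphD Phi2) !cpsDE !(hom_order _ fpN) // !addr0; congr (cps_coef _ e).
rewrite !rmorph_sum; apply: eq_bigr => k _; rewrite !rmorphM C1 C2.
congr (_ * _); rewrite [X in cpsX K X]multinomUE_id cpsX_sum !rmorph_prod.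
by apply: eq_bigr => i _; rewrite !rmorphXn P12.
Qed.

End Morphisms.

Section MonomialSubstitution.
Context (K : numFieldType) (n q : nat) (g : 'I_n -> 'X_{1..q}).
Hypothesis g0 : forall i, g i != 0%MM.

Definition mon (a : 'X_{1..n}) : 'X_{1..q} := (\sum_i g i *+ a i)%MM.

Lemma monD a b : mon (a + b)%MM = (mon a + mon b)%MM.
Proof.
apply/mnmP => j; rewrite mnmDE /mon !mnm_sumE -big_split /=.
by apply: eq_bigr => i _; rewrite !mulmnE mnmDE mulnDr.
Qed.

Lemma mon0 : mon 0%MM = 0%MM.
Proof.
by apply/mnmP => j; rewrite mnm_sumE mnm0E big1 // => i _; rewrite mulmnE mnm0E muln0.
Qed.

Lemma mon1 i : mon U_(i)%MM = g i.
Proof.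
apply/mnmP => j; rewrite mnm_sumE (bigD1 i) //= big1 => [|k ki].
  by rewrite mulmnE mnm1E eqxx muln1 addn0.
by rewrite mulmnE mnm1E eq_sym (negPf ki) muln0.
Qed.

Lemma mdeg_mon a : (mdeg a <= mdeg (mon a))%N.
Proof.
rewrite /mon mdeg_sum mdegE; apply: leq_sum => i _; rewrite mdegMn.
by rewrite leq_pmull // lt0n mdeg_eq0.
Qed.

(** The coefficients of the image are those recorded by [toric_series]. *)
Lemma monomial_subst : exists Phi : {rmorphism cps K n -> cps K q},
  const_compat (cps_const q) Phi /\
  forall f e N, (mdeg e < N)%N ->
    Phi f e = \sum_(a : 'X_{1..n < N} | mon a == e) f a.
Proof.
have [|Phi [PhiC PhiE]] := @subst_exists K n q (fun i => cpsX K (g i)).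
  by move=> i; rewrite cpsXE eq_sym (negPf (g0 i)).
exists Phi; split=> // f e N eN; rewrite (PhiE _ _ N) // [RHS]big_mkcond.
apply: eq_bigr => a _; rewrite /mmap1 -cpsX_sum cpsXE eq_sym -/(mon a).
by case: eqP => _; rewrite ?mulr1 ?mulr0.
Qed.

Lemma monomial_subst_X (Phi : cps K n -> cps K q) :
    (forall f e N, (mdeg e < N)%N ->
      Phi f e = \sum_(a : 'X_{1..n < N} | mon a == e) f a) ->
  forall a, Phi (cpsX K a) = cpsX K (mon a).
Proof.
move=> PhiE a; rewrite (@subst_X _ _ _ (fun i => cpsX K (g i))) => [|f e N eN].
  by rewrite /mmap1 -cpsX_sum.
rewrite (PhiE _ _ N) // big_mkcond; apply: eq_bigr => b _.
rewrite /mmap1 -cpsX_sum cpsXE eq_sym -/(mon b).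
by case: eqP => _; rewrite ?mulr1 ?mulr0.
Qed.

(** Choosing one representation of each exponent as a combination of the [g_i]
    loses no convergence: [mdeg e] and the degree of a representation of [e]
    bound each other up to a constant. *)
Lemma monomial_subst_lift (Phi : {rmorphism cps K n -> cps K q}) (f : cps K q) :
    (forall f e N, (mdeg e < N)%N ->
      Phi f e = \sum_(a : 'X_{1..n < N} | mon a == e) f a) ->
  supported f (range mon) -> exists h, Phi h = f.
Proof.
move=> PhiE fS.
have rep_ex (e : 'X_{1..q}) : exists a, f e != 0 -> mon a = e.
  have [fe|fe] := eqVneq (f e) 0; first by exists 0%MM.
  by have [a _ ae] := fS e fe; exists a.
have [rep repP] := choice rep_ex.
pose c a := if rep (mon a) == a then f (mon a) else 0.
pose H := (\sum_i mdeg (g i))%N.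
have mH a : (mdeg (mon a) <= H * mdeg a)%N.
  rewrite /mon mdeg_sum mdegE big_distrr; apply: leq_sum => i _ /=.
  by rewrite mdegMn leq_mul2r /H (bigD1 i) //= leq_addr orbT.
have cc : convergent c.
  have [r [M [r0 fM]]] := cpsP f; pose s := r / (1 + r).
  have r1 : 0 < 1 + r by rewrite addr_gt0.
  have s0 : 0 < s by rewrite divr_gt0.
  have s1 : s <= 1 by rewrite ler_pdivrMr // mul1r lerDr.
  have sr : s <= r by rewrite ler_pdivrMr // ler_peMr ?lerDl // ltW.
  exists (s ^+ H), M; split=> [|N]; first by rewrite exprn_gt0.
  apply: le_trans (fM (H * N).+1).
  rewrite (bigID (fun a : 'X_{1..n < N} => rep (mon a) == a)) /=.
  rewrite [X in _ + X]big1 ?addr0 => [|a /negPf ra]; last first.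
    by rewrite /c ra normr0 mul0r.
  have mN (a : 'X_{1..n < N}) : (mdeg (mon a) < (H * N).+1)%N.
    by rewrite ltnS (leq_trans (mH a)) // leq_mul2l ltnW ?bmdeg ?orbT.
  pose b (e : 'X_{1..q < (H * N).+1}) := `|f e| * r ^+ mdeg e.
  apply: (@le_trans _ _ (\sum_(a : 'X_{1..n < N} | rep (mon a) == a)
      b (BMultinom (mN a)))).
    apply: ler_sum => a ra; rewrite /c ra /b /= ler_wpM2l // -exprM.
    apply: (@le_trans _ _ (s ^+ mdeg (mon a))).
      by apply: ler_wiXn2l; rewrite ?mH // ltW.
    by apply: lerXn2r; rewrite ?nnegrE //; apply: ltW.
  apply: sum_inj_le => [a1 a2|e]; last first.
    by apply: mulr_ge0 => //; apply/exprn_ge0/ltW.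
  rewrite !unfold_in => /eqP e1 /eqP e2 /(congr1 val)/= e.
  by apply/val_inj; rewrite /= -e1 -e2 e.
exists (Cps cc); apply: cps_ext => e; rewrite (PhiE _ _ (mdeg e).+1) //=.
have [fe|fe] := eqVneq (f e) 0.
  by rewrite fe big1 // => a /eqP ae; rewrite /c ae fe if_same.
have re := repP e fe.
have rN : (mdeg (rep e) < (mdeg e).+1)%N by rewrite ltnS -{2}re mdeg_mon.
rewrite (bigD1 (BMultinom rN)) /=; last by rewrite re.
rewrite /c re eqxx big1 ?addr0 // => a /andP[/eqP ae].
rewrite -val_eqE /= ae => /negPf ar; by rewrite eq_sym ar.
Qed.

Lemma monomial_subst_supported (Phi : cps K n -> cps K q) h :
    (forall f e N, (mdeg e < N)%N ->
      Phi f e = \sum_(a : 'X_{1..n < N} | mon a == e) f a) ->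
  supported (Phi h) (range mon).
Proof.
move=> PhiE e; rewrite (PhiE _ _ (mdeg e).+1) // => he.
apply: contrapT => ne; move/eqP: he; apply; rewrite big1 // => a /eqP ae.
by case: ne; exists a.
Qed.

End MonomialSubstitution.

(** * Dickson's lemma and Gordan's alternative *)

Section Dickson.

(** Repeatedly pick an index at which the rest of the sequence is minimal. *)
Lemma nondecreasing_subseq (f : nat -> nat) : exists phi : nat -> nat,
  {homo phi : i j / (i < j)%N} /\ {homo f \o phi : i j / (i <= j)%N}.
Proof.
have ex_min N : exists k, (N <= k)%N /\ forall m, (N <= m)%N -> (f k <= f m)%N.
  have ex : exists v, `[< exists2 k, (N <= k)%N & f k = v >].
    by exists (f N); apply/asboolP; exists N.
  case: (ex_minnP ex) => v /asboolP[k Nk <-] vmin; exists k; split=> // m Nm.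
  by apply: vmin; apply/asboolP; exists m.
have [g gP] := choice ex_min.
pose phi i := iter i (fun k => g k.+1) (g 0%N).
have phiS i : (phi i < phi i.+1)%N by case: (gP (phi i).+1).
have fphi i m : (phi i <= m)%N -> (f (phi i) <= f m)%N.
  case: i => [|i] im; first by case: (gP 0%N) => _; apply.
  have [im' mn] := gP (phi i).+1.
  by apply: mn; apply: leq_trans im' im.
exists phi; split; first exact: homo_ltn ltn_trans phiS.
move=> i j ij; apply: fphi.
by apply: (homo_leq (f := phi) leqnn leq_trans) ij => k; apply: ltnW.
Qed.

(** Extract a subsequence that is nondecreasing in one coordinate after the
    other. *)
Lemma dickson (I : finType) (c : nat -> I -> nat) :
  exists i j, (i < j)%N /\ forall x, (c i x <= c j x)%N.
Proof.
have sub (s : seq I) : exists phi : nat -> nat, {homo phi : i j / (i < j)%N} /\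
    forall x, x \in s -> {homo (fun k => c (phi k) x) : i j / (i <= j)%N}.
  elim: s => [|x s [phi [phiS phic]]]; first by exists id; split=> [i j|y].
  have [psi [psiS psic]] := nondecreasing_subseq (fun k => c (phi k) x).
  exists (phi \o psi); split=> [i j ij|y]; first exact/phiS/psiS.
  rewrite inE => /predU1P[->//|ys] i j ij /=; apply: (phic y ys).
  by move: ij; case: (ltngtP i j) => // [/psiS/ltnW|->].
have [phi [phiS phic]] := sub (enum I).
exists (phi 0%N), (phi 1%N); split=> [|x]; first exact: phiS.
by apply: phic; rewrite ?mem_enum.
Qed.

(** Dickson's lemma for the order given by adding multiples of [K]. A sequence
    of elements none of which is reached from an earlier one is compared by
    [dickson] together with its residues and their complements to [K]: these
    can only both increase if the residues agree. *)
Lemma finite_basis n (K : nat) (T : set 'X_{1..n}) : (0 < K)%N ->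
  exists u : seq 'X_{1..n}, (forall a, a \in u -> T a) /\
    forall m, T m -> exists2 a, a \in u &
      (a <= m)%MM /\ forall i, (K %| (m - a)%MM i)%N.
Proof.
move=> K0; pose cov (u : seq 'X_{1..n}) m := exists2 a, a \in u &
  (a <= m)%MM /\ forall i, (K %| (m - a)%MM i)%N.
apply: contrapT => nu.
have nxt_ex (u : seq 'X_{1..n}) :
    exists m, (forall a, a \in u -> T a) -> T m /\ ~ cov u m.
  have [uT|nuT] := pselect (forall a, a \in u -> T a); last by exists 0%MM.
  apply: contrapT => nm; apply: nu; exists u; split=> // m Tm.
  by apply: contrapT => ncov; apply: nm; exists m.
have [nxt nxtP] := choice nxt_ex.
pose s := fix s k := if k is k'.+1 then nxt (s k') :: s k' else [::].
have sT k : forall a, a \in s k -> T a.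
  elim: k => [|k IH] a //=; rewrite inE => /predU1P[->|/IH//].
  by case: (nxtP (s k) IH).
have si i j : (i < j)%N -> nxt (s i) \in s j.
  elim: j => // j IH; rewrite ltnS leq_eqVlt /= inE => /predU1P[->|/IH->].
    by rewrite eqxx.
  by rewrite orbT.
pose r (m : 'X_{1..n}) (x : 'I_n * 'I_3) := nth 0%N
  [:: m x.1; m x.1 %% K; K - m x.1 %% K]%N x.2.
have [i [j [ij rij]]] := dickson (fun k => r (nxt (s k))).
case: (nxtP (s j) (sT j)) => _; apply; exists (nxt (s i)); first exact: si.
have le0 x := rij (x, inord 0); have le1 x := rij (x, inord 1).
have le2 x := rij (x, inord 2).
split=> [|x]; first by apply/mnm_lepP => x; have := le0 x; rewrite /r /= !inordK.
rewrite mnmBE; have := le0 x; have := le1 x; have := le2 x.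
rewrite /r /= !inordK //=; set p := nxt (s j) x; set q := nxt (s i) x => h2 h1 h0.
rewrite -eqn_mod_dvd // eqn_leq h1 andbT.
have := ltn_pmod p K0; have := ltn_pmod q K0; lia.
Qed.

End Dickson.

Section Gordan.
Context (d : nat).
Implicit Types (u v : 'rV[int]_d).

Definition dot u v : int := \sum_j u 0 j * v 0 j.

Lemma dotDl u v w : dot (u + v) w = dot u w + dot v w.
Proof. by rewrite -big_split; apply: eq_bigr => j _; rewrite mxE mulrDl. Qed.
Lemma dotZl c u w : dot (c *: u) w = c * dot u w.
Proof. by rewrite mulr_sumr; apply: eq_bigr => j _; rewrite mxE mulrA. Qed.
Lemma dotC u v : dot u v = dot v u.
Proof. by apply: eq_bigr => j _; rewrite mulrC. Qed.
Lemma dotDr u v w : dot w (u + v) = dot w u + dot w v.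
Proof. by rewrite !(dotC w) dotDl. Qed.
Lemma dotZr c u w : dot w (c *: u) = c * dot w u.
Proof. by rewrite !(dotC w) dotZl. Qed.
Lemma dot_sumr (I : finType) (F : I -> 'rV[int]_d) w :
  dot w (\sum_i F i) = \sum_i dot w (F i).
Proof.
elim/big_rec2: _ => [|i x y _ <-]; last by rewrite dotDr.
by rewrite /dot big1 // => j _; rewrite mxE mulr0.
Qed.
Lemma dot_gt0 u : u != 0 -> 0 < dot u u.
Proof.
move=> u0; rewrite lt_neqAle sumr_ge0 ?andbT => [|j _]; last exact: sqr_ge0.
apply: contra_neq u0 => /esym/eqP.
rewrite psumr_eq0 => [/allP u0|j _]; last exact: sqr_ge0.
apply/rowP => j; rewrite mxE; apply/eqP.
by have := u0 j (mem_index_enum _); rewrite mulf_eq0 orbb.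
Qed.

(** Gordan's alternative. If [l] is positive on all vectors but the first one
    [a], and negative on [a], the other vectors are replaced by their
    projections [b_i] along [a] to the kernel of [l]: a form positive on the
    [b_i] can be made to vanish on [a], and a small multiple of [l] is
    subtracted from it; a relation between the [b_i] is one between the given
    vectors. If [l] vanishes on [a], then [a] itself corrects [l]. *)
Lemma gordan n (a : 'I_n -> 'rV[int]_d) :
  (exists l, forall i, 0 < dot l (a i)) \/
  (exists r : 'I_n -> int, [/\ forall i, 0 <= r i, exists i, 0 < r i &
    \sum_i r i *: a i = 0]).
Proof.
elim: n a => [|n IH] a; first by left; exists 0 => -[].
pose ext (c : int) (r : 'I_n -> int) i := oapp r c (unlift ord0 i).
have ext0 c r : ext c r ord0 = c by rewrite /ext unlift_none.
have extS c r i : ext c r (lift ord0 i) = r i by rewrite /ext liftK.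
have ext_ge0 c r : 0 <= c -> (forall i, 0 <= r i) -> forall i, 0 <= ext c r i.
  by move=> c0 r0 i; rewrite /ext; case: unliftP => [j|] _ /=; [exact: r0|exact: c0].
have all0S (P : 'I_n.+1 -> Prop) : P ord0 -> (forall i, P (lift ord0 i)) -> forall i, P i.
  by move=> P0 PS i; case: (unliftP ord0 i) => [j|] ->.
case: (IH (fun i => a (lift ord0 i))) => [[l la]|[r [r0 [i ri] rs]]]; last first.
  right; exists (ext 0 r); split; first exact: ext_ge0.
    by exists (lift ord0 i); rewrite extS.
  rewrite big_ord_recl ext0 scale0r add0r -[RHS]rs.
  by apply: eq_bigr => j _; rewrite extS.
have bound (x y : 'I_n -> int) : (forall i, 0 < x i) ->
    exists2 C : int, 0 <= C & forall i, 0 < C * x i + y i.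
  move=> x0; exists (1 + \sum_i `|y i|) => [|i].
    by rewrite addr_ge0 ?sumr_ge0.
  have yi : `|y i| <= \sum_i `|y i| by rewrite [leRHS](bigD1 i) //= lerDl sumr_ge0.
  have Cx : 1 + \sum_i `|y i| <= (1 + \sum_i `|y i|) * x i.
    by rewrite ler_peMr -?gtz0_ge1 ?x0 ?addr_ge0 ?sumr_ge0.
  have := ler_norm (- y i); rewrite normrN; lia.
case: (ltgtP (dot l (a ord0)) 0) => [la0|la0|la0].
- pose b i := (- dot l (a ord0)) *: a (lift ord0 i) + dot l (a (lift ord0 i)) *: a ord0.
  case: (IH b) => [[m mb]|[r [r0 [i ri] rs]]].
    pose l' := (- dot l (a ord0)) *: m + dot m (a ord0) *: l.
    have l'a i : 0 < dot l' (a (lift ord0 i)).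
      by have := mb i; rewrite /b /l' dotDr !dotZr dotDl !dotZl; lia.
    have [C C0 CP] := bound _ (fun i => - dot l (a (lift ord0 i))) l'a.
    left; exists (C *: l' + (-1) *: l); apply: all0S => [|i].
      by rewrite dotDl !dotZl /l' dotDl !dotZl; lia.
    by rewrite dotDl !dotZl mulN1r.
  right; exists (ext (\sum_i r i * dot l (a (lift ord0 i))) (fun i => - dot l (a ord0) * r i)).
  have s0 : 0 < \sum_i r i * dot l (a (lift ord0 i)).
    rewrite (bigD1 i) //= ltr_pwDl ?mulr_gt0 // sumr_ge0 // => j _.
    by rewrite mulr_ge0 // ltW.
  split.
  + by apply: ext_ge0 => [|j]; [exact: ltW | rewrite mulr_ge0 // oppr_ge0 ltW].
  + by exists ord0; rewrite ext0.
  + rewrite big_ord_recl ext0 scaler_suml -big_split -[RHS]rs /=.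
    apply: eq_bigr => j _; rewrite extS /b scalerDr !scalerA addrC.
    by rewrite [- _ * _]mulrC.
- by left; exists l; apply: all0S.
- have [a0|a0] := eqVneq (a ord0) 0.
    right; exists (ext 1 (fun=> 0)); split; first exact: ext_ge0.
      by exists ord0; rewrite ext0.
    rewrite big_ord_recl ext0 a0 scaler0 add0r big1 // => i _.
    by rewrite extS scale0r.
  have [C C0 CP] := bound _ (fun i => dot (a ord0) (a (lift ord0 i))) la.
  left; exists (C *: l + a ord0); apply: all0S => [|i]; rewrite dotDl dotZl //.
  by rewrite la0 mulr0 add0r dot_gt0.
Qed.

End Gordan.

(** * Embedding a strongly convex semigroup *)

Section Embedding.
Context (R : realType) (d n : nat) (gamma : 'I_n -> 'rV[int]_d).

(** A nontrivial nonnegative relation would put some [r_i gamma_i] and its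
    opposite in the cone. *)
Lemma pointed_half_space : toric_generators R gamma ->
  exists l, forall i, 0 < dot l (gamma i).
Proof.
case=> gamma0 _ pointed; case: (gordan gamma) => [//|[r [r0 [i ri] rs]]].
have ge0 j : 0 <= (r j)%:~R :> R by rewrite ler0z.
have /eqP := gamma0 i; case; apply/rowP => j; rewrite mxE.
pose v := (r i)%:~R *: map_mx intr (gamma i) : 'rV[R]_d.
have : v = 0.
  apply: pointed.
    exists (fun k => if k == i then (r i)%:~R else 0); split.
      by move=> k; case: ifP.
    by rewrite (bigD1 i) //= eqxx big1 ?addr0 // => k /negPf ->; rewrite scale0r.
  exists (fun k => if k == i then 0 else (r k)%:~R); split.
    by move=> k; case: ifP.
  have rs' : \sum_k (r k)%:~R *: map_mx intr (gamma k) = 0 :> 'rV[R]_d.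
    apply/rowP => k; have /rowP/(_ k) := rs; rewrite !mxE !summxE.
    move=> /(congr1 (intr : int -> R)); rewrite rmorph_sum /= => e.
    by rewrite -[RHS]e; apply: eq_bigr => h _; rewrite !mxE rmorphM.
  rewrite (bigD1 i) //= in rs'; rewrite (bigD1 i) //= eqxx scale0r add0r.
  rewrite /v; move/eqP: rs'; rewrite addr_eq0 => /eqP ->; rewrite opprK.
  by apply: eq_bigr => k /negPf ->.
move/rowP/(_ j); rewrite !mxE => /eqP; rewrite mulf_eq0 !intr_eq0.
by rewrite gt_eqF //= => /eqP.
Qed.

(** The coordinates are a linear form [l] positive on the generators, and those
    of [Z^d] shifted by a multiple of [l] that is large enough to make them
    nonnegative on the generators. *)
Lemma toric_embedding : toric_generators R gamma ->
  exists q (g : 'I_n -> 'X_{1..q}), (forall i, g i != 0%MM) /\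
    forall a b : 'X_{1..n}, \sum_i gamma i *+ a i = \sum_i gamma i *+ b i <->
      mon g a = mon g b.
Proof.
move=> /pointed_half_space[l lgamma].
pose N := \sum_i \sum_j `|gamma i 0 j|.
have N0 : 0 <= N by apply: sumr_ge0 => i _; apply: sumr_ge0.
have Ngamma i j : `|gamma i 0 j| <= N.
  rewrite /N (bigD1 i) //= (bigD1 j) //= -addrA lerDl addr_ge0 ?sumr_ge0 // => k _.
  exact: sumr_ge0.
pose x (v : 'rV[int]_d) (j : 'I_d.+1) : int :=
  if unlift ord0 j is Some k then v 0 k + N * dot l v else dot l v.
have xge0 i j : 0 <= x (gamma i) j.
  rewrite /x; case: unliftP => [k _|_]; last exact: ltW.
  have := Ngamma i k; have := ler_norm (- gamma i 0 k); rewrite normrN.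
  have := lgamma i; have : N <= N * dot l (gamma i) by rewrite ler_peMr -?gtz0_ge1.
  lia.
have x_sum (a : 'X_{1..n}) j : x (\sum_i gamma i *+ a i) j = \sum_i x (gamma i) j *+ a i.
  have dE : dot l (\sum_i gamma i *+ a i) = \sum_i dot l (gamma i) *+ a i.
    rewrite dot_sumr; apply: eq_bigr => i _.
    by rewrite -scaler_nat dotZr mulr_natl.
  rewrite /x; case: unliftP => [k _|_] //.
  rewrite dE summxE mulr_sumr -big_split; apply: eq_bigr => i _ /=.
  by rewrite mulmxnE mulrnDl mulrnAr.
pose g i := [multinom `|x (gamma i) j|%N | j < d.+1].
have gE i j : (g i j)%:Z = x (gamma i) j by rewrite mnmE gez0_abs.
have monE a j : (mon g a j)%:Z = x (\sum_i gamma i *+ a i) j.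
  rewrite /mon mnm_sumE x_sum (big_morph Posz PoszD (erefl _)).
  by apply: eq_bigr => i _; rewrite mulmnE PoszM gE -mulr_natr natz.
exists d.+1, g; split=> [i|a b].
  apply/eqP => /mnmP/(_ ord0); rewrite mnm0E => /(congr1 Posz).
  by rewrite gE /x unlift_none => e; have := lgamma i; rewrite e ltxx.
split=> [e|e]; first by apply/mnmP => j; apply/eqP; rewrite -eqz_nat !monE e.
have xe j : x (\sum_i gamma i *+ a i) j = x (\sum_i gamma i *+ b i) j.
  by rewrite -!monE e.
have e0 := xe ord0; rewrite /x unlift_none in e0.
apply/rowP => j; have := xe (lift ord0 j).
by rewrite /x liftK e0 => /addIr.
Qed.

(** Both sides record the sums of the coefficients of [f] over the sets of
    exponents with a given value of the semigroup. *)
Lemma toric_series_eq q (g : 'I_n -> 'X_{1..q}) (Phi : cps R[i] n -> cps R[i] q) :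
    (forall i, g i != 0%MM) ->
    (forall a b : 'X_{1..n}, \sum_i gamma i *+ a i = \sum_i gamma i *+ b i <->
      mon g a = mon g b) ->
    (forall f e N, (mdeg e < N)%N ->
      Phi f e = \sum_(a : 'X_{1..n < N} | mon g a == e) f a) ->
  forall f h, Phi f = Phi h <-> toric_series gamma f = toric_series gamma h.
Proof.
move=> g0 gammag PhiE.
have tsE f (a : 'X_{1..n}) : toric_series gamma f (\sum_i gamma i *+ a i) = Phi f (mon g a).
  rewrite (PhiE _ _ (mdeg (mon g a)).+1) // /toric_series.
  pose r := [seq val m | m <- index_enum 'X_{1..n < (mdeg (mon g a)).+1}].
  transitivity (\sum_(m <- r | mon g m == mon g a) f m); last by rewrite big_map.
  rewrite [RHS]bigfs => [||m /eqP ma].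
  - apply: eq_fsbigl; apply/seteqP; split=> m /=; first by move=> /gammag/eqP.
    by move=> /eqP/gammag.
  - by rewrite map_inj_uniq ?index_enum_uniq //; apply: val_inj.
  - have mN : (mdeg m < (mdeg (mon g a)).+1)%N by rewrite ltnS -ma mdeg_mon.
    by case/negP; apply/mapP; exists (BMultinom mN); rewrite ?mem_index_enum.
move=> f h; split=> [e|e].
  apply/funext => v; case: (pselect (exists a : 'X_{1..n}, \sum_i gamma i *+ a i = v)).
    by case=> a <-; rewrite !tsE e.
  by move=> nv; rewrite /toric_series !fsbig1 // => a av; case: nv; exists a.
apply: cps_ext => v; case: (pselect (exists a : 'X_{1..n}, mon g a = v)).
  by case=> a <-; rewrite -!tsE e.
move=> nv; rewrite !(PhiE _ _ (mdeg v).+1) // !big1 // => a /eqP av; case: nv;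
by exists a.
Qed.

End Embedding.

(** * The integral closure of an ideal *)

Section IdealMorphism.
Context (E E' : comPzRingType) (theta : {rmorphism E -> E'}).

Lemma ideal_gen_morph (I : set E) (J : set E') : (forall f, I f -> ideal_gen J (theta f)) ->
    (forall f g, ideal_gen J f -> ideal_gen J g -> ideal_gen J (f + g)) ->
    (forall a f, ideal_gen J f -> ideal_gen J (a * f)) ->
  forall f, ideal_gen I f -> ideal_gen J (theta f).
Proof.
move=> IJ ID IM f [k [a [g [Ig ->]]]]; rewrite rmorph_sum.
elim/big_ind: _ => [||i _]; last by rewrite rmorphM; apply/IM/IJ.
  by exists 0%N, (fun=> 0), (fun=> 0); split=> [[]//|]; rewrite big_ord0.
exact: ID.
Qed.

Lemma ideal_pow_morph (I : set E) (J : set E') : (forall f, I f -> J (theta f)) ->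
  forall k f, ideal_pow I k f -> ideal_pow J k (theta f).
Proof.
move=> IJ k; elim: k => [//|k IH] f [m [a [g [Ig ->]]]].
exists m, (theta \o a), (theta \o g); split=> [i|] /=; last first.
  by rewrite rmorph_sum; apply: eq_bigr => i _; rewrite rmorphM.
have [u Iu [v Iv <-]] := Ig i; exists (theta u); first exact: IJ.
by exists (theta v); [exact: IH | rewrite rmorphM].
Qed.

Lemma ideal_int_closure_morph (I : set E) (J : set E') : (forall f, I f -> J (theta f)) ->
  forall f, ideal_int_closure I f -> ideal_int_closure J (theta f).
Proof.
move=> IJ f [n [a [n0 Ia e]]]; exists n, (theta \o a); split=> //.
  by move=> i /Ia; apply: ideal_pow_morph.
rewrite -[RHS](rmorph0 theta) -e rmorphD rmorphXn rmorph_sum; congr (_ + _).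
by apply: eq_bigr => i _; rewrite rmorphM rmorphXn.
Qed.

End IdealMorphism.

Section IntegralClosure.
Context (E : comNzRingType) (I : set E).

Lemma ideal_gen0 (S : set E) : ideal_gen S 0.
Proof. by exists 0%N, (fun=> 0), (fun=> 0); split=> [[]//|]; rewrite big_ord0. Qed.

Lemma ideal_gen_mem (S : set E) f : S f -> ideal_gen S f.
Proof. by move=> Sf; exists 1%N, (fun=> 1), (fun=> f); split=> //; rewrite big_ord1 mul1r. Qed.

Lemma ideal_pow0 k : ideal_pow I k 0.
Proof. by case: k => [//|k]; apply: ideal_gen0. Qed.

Lemma ideal_powD k f g : ideal_pow I k f -> ideal_pow I k g -> ideal_pow I k (f + g).
Proof. by case: k => [//|k]; apply: ideal_genD. Qed.

Lemma ideal_powMl k a f : ideal_pow I k f -> ideal_pow I k (a * f).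
Proof. by case: k => [//|k]; apply: ideal_genMl. Qed.

Lemma ideal_powM i j f g :
  ideal_pow I i f -> ideal_pow I j g -> ideal_pow I (i + j) (f * g).
Proof.
move=> + gj; elim: i f => [|i IH] f; first by move=> _; apply: ideal_powMl.
move=> [k [a [s [Is ->]]]]; exists k, a, (fun m => s m * g); split.
  move=> m; have [u Iu [v Iv <-]] := Is m; exists u => //.
  by exists (v * g); rewrite ?mulrA //; apply: IH.
by rewrite mulr_suml; apply: eq_bigr => m _; rewrite mulrA.
Qed.

(** The Rees algebra of [I] inside [E[T]]. *)
Definition rees : {pred {poly E}} := fun p => `[< forall i, ideal_pow I i p`_i >].

Lemma reesP (p : {poly E}) : reflect (forall i, ideal_pow I i p`_i) (p \in rees).
Proof. exact: asboolP. Qed.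

Fact rees_subring_closed : subring_closed rees.
Proof.
split=> [|p q /reesP pI /reesP qI|p q /reesP pI /reesP qI]; apply/reesP => i.
- by rewrite coef1; case: i => [//|i]; apply: ideal_pow0.
- by rewrite coefB -mulN1r; apply: ideal_powD => //; apply: ideal_powMl.
- rewrite coefM; elim/big_ind: _ => [|f g|j _]; first exact: ideal_pow0.
    exact: ideal_powD.
  by rewrite -[X in ideal_pow I X](subnKC (leq_ord j)); apply: ideal_powM.
Qed.
HB.instance Definition _ := GRing.isSubringClosed.Build {poly E} rees rees_subring_closed.

Definition rees_ring := {p : {poly E} | p \in rees}.
HB.instance Definition _ := SubChoice.on rees_ring.
HB.instance Definition _ := [SubChoice_isSubComNzRing of rees_ring by <:].

Lemma rees_valE (p : {poly E}) : p \in rees -> exists r : rees_ring, val r = p.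
Proof. by move=> pI; exists (Sub p pI); rewrite SubK. Qed.

(** An equation of integral dependence of [f] over [I] of degree [n] is the
    coefficient of [T^n] in an equation of [f T] over the Rees algebra. *)
Lemma int_closure_rees f : ideal_int_closure I f <->
  integralOver (val : rees_ring -> {poly E}) (f *: 'X).
Proof.
split=> [[n [a [n0 Ia e]]]|[P mP rP]].
  pose q := \poly_(j < n) (a (n - j)%N *: 'X^(n - j)) : {poly {poly E}}.
  have sq : (size q < size ('X^n : {poly {poly E}}))%N by rewrite size_polyXn ltnS size_poly.
  apply: (@integral_root_monic _ _ _ _ ('X^n + q)).
  - by rewrite monicE lead_coefDl // lead_coefXn.
  - rewrite /root hornerD hornerXn horner_poly; apply/eqP.
    rewrite exprZn -[RHS](scale0r 'X^n) -e scalerDl; congr (_ + _).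
    rewrite -(big_mkord xpredT (fun i => a (n - i)%N *: 'X^(n - i) * (f *: 'X) ^+ i)).
    rewrite big_nat_rev /= add0n scaler_suml big_add1 /=.
    rewrite !big_nat; apply: eq_bigr => i /andP[_ iN].
    have -> : (n - (n - i.+1) = i.+1)%N by rewrite subKn.
    by rewrite exprZn -scalerAl -scalerAr scalerA -exprD subnKC.
  - apply/integral_poly => i; rewrite coefD coefXn coef_poly.
    apply: integral_add; first exact: integral_nat.
    case: ifP => ni; last exact: integral0.
    have [|r <-] := @rees_valE (a (n - i)%N *: 'X^(n - i)); last exact: integral_id.
    apply/reesP => j; rewrite coefZ coefXn; case: eqP => [->|_].
      by rewrite mulr1; apply: Ia; rewrite subn_gt0 ni leq_subr.
    by rewrite mulr0; apply: ideal_pow0.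
have P0 : (0 < size P)%N by rewrite lt0n size_poly_eq0 monic_neq0.
pose n := (size P).-1; have nP : size P = n.+1 by rewrite prednK.
have eP : \sum_(i < n.+1) val P`_i * (f *: 'X) ^+ i = 0.
  rewrite -[RHS](rootP rP) horner_coef size_map_inj_poly; last 2 first.
  - exact: val_inj.
  - exact: raddf0.
  by rewrite nP; apply: eq_bigr => i _; rewrite coef_map.
have eN : \sum_(i < n.+1) (val P`_i)`_(n - i) * f ^+ i = 0.
  rewrite -[RHS](coef0 _ n) -eP coef_sum; apply: eq_bigr => i _.
  rewrite exprZn -scalerAr coefZ coefMXn ltnNge leq_ord /= mulrC //.
have Pn : val P`_n = 1 by have := monicP mP; rewrite lead_coefE => ->.
exists n, (fun i => (val P`_(n - i))`_i); split.
- case: (posnP n) => // n0; move: eN; rewrite n0 big_ord1 /=.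
  by rewrite -{1}n0 Pn coef1 mulr1 => /eqP; rewrite oner_eq0.
- by move=> i _; apply/reesP/valP.
- move: eN; rewrite big_ord_recr /= subnn Pn coef1 eqxx mul1r addrC => e.
  rewrite -[RHS]e; congr (_ + _).
  rewrite -(big_mkord xpredT (fun i => (val P`_i)`_(n - i) * f ^+ i)).
  rewrite [RHS]big_nat_rev /= add0n big_add1 /= !big_nat.
  by apply: eq_bigr => i /andP[_ iN]; rewrite subKn.
Qed.

Lemma int_closureD f g : ideal_int_closure I f -> ideal_int_closure I g ->
  ideal_int_closure I (f + g).
Proof.
by rewrite !int_closure_rees scalerDl; apply: integral_add.
Qed.

Lemma int_closureMl a f : ideal_int_closure I f -> ideal_int_closure I (a * f).
Proof.
rewrite !int_closure_rees -scalerA -[a *: _]mul_polyC => If.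
apply: integral_mul => //; have [|r <-] := @rees_valE a%:P; last exact: integral_id.
by apply/reesP => -[//|i]; rewrite coefC; apply: (ideal_pow0 i.+1).
Qed.

Lemma int_closure_mem f : I f -> ideal_int_closure I f.
Proof.
move=> If; exists 1%N, (fun=> - f); split=> // [[|[|i]]//|].
  move=> _; rewrite -mulN1r; apply/ideal_powMl/ideal_gen_mem.
  by exists f => //; exists 1; rewrite ?mulr1.
by rewrite big_nat1 subnn expr0 mulr1 expr1 subrr.
Qed.

End IntegralClosure.

(** * Freeness of the semigroup of a smooth germ *)

Section ConstantTerm.
Context (K : numFieldType) (n : nat).

Lemma cps_prodX0E (I : finType) (F : I -> cps K n) (a : I -> nat) :
  (\prod_i F i ^+ a i) 0%MM = \prod_i F i 0%MM ^+ a i.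
Proof.
elim/big_rec2: _ => [|i x y _ <-]; first by rewrite cps1E eqxx.
by rewrite cpsM0E cpsX0E.
Qed.

Lemma hom_const_term q (Phi : {rmorphism cps K n -> cps K q}) (f : cps K n) :
  const_compat (cps_const q) Phi -> Phi f 0%MM = f 0%MM.
Proof.
move=> PhiC; have := @hom_local _ _ _ Phi (f - cps_const n (f 0%MM)) PhiC.
rewrite cpsBE cps_constE eqxx subrr rmorphB PhiC cpsBE cps_constE eqxx.
by move=> /(_ erefl)/eqP; rewrite subr_eq0 => /eqP.
Qed.

(** The restriction to the line of direction [p]; the value of [w] at [0] is the
    derivative of [f] in this direction. *)
Lemma line_restriction (p : 'I_n -> K) :
  exists Phi : {rmorphism cps K n -> cps K 1}, forall f : cps K n, f 0%MM = 0 ->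
    exists w, Phi f = cpsX K U_(ord0)%MM * w /\
      w 0%MM = \sum_j p j * f U_(j)%MM.
Proof.
pose F j := cps_const 1 (p j) * cpsX K U_(ord0)%MM.
have [|Phi [PhiC PhiE]] := @subst_exists K n 1 F.
  by move=> i; rewrite cps_constME cpsXE eq_sym mnm1_eq0 mulr0.
exists Phi => f f0; have [H [_ fE]] := order_ge_split (order_ge1 f0).
exists (\sum_j cps_const 1 (p j) * Phi (H j)); split.
  rewrite {1}fE rmorph_sum mulr_sumr; apply: eq_bigr => j _.
  by rewrite rmorphM (subst_X PhiE) mmap1U /F mulrCA mulrA.
rewrite cps_sumE; apply: eq_bigr => j _; rewrite cps_constME hom_const_term //.
congr (_ * _); rewrite fE cps_sumE.
under eq_bigr do rewrite cpsXME lep1mP mnm1E.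
rewrite (bigD1 j) //= big1 => [|i ij].
  by rewrite addr0 eqxx -{1}[U_(j)%MM]add0m addmK.
by rewrite [j == i]eq_sym (negPf ij).
Qed.

End ConstantTerm.

Section FreeMonoid.
Context (K : numFieldType) (e q : nat) (pi : {rmorphism cps K e -> cps K q}).
Context (S : set 'X_{1..q}).
Hypothesis piC : const_compat (cps_const q) pi.
Hypothesis pi_inj : injective pi.
Hypothesis S_add : forall a b, S a -> S b -> S (a + b)%MM.
Hypothesis pi_S : forall f, supported (pi f) S.
Hypothesis S_pi : forall s, S s -> exists f, pi f = cpsX K s.

Definition irreducible_exponent h := [/\ S h, h <> 0%MM &
  forall u v, S u -> S v -> u <> 0%MM -> v <> 0%MM -> (u + v)%MM <> h].

(** A vanishing combination of the linear parts of preimages of distinct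
    irreducible monomials is a combination of monomials in the square of the
    maximal ideal, and an irreducible monomial does not occur in a product of
    two series without constant term. *)
Lemma irreducible_free k (h : 'I_k -> 'X_{1..q}) (X : 'I_k -> cps K e) :
    injective h -> (forall i, irreducible_exponent (h i)) ->
    (forall i, pi (X i) = cpsX K (h i)) ->
  (forall i, X i 0%MM = 0) /\ row_free (\matrix_(i, j) X i U_(j)%MM).
Proof.
move=> hI irr piX; have X0 i : X i 0%MM = 0.
  rewrite -(hom_const_term (X i) piC) piX cpsXE.
  by case: eqP => // h0; case: (irr i) => _ []; rewrite -h0.
split=> //; apply: inj_row_free => v vL.
pose W := \sum_i cps_const e (v 0 i) * X i.
have W2 : order_ge 2 W.
  move=> m; rewrite ltnS leq_eqVlt ltnS leqn0 => /orP[/mdeg1P[j /eqP ->]|].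
    rewrite cps_sumE; have /rowP/(_ j) := vL; rewrite !mxE => vLj.
    by rewrite -[RHS]vLj; apply: eq_bigr => i _; rewrite cps_constME mxE.
  rewrite mdeg_eq0 => /eqP ->; rewrite cps_sumE big1 // => i _.
  by rewrite cps_constME X0 mulr0.
have [F [F1 WE]] := order_ge_split W2.
apply/rowP => i; rewrite mxE; case: (irr i) => Sh h0 hirr.
have : pi W (h i) = 0.
  rewrite WE rmorph_sum cps_sumE big1 // => j _; rewrite rmorphM cpsME big1 // => u uh.
  have [->|Fu] := eqVneq (pi (cpsX K U_(j)%MM) u) 0; first by rewrite mul0r.
  have [->|Fv] := eqVneq (pi (F j) (h i - u)%MM) 0; first by rewrite mulr0.
  have /(_ _ _ (pi_S Fu) (pi_S Fv)) := hirr; case.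
  - move=> u0; move: Fu; rewrite u0 hom_const_term // cpsXE [0%MM == _]eq_sym mnm1_eq0.
    by rewrite eqxx.
  - by move=> u0; move: Fv; rewrite u0 hom_const_term // F1 ?mdeg0 // eqxx.
  - by rewrite addmC submK.
rewrite rmorph_sum cps_sumE (bigD1 i) //= big1 => [|j ji].
  by rewrite addr0 rmorphM piC piX cps_constME cpsXE eqxx mulr1.
rewrite rmorphM piC piX cps_constME cpsXE; have [/hI ij|] := eqVneq (h i) (h j).
  by rewrite ij eqxx in ji.
by rewrite mulr0.
Qed.

(** Restricted to a line on which the linear part of [X i] vanishes and those
    of the others do not, [X^a] vanishes to an order larger than [mdeg a], and
    [X^b] to the order [mdeg b]. *)
Lemma relation_degree k (h : 'I_k -> 'X_{1..q}) (X : 'I_k -> cps K e) a b i :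
    injective h -> (forall i, irreducible_exponent (h i)) ->
    (forall i, pi (X i) = cpsX K (h i)) ->
    mon h a = mon h b -> (0 < a i)%N -> b i = 0%N -> (mdeg a < mdeg b)%N.
Proof.
move=> hI irr piX ab ai bi; rewrite ltnNge; apply/negP => leba.
have [X0 /row_freeP[B LB]] := irreducible_free hI irr piX.
(* The linear parts being independent, they can be prescribed at one point. *)
pose u : 'cV[K]_k := \col_j (j != i)%:R.
have [Phi PhiP] := line_restriction (fun j => (B *m u) j 0).
have [w wP] := choice (fun j => PhiP (X j) (X0 j)).
have w0 j : w j 0%MM = (j != i)%:R.
  case: (wP j) => _ ->; transitivity (((\matrix_(i, j) X i U_(j)%MM) *m (B *m u)) j 0).
    by rewrite [RHS]mxE; apply: eq_bigr => l _; rewrite !mxE mulrC.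
  by rewrite mulmxA LB mul1mx mxE.
have Xab : \prod_j X j ^+ a j = \prod_j X j ^+ b j.
  apply: pi_inj; rewrite !rmorph_prod.
  have piXc (c : 'X_{1..k}) : \prod_j pi (X j ^+ c j) = cpsX K (mon h c).
    by rewrite /mon cpsX_sum; apply: eq_bigr => j _; rewrite rmorphXn piX.
  by rewrite !piXc ab.
have PhiX (c : 'X_{1..k}) : Phi (\prod_j X j ^+ c j) =
    cpsX K U_(ord0)%MM ^+ mdeg c * \prod_j w j ^+ c j.
  rewrite rmorph_prod mdegE -prodrXr -big_split; apply: eq_bigr => j _ /=.
  by rewrite rmorphXn -exprMn; case: (wP j) => ->.
have := congr1 Phi Xab; rewrite !PhiX -(subnK leba) addnC exprD -mulrA.
have t0 : cpsX K U_(ord0)%MM ^+ mdeg b <> 0 :> cps K 1.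
  apply: (@lead_neq0 _ _ _ (U_(ord0) *+ mdeg b)%MM); apply: leadX.
  split=> [|l]; first by rewrite cpsXE eqxx oner_eq0.
  by rewrite cpsXE; case: eqP => [->|//]; rewrite ltxx.
move/(cps_mulfI t0)/(congr1 (fun f : cps K 1 => f 0%MM)).
rewrite cpsM0E !cps_prodX0E (bigD1 i) //= w0 eqxx expr0n.
rewrite -[a i == 0%N]negbK -lt0n ai mul0r mulr0 big1 => [/esym/eqP|j _].
  by rewrite oner_eq0.
by rewrite w0; have [->|_] := eqVneq j i; rewrite ?bi ?expr1n.
Qed.

(** The irreducible exponents form a basis: there are finitely many since they
    give independent linear forms, they generate since degrees decrease in a
    decomposition, and after cancellation [relation_degree] applies to a
    relation in both directions. *)
Lemma free_monoid : S 0%MM -> exists k (h : 'I_k -> 'X_{1..q}),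
  [/\ forall i, h i != 0%MM, forall m, S m <-> exists a, mon h a = m &
      injective (mon h)].
Proof.
move=> S0.
pose P k := `[< exists h : 'I_k -> 'X_{1..q}, injective h /\
  forall i, irreducible_exponent (h i) >].
have preim k (h : 'I_k -> 'X_{1..q}) : (forall i, irreducible_exponent (h i)) ->
    exists X : 'I_k -> cps K e, forall i, pi (X i) = cpsX K (h i).
  move=> irr; have ex i : exists f, pi f = cpsX K (h i).
    by apply: S_pi; case: (irr i).
  by have [X XP] := choice ex; exists X.
have P0 : exists k, P k by exists 0%N; apply/asboolP; exists (fun=> 0%MM); split=> -[].
have Pe k : P k -> (k <= e)%N.
  move=> /asboolP[h [hI irr]]; have [X piX] := preim _ _ irr.
  have [_] := irreducible_free hI irr piX.
  by rewrite /row_free => /eqP <-; apply: rank_leq_col.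
case: (ex_maxnP P0 Pe) => k /asboolP[h [hI irr]] kmax; exists k, h.
have h_all m : irreducible_exponent m -> exists i, h i = m.
  move=> im; apply: contrapT => nh.
  have : P k.+1.
    apply/asboolP; exists (fun i => oapp h m (unlift ord0 i)); split=> [i j|i].
      case: (unliftP ord0 i) => [i'|] ->; case: (unliftP ord0 j) => [j'|] ->;
        rewrite ?liftK ?unlift_none //= => e'.
      - by rewrite (hI _ _ e').
      - by case: nh; exists i'.
      - by case: nh; exists j'.
    by case: unliftP => [j|] _ /=; [exact: irr|exact: im].
  by move/kmax; rewrite ltnn.
have Sh i : S (h i) by case: (irr i).
split=> [i|m|a b ab]; first by case: (irr i) => _ /eqP.
- split=> [|[a <-]]; last first.
    rewrite /mon; elim/big_ind: _ => // i _; elim: (a i) => [|c IH].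
      by rewrite mulm0n.
    by rewrite mulmS; apply: S_add.
  have [N mN] := ubnP (mdeg m); elim: N m mN => // N IH m mN Sm.
  have [->|/eqP m0] := eqVneq m 0%MM; first by exists 0%MM; rewrite mon0.
  have [/h_all[i <-]|nirr] := pselect (irreducible_exponent m).
    by exists U_(i)%MM; rewrite mon1.
  have [u [v [Su Sv u0 v0 uvm]]] : exists u v,
      [/\ S u, S v, u <> 0%MM, v <> 0%MM & (u + v)%MM = m].
    apply: contrapT => nuv; apply: nirr; split=> // u v Su Sv u0 v0 uvm.
    by apply: nuv; exists u, v.
  move: u0 v0 => /eqP; rewrite -mdeg_eq0 => u0 /eqP; rewrite -mdeg_eq0 => v0.
  have := mdegD u v; rewrite uvm => duv.
  have [|a au] := IH u _ Su; first by move: mN u0 v0 duv; lia.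
  have [|b bv] := IH v _ Sv; first by move: mN u0 v0 duv; lia.
  by exists (a + b)%MM; rewrite monD au bv.
- have [X piX] := preim _ _ irr.
  pose c := [multinom minn (a i) (b i) | i < k].
  have aE : a = (a - b + c)%MM by apply/mnmP => i; rewrite mnmDE mnmBE mnmE; lia.
  have bE : b = (b - a + c)%MM by apply/mnmP => i; rewrite mnmDE mnmBE mnmE; lia.
  have ab' : mon h (a - b)%MM = mon h (b - a)%MM.
    by apply: (@addIm _ (mon h c)); rewrite -!monD -aE -bE.
  have deg x y : mon h (x - y)%MM = mon h (y - x)%MM -> (x - y)%MM != 0%MM ->
      (mdeg (x - y)%MM < mdeg (y - x)%MM)%N.
    move=> xy xy0; have /existsP[i xi] : [exists i, (x - y)%MM i != 0%N].
      apply: contraNT xy0; rewrite negb_exists => /forallP z.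
      by apply/eqP/mnmP => i; rewrite mnm0E; apply/eqP; have := z i; rewrite negbK.
    apply: (relation_degree (i := i) hI irr piX xy); first by rewrite lt0n.
    by move: xi; rewrite !mnmBE; lia.
  have [ab0|/(deg _ _ ab')] := eqVneq (a - b)%MM 0%MM; last first.
    move=> lt1; have [ba0|/(deg _ _ (esym ab'))] := eqVneq (b - a)%MM 0%MM.
      by move: lt1; rewrite ba0 mdeg0.
    by move: lt1; lia.
  have [ba0|/(deg _ _ (esym ab'))] := eqVneq (b - a)%MM 0%MM.
    by rewrite [LHS]aE [RHS]bE ab0 ba0.
  by rewrite ab0 mdeg0.
Qed.

End FreeMonoid.

(** * Denominators and the saturation of a semigroup *)

Section Fractions.
Context (A : idomainType).
Local Notation "x %:F" := (@tofrac A x) : ring_scope.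

Lemma frac_exists (F : {fraction A}) : exists p d : A, d != 0 /\ F * d%:F = p%:F.
Proof.
rewrite -[F]reprK; set x := repr F.
exists \n_x, \d_x; split; first exact: denom_ratioP.
unlock tofrac; rewrite -[LHS]FracField.pi_mul; apply/eqmodP/eqP => /=.
by rewrite /FracField.mulf !numden_Ratio ?(oner_neq0, mul1r, mulr1) ?denom_ratioP // mulrC.
Qed.

(** The powers of an element integral of degree [n] are combinations of its
    first [n] powers, so a power of a denominator is a common denominator of
    all of them. *)
Lemma integral_denominator (F : {fraction A}) : integralOver (@tofrac A) F ->
  exists p d c : A, [/\ d != 0, c != 0, F * d%:F = p%:F &
    forall k, exists a, c%:F * F ^+ k = a%:F].
Proof.
move=> [P mP rP]; have [p [d [d0 Fd]]] := frac_exists F.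
exists p, d, (d ^+ size P); split; rewrite ?expf_neq0 // => k.
set r := Pdiv.CommonRing.rmodp 'X^k P.
have rN : (size r < size P)%N by apply/Pdiv.CommonRing.ltn_rmodpN0/monic_neq0.
have FkE : F ^+ k = (map_poly (@tofrac A) r).[F].
  have /(congr1 (fun p => (map_poly (@tofrac A) p).[F])) :=
    Pdiv.RingMonic.rdivp_eq mP 'X^k.
  by rewrite rmorphD rmorphM /= map_polyXn hornerD hornerM hornerXn (rootP rP) mulr0 add0r.
exists (\sum_(i < size r) r`_i * (d ^+ (size P - i) * p ^+ i)).
rewrite FkE horner_coef size_map_inj_poly; last 2 first.
- by move=> x y /eqP; rewrite tofrac_eq => /eqP.
- exact: tofrac0.
rewrite mulr_sumr rmorph_sum; apply: eq_bigr => i _ /=.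
rewrite coef_map !tofracM !tofracXn -Fd exprMn mulrCA; congr (_ * _).
rewrite mulrCA mulrC; congr (_ * _); rewrite -exprD subnK //.
by rewrite ltnW // (ltn_trans (ltn_ord i)).
Qed.

End Fractions.

Section Support.
Context (K : numFieldType) (q : nat).
Implicit Types (f g : cps K q).

Lemma supportedW f (S T : set 'X_{1..q}) :
  (forall m, S m -> T m) -> supported f S -> supported f T.
Proof. by move=> ST fS m /fS/ST. Qed.

Lemma supported_sum (I : Type) (r : seq I) (P : pred I) (F : I -> cps K q) S :
  (forall i, P i -> supported (F i) S) -> supported (\sum_(i <- r | P i) F i) S.
Proof.
move=> FS; elim/big_ind: _ => [m|f g|]; last exact: FS.
  by rewrite cps0E eqxx.
exact: supportedD.
Qed.

Lemma supported_cpsX (S : set 'X_{1..q}) m : S m -> supported (cpsX K m) S.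
Proof. by move=> Sm k; rewrite cpsXE; case: (k =P m) => [->//|_]; rewrite eqxx. Qed.

Lemma supported_const (S : set 'X_{1..q}) c f : supported f S -> supported (cps_const q c * f) S.
Proof.
by move=> fS m; rewrite cps_constME => cf; apply: fS; apply: contraNneq cf => ->; rewrite mulr0.
Qed.

End Support.

Section Saturation.
Context (K : numFieldType) (n q : nat) (g : 'I_n -> 'X_{1..q}).
Local Notation Gamma := (range (mon g)).

Lemma Gamma0 : Gamma 0%MM.
Proof. by exists 0%MM; rewrite // mon0. Qed.

Lemma GammaD a b : Gamma a -> Gamma b -> Gamma (a + b)%MM.
Proof. by move=> [x _ <-] [y _ <-]; exists (x + y)%MM; rewrite // monD. Qed.

Lemma GammaMn a k : Gamma a -> Gamma (a *+ k)%MM.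
Proof.
move=> Ga; elim: k => [|k IH]; first by rewrite mulm0n; exact: Gamma0.
by rewrite mulmS; exact: GammaD.
Qed.

(** The exponents of the monomials of the normalization of [C{Gamma}]: a
    fraction of monomials is integral when one of its powers lies in
    [C{Gamma}]. *)
Definition saturation : set 'X_{1..q} := [set m |
  (exists2 k, (0 < k)%N & Gamma (m *+ k)%MM) /\
  (exists2 b, Gamma b & Gamma (b + m)%MM)]%classic.

Lemma mulm_comm (m : 'X_{1..q}) a b : (m *+ a *+ b)%MM = (m *+ (a * b))%MM.
Proof. by apply/mnmP => i; rewrite !mulmnE mulnA. Qed.

Lemma mulmDl (a b : 'X_{1..q}) k : ((a + b) *+ k)%MM = (a *+ k + b *+ k)%MM.
Proof. by apply/mnmP => i; rewrite !(mulmnE, mnmDE) mulnDl. Qed.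

Lemma mulmD (a : 'X_{1..q}) k l : (a *+ (k + l))%MM = (a *+ k + a *+ l)%MM.
Proof. by apply/mnmP => i; rewrite !(mulmnE, mnmDE) mulnDr. Qed.

Lemma Gamma_saturation m : Gamma m -> saturation m.
Proof.
by move=> Gm; split; [exists 1%N; rewrite ?mulm1n | exists 0%MM; rewrite ?add0m //; exact: Gamma0].
Qed.

Lemma saturation_add a b : saturation a -> saturation b -> saturation (a + b)%MM.
Proof.
move=> [[k k0 ak] [c Gc Gca]] [[l l0 bl] [e Ge Geb]]; split.
  exists (k * l)%N; first by rewrite muln_gt0 k0.
  rewrite mulmDl -mulm_comm [(k * l)%N]mulnC -mulm_comm.
  by apply: GammaD; apply: GammaMn.
exists (c + e)%MM; first exact: GammaD.
have -> : (c + e + (a + b) = (c + a) + (e + b))%MM.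
  by apply/mnmP => i; rewrite !mnmDE addnACA.
exact: GammaD.
Qed.

(** Almost integrality over [C{Gamma}], which integral fractions satisfy; unlike
    integrality it is expressed by supports alone. *)
Definition almost_integral (f : cps K q) := exists c, [/\ c <> 0, supported c Gamma &
  forall k, supported (c * f ^+ k) Gamma].

Lemma almost_integralB f h : almost_integral f -> almost_integral h ->
  almost_integral (f - h).
Proof.
move=> [c [c0 cG cf]] [d [d0 dG dh]]; exists (c * d); split.
- exact: cps_mul_neq0.
- exact: supportedM GammaD cG dG.
move=> k; rewrite exprBn mulr_sumr; apply: supported_sum => i _.
have -> : c * d * ((-1) ^+ i * f ^+ (k - i) * h ^+ i *+ 'C(k, i)) =
    cps_const q ((-1) ^+ i *+ 'C(k, i)) * ((c * f ^+ (k - i)) * (d * h ^+ i)).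
  rewrite rmorphMn rmorphXn rmorphN rmorph1 mulrnAl mulrnAr; congr (_ *+ _).
  by move: (_ ^+ i) (f ^+ _) (h ^+ i) => x y z; ring.
by apply: supported_const; apply: supportedM GammaD _ _.
Qed.

Lemma almost_integral0 : almost_integral 0.
Proof.
exists 1; split=> [/eqP||k].
- by rewrite oner_eq0.
- by rewrite -cpsX0; apply: supported_cpsX; exact: Gamma0.
- case: k => [|k]; last by rewrite exprS mul0r mulr0 => m; rewrite cps0E eqxx.
  by rewrite expr0 mulr1 -cpsX0; apply: supported_cpsX; exact: Gamma0.
Qed.

Lemma almost_integral_sum (I : Type) (r : seq I) (P : pred I) (F : I -> cps K q) :
  (forall i, P i -> almost_integral (F i)) ->
  almost_integral (\sum_(i <- r | P i) F i).
Proof.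
move=> Fai; elim/big_ind: _ => [|f h fi hi|]; [exact: almost_integral0| |exact: Fai].
rewrite -[h]opprK -[- h]sub0r.
by apply: almost_integralB => //; apply: almost_integralB => //; exact: almost_integral0.
Qed.

Lemma almost_integral_monomial c m : saturation m ->
  almost_integral (cps_const q c * cpsX K m).
Proof.
move=> [[N N0 mN] [b Gb Gbm]]; exists (cpsX K (b *+ N)%MM); split.
- move=> /(congr1 (fun f : cps K q => f (b *+ N)%MM))/eqP.
  by rewrite cpsXE eqxx cps0E oner_eq0.
- by apply: supported_cpsX; apply: GammaMn.
move=> k; rewrite exprMn mulrCA -rmorphXn; apply: supported_const.
have -> : cpsX K m ^+ k = cpsX K (m *+ k)%MM.
  by elim: k => [|k IH]; rewrite ?mulm0n ?cpsX0 // mulmS cpsX_add exprS IH.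
rewrite -cpsX_add; apply: supported_cpsX.
(* Of the [k] summands [m], all but [k %% N] are grouped by [N]; each of the
     others is combined with one of the [N] summands [b]. *)
have -> : (b *+ N + m *+ k = b *+ (N - k %% N) + (b + m) *+ (k %% N) + (m *+ N) *+ (k %/ N))%MM.
  apply/mnmP => i; rewrite !(mulmnE, mnmDE).
  have := divn_eq k N; have := ltn_pmod k N0.
  by set r := (k %% N)%N; set s := (k %/ N)%N => rN kE; rewrite [in LHS]kE; nia.
by apply: GammaD; [apply: GammaD|]; apply: GammaMn.
Qed.

(** If [m] is the leading exponent of [f] and [c f^k] is supported on [Gamma]
    for all [k], then so is [e + k m], with [e] the leading exponent of [c]. By
    Dickson's lemma the difference of two of these elements is in [Gamma]. *)
Lemma almost_integral_lead f m : almost_integral f -> lead f m -> saturation m.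
Proof.
move=> [c [/lead_exists[e ce] _ cf]] fm.
have Gem k : Gamma (e + m *+ k)%MM.
  by have [_ [nz _]] := leadM ce (leadX k fm); exact: (cf k _ nz).
have ex k : exists a, mon g a = (e + m *+ k)%MM by have [a _ ea] := Gem k; exists a.
have [a aE] := choice ex.
split; last first.
  exists e; last by have := Gem 1%N; rewrite mulm1n.
  by have := Gem 0%N; rewrite mulm0n addm0.
have [i [j [ij aij]]] := dickson (fun k (x : 'I_n) => a k x).
exists (j - i)%N; first by rewrite subn_gt0.
exists (a j - a i)%MM => //; apply: (@addmI _ (mon g (a i))).
have aij' : (a i <= a j)%MM by apply/mnm_lepP.
rewrite -monD addmC submK // !aE -addmA -mulmD subnKC //; exact: ltnW.
Qed.

(** At the first exponent [m] of [f] outside the saturation, the earlier terms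
    can be removed, and then [m] is a leading exponent. *)
Lemma almost_integral_supported f : almost_integral f -> supported f saturation.
Proof.
move=> fai; apply: (@ltmwf q (fun m => f m != 0 -> saturation m)) => m IH fm.
pose P := \sum_(k : 'X_{1..q < (mdeg m).+1} | (val k < m)%O) cps_const q (f k) * cpsX K k.
have Pai : almost_integral P.
  apply: almost_integral_sum => k km.
  have [fk|fk] := eqVneq (f k) 0; last by apply/almost_integral_monomial/IH.
  by rewrite fk rmorph0 mul0r; exact: almost_integral0.
have PE (k : 'X_{1..q}) : (k <= m)%O -> P k = if (k < m)%O then f k else 0.
  move=> km; rewrite cps_sumE; have kN : (mdeg k < (mdeg m).+1)%N by rewrite ltnS lemc_mdeg.
  under eq_bigr do rewrite cps_constME cpsXE.
  case: ifP => [km'|/negbT nkm].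
    rewrite (bigD1 (BMultinom kN)) //= eqxx mulr1 big1 ?addr0 // => l /andP[_].
    by rewrite -val_eqE eq_sym /= => /negPf ->; rewrite mulr0.
  by rewrite big1 // => l lm; case: eqP => [kl|_]; [move: nkm; rewrite kl lm | rewrite mulr0].
apply: (almost_integral_lead (almost_integralB fai Pai)).
split=> [|k km]; first by rewrite cpsBE PE // ltxx subr0.
by rewrite cpsBE PE ?(ltW km) // km subrr.
Qed.

End Saturation.

(** * The normalization of a toric algebra *)

(** Fractions have no preferred representative, so the morphisms from or to the
    normalization are given by their graphs. *)
Lemma rmorphism_of_relation (E E' : comNzRingType) (r : E -> E' -> Prop) :
    (forall x, exists y, r x y) -> (forall x y y', r x y -> r x y' -> y = y') ->
    (forall x x' y y', r x y -> r x' y' -> r (x - x') (y - y')) ->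
    (forall x x' y y', r x y -> r x' y' -> r (x * x') (y * y')) -> r 1 1 ->
  exists phi : {rmorphism E -> E'}, forall x, r x (phi x).
Proof.
move=> ex uniq rB rM r1; have [phi phiP] := choice ex.
have phiB : zmod_morphism phi.
  by move=> x y; apply: uniq (phiP _) _; apply: rB.
have phiM : monoid_morphism phi.
  by split=> [|x y]; apply: uniq (phiP _) _ => //; apply: rM.
pose P : {rmorphism E -> E'} := HB.pack phi
  (GRing.isZmodMorphism.Build _ _ phi phiB) (GRing.isMonoidMorphism.Build _ _ phi phiM).
by exists P.
Qed.

Lemma rmorphism_factor (E E' A : comNzRingType) (phi : {rmorphism E -> A})
    (mu : {rmorphism E -> E'}) :
    (forall a, exists f, phi f = a) -> (forall f h, phi f = phi h <-> mu f = mu h) ->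
  exists j : {rmorphism A -> E'}, injective j /\ forall f, j (phi f) = mu f.
Proof.
move=> phi_surj ker.
have [|||||j jP] := @rmorphism_of_relation A E' (fun a h => exists2 f, phi f = a & mu f = h).
- by move=> a; have [f fa] := phi_surj a; exists (mu f); exists f.
- by move=> a h h' [f fa <-] [f' fa' <-]; apply/ker; rewrite fa.
- by move=> a a' h h' [f <- <-] [f' <- <-]; exists (f - f'); rewrite rmorphB.
- by move=> a a' h h' [f <- <-] [f' <- <-]; exists (f * f'); rewrite rmorphM.
- by exists 1; rewrite rmorph1.
exists j; split=> [a b ab|f].
  have [f fa jfa] := jP a; have [h hb jhb] := jP b.
  by rewrite -fa -hb; apply/ker; rewrite jfa jhb.
by have [h /ker <-] := jP (phi f).
Qed.

Section Normalization.
Context (K : numFieldType) (A : idomainType) (iota : {rmorphism K -> A}).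
Context (n q : nat) (g : 'I_n -> 'X_{1..q}) (j : {rmorphism A -> cps K q}).
Local Notation "x %:F" := (@tofrac A x) : ring_scope.
Local Notation Gamma := (range (mon g)).
Hypothesis j_inj : injective j.
Hypothesis jC : forall c, j (iota c) = cps_const q c.
Hypothesis j_range : forall f, (exists a, j a = f) <-> supported f Gamma.

(** The graph of the extension of [j] to fractions, on those fractions that it
    sends to power series. *)
Definition frac_rel (F : {fraction A}) (f : cps K q) := exists p d : A,
  [/\ d != 0, F * d%:F = p%:F & j p = f * j d].

Let j_neq0 d : d != 0 -> j d <> 0.
Proof. by move=> /eqP d0; rewrite -(rmorph0 j) => /j_inj. Qed.

Let F_neq0 d : d != 0 -> d%:F != 0 :> {fraction A}.
Proof. by rewrite tofrac_eq0. Qed.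

Let tofrac_inj : injective (@tofrac A).
Proof. by move=> x y /eqP; rewrite tofrac_eq => /eqP. Qed.

Lemma frac_rel_uniqr F f f' : frac_rel F f -> frac_rel F f' -> f = f'.
Proof.
move=> [p [d [d0 Fd pf]]] [p' [d' [d'0 Fd' pf']]].
have /(congr1 j) : p * d' = p' * d.
  by apply: tofrac_inj; rewrite !tofracM -Fd -Fd' mulrAC.
rewrite !rmorphM pf pf' => e; apply: (cps_mulfI (cps_mul_neq0 (j_neq0 d0) (j_neq0 d'0))).
by rewrite mulrC mulrA e mulrC; ring.
Qed.

Lemma frac_rel_uniql F F' f : frac_rel F f -> frac_rel F' f -> F = F'.
Proof.
move=> [p [d [d0 Fd pf]]] [p' [d' [d'0 Fd' pf']]].
have e : p * d' = p' * d by apply: j_inj; rewrite !rmorphM pf pf' mulrAC.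
apply: (mulIf (mulf_neq0 (F_neq0 d0) (F_neq0 d'0))).
by rewrite mulrA Fd [d%:F * _]mulrC mulrA Fd' -!tofracM e.
Qed.

Lemma frac_relB F F' f f' : frac_rel F f -> frac_rel F' f' -> frac_rel (F - F') (f - f').
Proof.
move=> [p [d [d0 Fd pf]]] [p' [d' [d'0 Fd' pf']]].
exists (p * d' - p' * d), (d * d'); split; first by rewrite mulf_neq0.
  by rewrite tofracB !tofracM -Fd -Fd'; ring.
by rewrite rmorphB !rmorphM pf pf'; ring.
Qed.

Lemma frac_relM F F' f f' : frac_rel F f -> frac_rel F' f' -> frac_rel (F * F') (f * f').
Proof.
move=> [p [d [d0 Fd pf]]] [p' [d' [d'0 Fd' pf']]].
exists (p * p'), (d * d'); split; first by rewrite mulf_neq0.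
  by rewrite !tofracM -Fd -Fd'; ring.
by rewrite !rmorphM pf pf'; ring.
Qed.

Lemma frac_rel_id a : frac_rel a%:F (j a).
Proof. by exists a, 1; rewrite oner_neq0 tofrac1 rmorph1 !mulr1. Qed.

Lemma frac_relD F F' f f' : frac_rel F f -> frac_rel F' f' -> frac_rel (F + F') (f + f').
Proof.
move=> Ff Ff'; have := frac_relB (frac_rel_id 0) Ff'.
by rewrite tofrac0 rmorph0 !sub0r => /(frac_relB Ff); rewrite !opprK.
Qed.

Lemma frac_relX F f k : frac_rel F f -> frac_rel (F ^+ k) (f ^+ k).
Proof.
move=> Ff; elim: k => [|k IH]; last by rewrite !exprS; apply: frac_relM.
by rewrite !expr0 -(rmorph1 j) -tofrac1; exact: frac_rel_id.
Qed.

(** As [C{y}] is completely integrally closed, the integral closure of [A] is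
    made of power series; their exponents lie in the saturation of [Gamma]. *)
Lemma integral_series F : integralOver (@tofrac A) F ->
  exists2 f, frac_rel F f & supported f (saturation g).
Proof.
move=> /integral_denominator[p [d [c [d0 c0 Fd cF]]]].
have cpd k : exists a, j c * j p ^+ k = j a * j d ^+ k.
  have [a cFa] := cF k; exists a.
  rewrite -!rmorphXn -!rmorphM; congr (j _); apply: tofrac_inj.
  by rewrite !tofracM !tofracXn -Fd exprMn mulrA cFa.
have [|r pr] := cps_normal (j_neq0 d0) (j_neq0 c0) (p := j p).
  by move=> k; have [a ca] := cpd k; exists (j a).
exists r; first by exists p, d; split=> //; rewrite mulrC.
apply: almost_integral_supported; exists (j c); split; first exact: j_neq0.
  by apply/j_range; exists c.
move=> k; have [a ca] := cpd k; apply/j_range; exists a.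
have dk0 : j d ^+ k <> 0 by rewrite -rmorphXn; apply/j_neq0/expf_neq0.
by apply: (cps_mulfI dk0); rewrite mulrC -ca pr exprMn; ring.
Qed.

Lemma saturation_monomial s : saturation g s ->
  exists2 F, frac_rel F (cpsX K s) & integralOver (@tofrac A) F.
Proof.
move=> [[k k0 sk] [b Gb Gbs]].
have mono m : Gamma m -> exists a, j a = cpsX K m.
  by move=> Gm; apply/j_range; apply: supported_cpsX.
have [x xE] := mono _ Gb; have [y yE] := mono _ Gbs; have [z zE] := mono _ sk.
have x0 : x != 0.
  apply/eqP => x0; have := congr1 (fun f : cps K q => f b) xE.
  by move/eqP; rewrite x0 rmorph0 cps0E cpsXE eqxx eq_sym oner_eq0.
have rF : frac_rel (y%:F / x%:F) (cpsX K s).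
  exists y, x; split=> //; first by rewrite divfK // F_neq0.
  by rewrite yE xE cpsX_add mulrC.
exists (y%:F / x%:F) => //; exists ('X^k - z%:P).
  by rewrite monicE lead_coefDl ?lead_coefXn // size_polyN size_polyXn size_polyC; case: eqP.
rewrite rmorphB /= map_polyXn map_polyC /root hornerD hornerN hornerXn hornerC subr_eq0.
apply/eqP; apply: frac_rel_uniql (frac_relX k rF) _.
have -> : cpsX K s ^+ k = j z; last exact: frac_rel_id.
by rewrite zE; elim: k {k0 sk zE} => [|k IH]; rewrite ?mulm0n ?cpsX0 // mulmS cpsX_add exprS IH.
Qed.

Section Smooth.
Context (e : nat) (psi : {rmorphism cps K e -> {fraction A}}).
Hypothesis psiC : forall c, psi (cps_const e c) = (iota c)%:F.
Hypothesis psi_range : forall F, (exists f, psi f = F) <-> integralOver (@tofrac A) F.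
Hypothesis psi_inj : injective psi.

(** The isomorphism with [C{x_1, .., x_e}] turns the inclusion of the
    normalization in [C{y}] into a morphism to which [free_monoid] applies. *)
Lemma smooth_saturation_free : exists k (h : 'I_k -> 'X_{1..q}),
  [/\ forall i, h i != 0%MM, forall m, saturation g m <-> exists a, mon h a = m &
      injective (mon h)].
Proof.
have psi_int f : integralOver (@tofrac A) (psi f) by apply/psi_range; exists f.
have [|||||pi piP] := @rmorphism_of_relation (cps K e) (cps K q) (fun f => frac_rel (psi f)).
- by move=> f; have [h hP _] := integral_series (psi_int f); exists h.
- by move=> f; exact: frac_rel_uniqr.
- by move=> f f' h h' fh fh'; rewrite rmorphB; exact: frac_relB.
- by move=> f f' h h' fh fh'; rewrite rmorphM; exact: frac_relM.
- by rewrite rmorph1 -tofrac1 -(rmorph1 j); exact: frac_rel_id.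
apply: (@free_monoid K e q pi).
- move=> c; apply: frac_rel_uniqr (piP _) _; rewrite psiC -jC; exact: frac_rel_id.
- by move=> f f' ff'; apply: psi_inj; apply: frac_rel_uniql (piP f) _; rewrite ff'.
- exact: saturation_add.
- move=> f; have [h fh hS] := integral_series (psi_int f).
  by rewrite (frac_rel_uniqr (piP f) fh).
- move=> s /saturation_monomial[F FX /psi_range[f fF]]; exists f.
  by apply: frac_rel_uniqr (piP f) _; rewrite fF.
- exact/Gamma_saturation/Gamma0.
Qed.

End Smooth.

Section FreeSaturation.
Context (k : nat) (h : 'I_k -> 'X_{1..q}) (nu : {rmorphism cps K k -> cps K q}).
Hypothesis h0 : forall i, h i != 0%MM.
Hypothesis h_sat : forall m, saturation g m <-> exists a, mon h a = m.
Hypothesis h_inj : injective (mon h).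
Hypothesis nuC : const_compat (cps_const q) nu.
Hypothesis nuE : forall f e N, (mdeg e < N)%N ->
  nu f e = \sum_(a : 'X_{1..k < N} | mon h a == e) f a.

Let nu_mon f a : nu f (mon h a) = f a.
Proof.
rewrite (nuE _ (N := (mdeg (mon h a)).+1)) //.
have aN : (mdeg a < (mdeg (mon h a)).+1)%N by rewrite ltnS mdeg_mon.
rewrite (bigD1 (BMultinom aN)) //= big1 ?addr0 // => b /andP[/eqP/h_inj ba].
by rewrite -val_eqE /= ba eqxx.
Qed.

Let nu_inj : injective nu.
Proof. by move=> f f' ff'; apply: cps_ext => a; rewrite -!nu_mon ff'. Qed.

(** [Gamma] in the coordinates given by the basis [h] of its saturation. *)
Definition pulled_back : set 'X_{1..k} := [set m | Gamma (mon h m)]%classic.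

Lemma nu_supported f : supported (nu f) Gamma <-> supported f pulled_back.
Proof.
split=> [fG m fm|fG m].
  by apply: fG; rewrite nu_mon.
rewrite (nuE _ (N := (mdeg m).+1)) // => fm; apply: contrapT => nG.
move/eqP: fm; apply; rewrite big1 // => a /eqP am; apply/eqP; apply: contrapT.
by move=> /negP/fG; rewrite /pulled_back /= am.
Qed.

Lemma common_multiple : exists2 N, (0 < N)%N &
  forall m : 'X_{1..k}, (forall i, N %| m i)%N -> pulled_back m.
Proof.
have ex i : exists N, (0 < N)%N /\ Gamma (h i *+ N)%MM.
  have [_] := h_sat (h i); case; first by exists U_(i)%MM; rewrite mon1.
  by move=> [N N0 hN] _; exists N.
have [N NP] := choice ex; exists (\prod_i N i)%N.
  by rewrite prodn_gt0 // => i; case: (NP i).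
move=> m Nm; rewrite /pulled_back /= /mon.
elim/big_ind: _ => [||i _]; [exact: Gamma0|exact: GammaD|].
have /dvdnP[c ->] : (N i %| m i)%N.
  by apply: dvdn_trans (Nm i); rewrite (bigD1 i) //= dvdn_mulr.
by rewrite mulnC -mulm_comm; apply: GammaMn; case: (NP i).
Qed.

(** Every monomial is a product of one of finitely many monomials, all of them
    integral over [A], by a monomial with exponents divisible by [N], which
    belongs to [A]. *)
Lemma series_integral f : exists2 F, frac_rel F (nu f) & integralOver (@tofrac A) F.
Proof.
have [N N0 NG] := common_multiple.
pose good f := exists2 F, frac_rel F f & integralOver (@tofrac A) F.
have goodM f1 f2 : good f1 -> good f2 -> good (f1 * f2).
  by move=> [F1 r1 i1] [F2 r2 i2]; exists (F1 * F2); [exact: frac_relM | exact: integral_mul].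
have goodD f1 f2 : good f1 -> good f2 -> good (f1 + f2).
  by move=> [F1 r1 i1] [F2 r2 i2]; exists (F1 + F2); [exact: frac_relD | exact: integral_add].
have good_j a : good (j a).
  by exists a%:F; [exact: frac_rel_id | exact: integral_id].
pose u : seq 'X_{1..k} := [seq [multinom nat_of_ord (b i) | i < k] | b : {ffun 'I_k -> 'I_N}].
have [|F [FN ->]] := @split_support K k u [set m | forall i, N %| m i]%N%classic f.
  move=> m _; exists [multinom m i %% N | i < k]%N.
    apply/mapP; exists [ffun i => Ordinal (ltn_pmod (m i) N0)]; rewrite ?mem_enum //.
    by apply/mnmP => i; rewrite !mnmE ffunE.
  split; first by apply/mnm_lepP => i; rewrite mnmE leq_mod.
  by move=> i; rewrite mnmBE mnmE /dvdn {1}(divn_eq (m i) N) addnK modnMl.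
rewrite rmorph_sum; elim/big_ind: _ => [|//|i _].
  by rewrite -(rmorph0 j); exact: good_j.
rewrite rmorphM; apply: goodM; last first.
  have [|a <-] := (j_range (nu (F i))).2; last exact: good_j.
  by apply/nu_supported; apply: supportedW (FN i).
rewrite (monomial_subst_X nuE); apply: saturation_monomial.
by apply/h_sat; eexists.
Qed.

(** A series in [t] is sent to the fraction that the extension of [j] maps to
    its image [nu f] in [C{y}]; every integral fraction is reached, since the
    support of its series consists of combinations of the [h_i]. *)
Lemma normalization_coordinates : exists psi0 : {rmorphism cps K k -> {fraction A}},
  [/\ forall c, psi0 (cps_const k c) = (iota c)%:F,
      forall F, (exists f, psi0 f = F) <-> integralOver (@tofrac A) F,
      injective psi0 &
      forall f, (exists a, psi0 f = a%:F) <-> supported f pulled_back].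
Proof.
have [|||||psi0 psiP] := @rmorphism_of_relation (cps K k) {fraction A}
  (fun f F => frac_rel F (nu f)).
- by move=> f; have [F rF _] := series_integral f; exists F.
- by move=> f F F'; exact: frac_rel_uniql.
- by move=> f f' F F' fF fF'; rewrite rmorphB; exact: frac_relB.
- by move=> f f' F F' fF fF'; rewrite rmorphM; exact: frac_relM.
- by rewrite rmorph1 -tofrac1 -(rmorph1 j); exact: frac_rel_id.
exists psi0; split.
- move=> c; apply: frac_rel_uniql (psiP _) _.
  by rewrite nuC -jC; exact: frac_rel_id.
- move=> F; split=> [[f <-]|/integral_series[f rF fS]].
    by have [F' rF' iF'] := series_integral f; rewrite (frac_rel_uniql (psiP f) rF').
  have [|f' f'E] := @monomial_subst_lift K k q h h0 nu f nuE.
    by apply: supportedW fS => m /h_sat[a <-]; exists a.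
  by exists f'; apply: frac_rel_uniql (psiP f') _; rewrite f'E.
- by move=> f f' ff'; apply: nu_inj; apply: frac_rel_uniqr (psiP f) _; rewrite ff'.
- move=> f; rewrite -nu_supported -j_range; split=> [[a fa]|[a fa]]; exists a.
    by apply: frac_rel_uniqr (frac_rel_id a) _; rewrite -fa.
  by apply: frac_rel_uniql (psiP f) _; rewrite -fa; exact: frac_rel_id.
Qed.

End FreeSaturation.
End Normalization.

(** * Lipschitz functions and the torus action *)

Section TwoGroups.
Context (K : numFieldType) (n1 n2 : nat).

Lemma cps_inl_exists : exists Phi : {rmorphism cps K n1 -> cps K (n1 + n2)},
  forall f, Phi f = cps_inl n2 f.
Proof.
pose g (i : 'I_n1) : 'X_{1..n1 + n2} := U_(lshift n2 i)%MM.
have [|Phi [_ PhiE]] := @monomial_subst K n1 (n1 + n2) g.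
  by move=> i; rewrite mnm1_eq0.
have lg a : lmon (mon g a) = a.
  apply/mnmP => i; rewrite mnmE mnm_sumE (bigD1 i) //= big1 => [|l li].
    by rewrite mulmnE mnm1E eqxx mul1n addn0.
  by rewrite mulmnE mnm1E eq_lshift (negPf li).
have rg a : rmon (mon g a) = 0%MM.
  apply/mnmP => i; rewrite mnmE mnm_sumE mnm0E big1 // => l _.
  by rewrite mulmnE mnm1E eq_lrshift.
exists Phi => f; apply: cps_ext => e; rewrite (PhiE _ _ (mdeg e).+1) //= /inl_coef.
case: ifP => [/eqP re|re]; last first.
  by rewrite big1 // => a /eqP ae; rewrite -ae rg eqxx in re.
have lN : (mdeg (lmon e) < (mdeg e).+1)%N by rewrite ltnS mdeg_lrmon leq_addr.
rewrite (bigD1 (BMultinom lN)) /=; last by apply/eqP/lrmon_inj; rewrite ?lg ?rg.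
rewrite big1 ?addr0 // => a /andP[/eqP ae].
by move: (lg a); rewrite ae -val_eqE /= => ->; rewrite eqxx.
Qed.

Lemma cps_inr_exists : exists Phi : {rmorphism cps K n2 -> cps K (n1 + n2)},
  forall f, Phi f = cps_inr n1 f.
Proof.
pose g (i : 'I_n2) : 'X_{1..n1 + n2} := U_(rshift n1 i)%MM.
have [|Phi [_ PhiE]] := @monomial_subst K n2 (n1 + n2) g.
  by move=> i; rewrite mnm1_eq0.
have rg a : rmon (mon g a) = a.
  apply/mnmP => i; rewrite mnmE mnm_sumE (bigD1 i) //= big1 => [|l li].
    by rewrite mulmnE mnm1E eqxx mul1n addn0.
  by rewrite mulmnE mnm1E eq_rshift (negPf li).
have lg a : lmon (mon g a) = 0%MM.
  apply/mnmP => i; rewrite mnmE mnm_sumE mnm0E big1 // => l _.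
  by rewrite mulmnE mnm1E eq_rlshift.
exists Phi => f; apply: cps_ext => e; rewrite (PhiE _ _ (mdeg e).+1) //= /inr_coef.
case: ifP => [/eqP le|le]; last first.
  by rewrite big1 // => a /eqP ae; rewrite -ae lg eqxx in le.
have rN : (mdeg (rmon e) < (mdeg e).+1)%N by rewrite ltnS mdeg_lrmon leq_addl.
rewrite (bigD1 (BMultinom rN)) /=; last by apply/eqP/lrmon_inj; rewrite ?lg ?rg.
rewrite big1 ?addr0 // => a /andP[/eqP ae].
by move: (rg a); rewrite ae -val_eqE /= => ->; rewrite eqxx.
Qed.

Fact cps_inl_zmod : zmod_morphism (@cps_inl K n1 n2).
Proof. by have [Phi P] := cps_inl_exists => f g; rewrite -!P rmorphB. Qed.
Fact cps_inl_monoid : monoid_morphism (@cps_inl K n1 n2).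
Proof. by have [Phi P] := cps_inl_exists; split=> [|f g]; rewrite -!P ?rmorph1 ?rmorphM. Qed.
Fact cps_inr_zmod : zmod_morphism (@cps_inr K n1 n2).
Proof. by have [Phi P] := cps_inr_exists => f g; rewrite -!P rmorphB. Qed.
Fact cps_inr_monoid : monoid_morphism (@cps_inr K n1 n2).
Proof. by have [Phi P] := cps_inr_exists; split=> [|f g]; rewrite -!P ?rmorph1 ?rmorphM. Qed.
HB.instance Definition _ := GRing.isZmodMorphism.Build _ _ (@cps_inl K n1 n2) cps_inl_zmod.
HB.instance Definition _ := GRing.isMonoidMorphism.Build _ _ (@cps_inl K n1 n2) cps_inl_monoid.
HB.instance Definition _ := GRing.isZmodMorphism.Build _ _ (@cps_inr K n1 n2) cps_inr_zmod.
HB.instance Definition _ := GRing.isMonoidMorphism.Build _ _ (@cps_inr K n1 n2) cps_inr_monoid.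

Lemma lmon0 : lmon (0%MM : 'X_{1..n1 + n2}) = 0%MM.
Proof. by apply/mnmP => i; rewrite mnmE !mnm0E. Qed.
Lemma rmon0 : rmon (0%MM : 'X_{1..n1 + n2}) = 0%MM.
Proof. by apply/mnmP => i; rewrite mnmE !mnm0E. Qed.

Lemma cps_inl0E (f : cps K n1) : cps_inl n2 f 0%MM = f 0%MM :> K.
Proof. by rewrite /= /inl_coef rmon0 eqxx lmon0. Qed.
Lemma cps_inr0E (f : cps K n2) : cps_inr n1 f 0%MM = f 0%MM :> K.
Proof. by rewrite /= /inr_coef lmon0 eqxx rmon0. Qed.

Lemma mon_eq0 (e : 'X_{1..n1 + n2}) : (e == 0%MM) = (lmon e == 0%MM) && (rmon e == 0%MM).
Proof. by rewrite -!mdeg_eq0 mdeg_lrmon addn_eq0. Qed.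

Lemma cps_inl_const : const_compat (cps_const (n1 + n2)) (@cps_inl K n1 n2).
Proof.
move=> c; apply: cps_ext => e; rewrite /= /inl_coef /const_coef mon_eq0.
by case: (lmon e == _); case: (rmon e == _).
Qed.
Lemma cps_inr_const : const_compat (cps_const (n1 + n2)) (@cps_inr K n1 n2).
Proof.
move=> c; apply: cps_ext => e; rewrite /= /inr_coef /const_coef mon_eq0.
by case: (lmon e == _); case: (rmon e == _).
Qed.

Lemma cps_inlX (i : 'I_n1) : cps_inl n2 (cpsX K U_(i)%MM) = cpsX K U_(lshift n2 i)%MM.
Proof.
apply: cps_ext => e; rewrite /= /inl_coef.
have lU : lmon U_(lshift n2 i)%MM = U_(i)%MM.
  by apply/mnmP => l; rewrite mnmE !mnm1E eq_lshift.
have rU : rmon U_(lshift n2 i)%MM = 0%MM.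
  by apply/mnmP => l; rewrite mnmE mnm1E eq_lrshift mnm0E.
have [->|ne] := eqVneq e U_(lshift n2 i)%MM; first by rewrite lU rU !eqxx.
case: eqP => // re; case: eqP => // le; case/eqP: ne.
by apply: lrmon_inj; rewrite ?lU ?rU.
Qed.

Lemma cps_inrX (i : 'I_n2) : cps_inr n1 (cpsX K U_(i)%MM) = cpsX K U_(rshift n1 i)%MM.
Proof.
apply: cps_ext => e; rewrite /= /inr_coef.
have rU : rmon U_(rshift n1 i)%MM = U_(i)%MM.
  by apply/mnmP => l; rewrite mnmE !mnm1E eq_rshift.
have lU : lmon U_(rshift n1 i)%MM = 0%MM.
  by apply/mnmP => l; rewrite mnmE mnm1E eq_rlshift mnm0E.
have [->|ne] := eqVneq e U_(rshift n1 i)%MM; first by rewrite lU rU !eqxx.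
case: eqP => // le; case: eqP => // re; case/eqP: ne.
by apply: lrmon_inj; rewrite ?lU ?rU.
Qed.

End TwoGroups.

(** Substitute in each group of variables the images of the variables under
    [pi]; on series in one group this agrees with [pi] by [hom_uniq]. *)
Lemma hom_double (K : numFieldType) n k (pi : {rmorphism cps K n -> cps K k}) :
    const_compat (cps_const k) pi ->
  exists Psi : {rmorphism cps K (n + n) -> cps K (k + k)},
    (forall f, Psi (cps_inl n f) = cps_inl k (pi f)) /\
    (forall f, Psi (cps_inr n f) = cps_inr k (pi f)).
Proof.
move=> piC.
pose F (l : 'I_(n + n)) := match split l with
  inl i => cps_inl k (pi (cpsX K U_(i)%MM)) | inr i => cps_inr k (pi (cpsX K U_(i)%MM)) end.
have pi0 i : pi (cpsX K U_(i)%MM) 0%MM = 0.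
  by rewrite hom_const_term // cpsXE eq_sym mnm1_eq0.
have [|Psi [PsiC PsiE]] := @subst_exists K (n + n) (k + k) F.
  by move=> l; rewrite /F; case: (split l) => i; rewrite ?cps_inl0E ?cps_inr0E pi0.
have FL i : F (lshift n i) = cps_inl k (pi (cpsX K U_(i)%MM)).
  by rewrite /F -/(unsplit (inl i)) unsplitK.
have FR i : F (rshift n i) = cps_inr k (pi (cpsX K U_(i)%MM)).
  by rewrite /F -/(unsplit (inr i)) unsplitK.
exists Psi; split.
  apply: (@hom_uniq _ _ _ (Psi \o @cps_inl K n n) (@cps_inl K k k \o pi)) => [c|c|i] /=.
  - by rewrite cps_inl_const PsiC.
  - by rewrite piC cps_inl_const.
  - by rewrite cps_inlX (subst_X PsiE) mmap1U FL.
apply: (@hom_uniq _ _ _ (Psi \o @cps_inr K n n) (@cps_inr K k k \o pi)) => [c|c|i] /=.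
- by rewrite cps_inr_const PsiC.
- by rewrite piC cps_inr_const.
- by rewrite cps_inrX (subst_X PsiE) mmap1U FR.
Qed.

Lemma scaling (K : numFieldType) n (x : 'I_n -> K) :
  exists Phi : {rmorphism cps K n -> cps K n},
    const_compat (cps_const n) Phi /\
    forall f m, Phi f m = (\prod_i x i ^+ m i) * f m.
Proof.
pose F i := cps_const n (x i) * cpsX K U_(i)%MM.
have [|Phi [PhiC PhiE]] := @subst_exists K n n F.
  by move=> i; rewrite cps_constME cpsXE eq_sym mnm1_eq0 mulr0.
exists Phi; split=> // f m; rewrite (PhiE _ _ (mdeg m).+1) //.
have FE a : mmap1 F a = cps_const n (\prod_i x i ^+ a i) * cpsX K a.
  rewrite [X in cpsX K X]multinomUE_id cpsX_sum rmorph_prod -big_split.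
  by apply: eq_bigr => i _; rewrite /F exprMn rmorphXn.
have mN : (mdeg m < (mdeg m).+1)%N by [].
rewrite (eq_bigr (fun a : 'X_{1..n < (mdeg m).+1} =>
    f a * (\prod_i x i ^+ a i * (m == a :> 'X_{1..n})%:R))) => [|a _]; last first.
  by rewrite -cpsXE -[X in _ = _ * X]cps_constME; congr (_ * cps_coef _ m); exact: FE.
rewrite (bigD1 (BMultinom mN)) //= eqxx mulr1 mulrC [X in _ + X]big1 ?addr0 // => a.
by rewrite -val_eqE /= eq_sym => /negPf ->; rewrite !mulr0.
Qed.

Section Lipschitz.
Context (K : numFieldType) (k : nat) (Gamma : set 'X_{1..k}).

(** They generate the ideal of the fibre product of the normalization with
    itself over the germ of [C{Gamma}]. *)
Definition diagonal_gen : set (cps K (k + k)) :=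
  [set F | exists2 a, supported a Gamma & F = cps_inl k a - cps_inr k a]%classic.
Definition diagonal_ideal : set (cps K (k + k)) := ideal_gen diagonal_gen.
Definition lipschitz (f : cps K k) :=
  ideal_int_closure diagonal_ideal (cps_inl k f - cps_inr k f).

Lemma lipschitz_supported f : supported f Gamma -> lipschitz f.
Proof. by move=> fG; apply/int_closure_mem/ideal_gen_mem; exists f. Qed.

Lemma lipschitzD f g : lipschitz f -> lipschitz g -> lipschitz (f + g).
Proof.
move=> Lf Lg; rewrite /lipschitz !rmorphD opprD addrACA.
exact: int_closureD.
Qed.

Lemma lipschitzM f g : lipschitz f -> lipschitz g -> lipschitz (f * g).
Proof.
move=> Lf Lg; rewrite /lipschitz !rmorphM.
have -> : cps_inl k f * cps_inl k g - cps_inr k f * cps_inr k g =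
    cps_inl k f * (cps_inl k g - cps_inr k g) + cps_inr k g * (cps_inl k f - cps_inr k f).
  by ring.
by apply: int_closureD; apply: int_closureMl.
Qed.

Lemma lipschitz_const c : lipschitz (cps_const k c).
Proof.
rewrite /lipschitz cps_inl_const cps_inr_const subrr -[0](mul0r 0).
exact/int_closureMl/int_closure_mem/ideal_gen0.
Qed.

Lemma lipschitz_sum (I : Type) (r : seq I) (P : pred I) (F : I -> cps K k) :
  (forall i, P i -> lipschitz (F i)) -> lipschitz (\sum_(i <- r | P i) F i).
Proof.
move=> LF; elim/big_ind: _ => [|f g|//]; last exact: lipschitzD.
by rewrite -(rmorph0 (cps_const k)); exact: lipschitz_const.
Qed.

(** Modulo the ideal, [(f u)(t) - (f u)(t')] is [u(t) (f(t) - f(t'))]. *)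
Lemma lipschitz_unit f u : supported u Gamma -> u 0%MM != 0 -> lipschitz (f * u) -> lipschitz f.
Proof.
move=> uG u0 Lfu; have [v uv] := cps_unit u0.
have uv' : cps_inl k u * cps_inl k v = 1 by rewrite -rmorphM uv rmorph1.
rewrite /lipschitz; have -> : cps_inl k f - cps_inr k f =
    cps_inl k v * ((cps_inl k (f * u) - cps_inr k (f * u)) +
      (- cps_inr k f) * (cps_inl k u - cps_inr k u)).
  transitivity ((cps_inl k u * cps_inl k v) * (cps_inl k f - cps_inr k f)).
    by rewrite uv' mul1r.
  by rewrite !rmorphM; ring.
apply/int_closureMl/int_closureD => //; apply: int_closureMl.
exact: lipschitz_supported.
Qed.

(** The torus acts on both groups of variables at once and preserves supports,
    hence the generators of the ideal. *)
Lemma lipschitz_scaling (x : 'I_k -> K) (Phi : {rmorphism cps K k -> cps K k}) f :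
    (forall f m, Phi f m = (\prod_i x i ^+ m i) * f m) ->
  lipschitz f -> lipschitz (Phi f).
Proof.
move=> PhiE Lf.
have [Psi [_ PsiE]] := scaling (fun l : 'I_(k + k) =>
  match split l with inl i => x i | inr i => x i end).
have prodE (m : 'X_{1..k + k}) :
    \prod_l (match split l with inl i => x i | inr i => x i end) ^+ m l =
    (\prod_i x i ^+ lmon m i) * (\prod_i x i ^+ rmon m i).
  rewrite big_split_ord; congr (_ * _); apply: eq_bigr => i _; rewrite mnmE.
    by rewrite -/(unsplit (inl i)) unsplitK.
  by rewrite -/(unsplit (inr i)) unsplitK.
have one0 : \prod_i x i ^+ (0%MM : 'X_{1..k}) i = 1.
  by rewrite big1 // => i _; rewrite mnm0E.
have PsiL h : Psi (cps_inl k h) = cps_inl k (Phi h).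
  apply: cps_ext => m; rewrite PsiE prodE /= /inl_coef.
  by case: eqP => [->|_]; rewrite ?mulr0 // PhiE one0 mulr1.
have PsiR h : Psi (cps_inr k h) = cps_inr k (Phi h).
  apply: cps_ext => m; rewrite PsiE prodE /= /inr_coef.
  by case: eqP => [->|_]; rewrite ?mulr0 // PhiE one0 mul1r.
rewrite /lipschitz -PsiL -PsiR -rmorphB.
apply: (@ideal_int_closure_morph _ _ Psi diagonal_ideal) Lf => F.
apply: ideal_gen_morph => [{}F [a aG ->]||]; [|exact: ideal_genD|exact: ideal_genMl].
apply: ideal_gen_mem; exists (Phi a); last by rewrite rmorphB PsiL PsiR.
by move=> m; rewrite PhiE => am; apply: aG; apply: contraNneq am => ->; rewrite mulr0.
Qed.

Section Averaging.
Context (p : nat) (z : K).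
Hypothesis z_prim : p.-primitive_root z.

Lemma root_sum (a b : nat) :
  \sum_(l < p) (z ^+ b)^-1 ^+ l * z ^+ l ^+ a = if (a %% p == b %% p)%N then p%:R else 0.
Proof.
pose y := (z ^+ b)^-1 * z ^+ a.
have zp := prim_expr_order z_prim.
have zb : z ^+ b != 0.
  apply/eqP => zb; have : (z ^+ b) ^+ p = 1 by rewrite exprAC zp expr1n.
  by rewrite zb expr0n gtn_eqF ?(prim_order_gt0 z_prim) // => /eqP; rewrite eq_sym oner_eq0.
have -> : \sum_(l < p) (z ^+ b)^-1 ^+ l * z ^+ l ^+ a = \sum_(l < p) y ^+ l.
  by apply: eq_bigr => l _; rewrite exprAC exprMn.
have y1 : (y == 1) = (a %% p == b %% p)%N.
  rewrite -(eq_prim_root_expr z_prim) /y mulrC -(inj_eq (mulIf zb)) mul1r divfK //.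
have yp : y ^+ p = 1.
  by rewrite /y exprMn exprVn -!exprM !(mulnC _ p) !exprM zp !expr1n invr1 mulr1.
rewrite -y1; case: eqP => [->|/eqP y1'].
  by under eq_bigr do rewrite expr1n; rewrite sumr_const card_ord.
have := subrX1 y p; rewrite yp subrr => /esym/eqP; rewrite mulf_eq0 subr_eq0 (negPf y1') /=.
by move/eqP.
Qed.

(** The projection to a class of exponents modulo [p] is an average of the
    action of [p]-th roots of unity, twisted by a character. *)
Lemma lipschitz_average (i : 'I_k) (r : nat) f :
  lipschitz f -> lipschitz (cps_restrict (fun m => m i %% p = r %% p)%N f).
Proof.
move=> Lf; have p0 : p%:R != 0 :> K by rewrite pnatr_eq0 -lt0n (prim_order_gt0 z_prim).
have ex (l : 'I_p) : exists Phi : {rmorphism cps K k -> cps K k},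
    forall f m, Phi f m = z ^+ l ^+ m i * f m.
  have [Phi [_ PhiE]] := scaling (fun j => if j == i then z ^+ l else 1).
  exists Phi => f' m; rewrite PhiE (bigD1 i) //= eqxx big1 ?mulr1 // => j /negPf ->.
  by rewrite expr1n.
have [Phi PhiE] := choice ex.
have LPhi l : lipschitz (Phi l f).
  apply: (lipschitz_scaling (x := fun j => if j == i then z ^+ l else 1)) Lf => f' m.
  rewrite PhiE (bigD1 i) //= eqxx big1 ?mulr1 // => j /negPf ->.
  by rewrite expr1n.
have -> : cps_restrict (fun m => m i %% p = r %% p)%N f =
    \sum_(l < p) cps_const k (p%:R^-1 * (z ^+ r)^-1 ^+ l) * Phi l f.
  apply: cps_ext => m; rewrite cps_sumE.
  under eq_bigr do rewrite cps_constME PhiE mulrA -(mulrA p%:R^-1).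
  rewrite -mulr_suml -mulr_sumr root_sum /=; case: (asboolP (_ = _)) => [->|/eqP/negPf ->].
    by rewrite eqxx mulVf ?mul1r.
  by rewrite mulr0 mul0r.
by apply: lipschitz_sum => l _; apply: lipschitzM => //; exact: lipschitz_const.
Qed.

Lemma lipschitz_congruent f (m : 'X_{1..k}) : lipschitz f ->
  lipschitz (cps_restrict (fun e => forall i, e i %% p = m i %% p)%N f).
Proof.
move=> Lf.
have part (s : seq 'I_k) :
    lipschitz (cps_restrict (fun e => forall i, i \in s -> e i %% p = m i %% p)%N f).
  elim: s => [|i s IH].
    have -> : cps_restrict (fun e => forall i, i \in [::] -> e i %% p = m i %% p)%N f = f.
      by apply: cps_ext => e /=; case: asboolP => // nP; case: nP.
    exact: Lf.
  have -> : cps_restrict (fun e => forall j, j \in i :: s -> e j %% p = m j %% p)%N f =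
    cps_restrict (fun e => e i %% p = m i %% p)%N
      (cps_restrict (fun e => forall i, i \in s -> e i %% p = m i %% p)%N f).
    apply: cps_ext => e /=; case: asboolP => e1; case: asboolP => e2 //.
    - case: asboolP => // nP; case: nP => j js.
      by apply: e1; rewrite inE js orbT.
    - by case: e2; apply: e1; rewrite inE eqxx.
    - case: asboolP => // e3; case: e1 => j; rewrite inE => /predU1P[->|]; [exact: e2|exact: e3].
  exact: lipschitz_average.
have -> : cps_restrict (fun e => forall i, e i %% p = m i %% p)%N f =
    cps_restrict (fun e => forall i, i \in enum 'I_k -> e i %% p = m i %% p)%N f.
  apply: cps_ext => e /=; case: asboolP => e1; case: asboolP => e2 //.
  by case: e1 => i; apply: e2; rewrite mem_enum.
exact: part.
Qed.

End Averaging.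
End Lipschitz.

(** * The Lipschitz saturation is toric *)

(** The polynomial [X^p - 1] is separable and splits, so it has [p] roots. *)
Lemma primitive_root_exists (C : numClosedFieldType) p : (0 < p)%N ->
  exists z : C, p.-primitive_root z.
Proof.
move=> p0; have [r] := closed_field_poly_normal ('X^p - 1 : {poly C}).
rewrite (monicP (monicXnsubC _ p0)) scale1r => rE.
have sr : (p <= size r)%N by rewrite -ltnS -(size_prod_XsubC r id) -rE size_XnsubC.
have ur : uniq r by rewrite -separable_prod_XsubC -rE separable_Xn_sub_1 // pnatr_eq0 -lt0n.
have [|z _ zp] := hasP (has_prim_root p0 _ ur sr); last by exists z.
by apply/allP => z; rewrite -root_prod_XsubC -rE.
Qed.

Section LipschitzSemigroup.
Context (K : numFieldType) (k : nat) (Gamma : set 'X_{1..k}) (N : nat).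
Hypothesis roots : forall p, (0 < p)%N -> exists z : K, p.-primitive_root z.
Hypothesis N0 : (0 < N)%N.
Hypothesis Gamma_multiples : forall m : 'X_{1..k}, (forall i, N %| m i)%N -> Gamma m.

Definition lipschitz_semigroup : set 'X_{1..k} :=
  [set m | lipschitz Gamma (cpsX K m)]%classic.

Lemma lipschitz_semigroupD a b : lipschitz_semigroup a -> lipschitz_semigroup b ->
  lipschitz_semigroup (a + b)%MM.
Proof. by move=> La Lb; rewrite /lipschitz_semigroup /= cpsX_add; apply: lipschitzM. Qed.

Lemma Gamma_lipschitz a : Gamma a -> lipschitz_semigroup a.
Proof. by move=> Ga; apply: lipschitz_supported; apply: supported_cpsX. Qed.

(** If [p] is a multiple of [N] larger than all coordinates of [m], the
    monomials of [f] with exponents congruent to [m] modulo [p] are multiples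
    of [x^m] by monomials of [C{Gamma}]; their sum is [x^m u] with
    [u(0) = f_m], so [u] is a unit. *)
Lemma lipschitz_monomial (f : cps K k) : lipschitz Gamma f -> supported f lipschitz_semigroup.
Proof.
move=> Lf m fm; pose p := (N * (mdeg m).+1)%N.
have p0 : (0 < p)%N by rewrite muln_gt0 N0.
have [z zp] := roots p0.
set fm' := cps_restrict (fun e => forall i, e i %% p = m i %% p)%N f.
have Lfm : lipschitz Gamma fm' by exact: lipschitz_congruent zp f m Lf.
have mp i : (m i < p)%N.
  have : (m i <= mdeg m)%N by rewrite mdegE (bigD1 i) //= leq_addr.
  by rewrite /p; nia.
have fm'E (e : 'X_{1..k}) : fm' e != 0 -> forall i, (m i <= e i)%N /\ (N %| e i - m i)%N.
  rewrite /fm' /=; case: asboolP => [em _ i|_]; last by rewrite eqxx.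
  have me : (m i <= e i)%N by rewrite -(modn_small (mp i)) -em leq_mod.
  by split=> //; apply: (@dvdn_trans p); [exact: dvdn_mulr | rewrite -eqn_mod_dvd // em].
apply: (@lipschitz_unit _ _ _ _ (cps_shift m fm')).
- move=> e; rewrite cps_shiftE => /fm'E ei; apply: Gamma_multiples => i.
  by have [_] := ei i; rewrite mnmDE addKn.
- by rewrite cps_shiftE addm0 /=; case: asboolP => // -[].
have -> // : cpsX K m * cps_shift m fm' = fm'.
apply: cps_ext => e; rewrite cpsXME; case: ifP => me.
  by rewrite cps_shiftE addmC submK.
apply/esym/eqP; apply: contraFT me => /fm'E ei; apply/mnm_lepP => i.
by have [] := ei i.
Qed.

(** A series supported on the Lipschitz semigroup is a combination of finitely
    many of its monomials with coefficients in [C{Gamma}], so no infinite sums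
    of elements of the integral closure are involved. *)
Lemma lipschitzE (f : cps K k) : lipschitz Gamma f <-> supported f lipschitz_semigroup.
Proof.
split; first exact: lipschitz_monomial.
move=> fL; have [u [uL ucov]] := finite_basis lipschitz_semigroup N0.
have [|F [FN ->]] := @split_support K k u [set m | forall i, N %| m i]%N%classic f.
  by move=> m /fL/ucov.
apply: lipschitz_sum => i _; apply: lipschitzM; first exact/uL/mem_nth.
by apply: lipschitz_supported; apply: supportedW (FN i).
Qed.

(** Besides a finite basis over the multiples of [N], the [N]-th multiples of the
    unit vectors are needed. *)
Lemma lipschitz_semigroup_generated : exists l (g : 'I_l -> 'X_{1..k}),
  (forall i, g i != 0%MM) /\ forall m, lipschitz_semigroup m <-> range (mon g) m.
Proof.
have [u [uL ucov]] := finite_basis lipschitz_semigroup N0.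
pose s := [seq a <- u | a != 0%MM] ++ [seq (U_(i) *+ N)%MM | i : 'I_k].
have s_lip a : a \in s -> a != 0%MM /\ lipschitz_semigroup a.
  rewrite mem_cat mem_filter => /orP[/andP[a0 /uL]//|/mapP[i _ ->]]; split.
    by rewrite -mdeg_eq0 mdegMn mdeg1 mul1n -lt0n.
  by apply/Gamma_lipschitz/Gamma_multiples => j; rewrite mulmnE dvdn_mull.
pose g (i : 'I_(size s)) := nth 0%MM s i.
have gs i : g i \in s by apply: mem_nth.
exists (size s), g; split=> [i|m]; first by case: (s_lip _ (gs i)).
have lip0 : lipschitz_semigroup 0%MM.
  by apply/Gamma_lipschitz/Gamma_multiples => i; rewrite mnm0E dvdn0.
split=> [/ucov[a au [am aN]]|[a _ <-]]; last first.
  rewrite /mon; elim/big_ind: _ => [//||i _]; first exact: lipschitz_semigroupD.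
  elim: (a i) => [|c IH]; first by rewrite mulm0n.
  by rewrite mulmS; apply: lipschitz_semigroupD => //; case: (s_lip _ (gs i)).
have s_range b : b \in s -> range (mon g) b.
  move=> bs; have bN : (index b s < size s)%N by rewrite index_mem.
  by exists U_(Ordinal bN)%MM; rewrite // mon1 /g /= nth_index.
rewrite -(submK am); apply: GammaD; last first.
  have [->|a0] := eqVneq a 0%MM; first exact: Gamma0.
  by apply: s_range; rewrite mem_cat mem_filter a0 au.
have -> : (m - a = \sum_i (U_(i) *+ N) *+ ((m - a)%MM i %/ N))%MM.
  apply/mnmP => i; rewrite mnm_sumE (bigD1 i) //= big1 => [|j ji].
    by rewrite !mulmnE mnm1E eqxx mul1n addn0 mulnC divnK.
  by rewrite !mulmnE mnm1E (negPf ji).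
elim/big_ind: _ => [||i _]; [exact: Gamma0|exact: GammaD|].
apply/GammaMn/s_range; rewrite mem_cat; apply/orP; right.
by apply/mapP; exists i; rewrite ?mem_enum.
Qed.

End LipschitzSemigroup.

Section LipschitzSaturation.
Context (R : realType) (A : idomainType) (iota : {rmorphism R[i] -> A}).
Context (k : nat) (psi0 : {rmorphism cps R[i] k -> {fraction A}}).
Context (Gamma : set 'X_{1..k}).
Hypothesis psi0C : forall c, psi0 (cps_const k c) = iota_frac iota c.
Hypothesis psi0_range : range psi0 = normalization (A := A).
Hypothesis psi0_inj : injective psi0.
Hypothesis psi0_A : forall f, (exists a, psi0 f = tofrac a) <-> supported f Gamma.

(** The projection of [C{t, t'}] to the tensor product over [C] defined by the
    presentation [psi0] sends the ideal of [diagonal_gen] into [I_Delta]. *)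
Lemma lipschitz_sub_saturation f : lipschitz Gamma f ->
  lipschitz_saturation iota (psi0 f).
Proof.
move=> Lf; split; first by rewrite -psi0_range; exists f.
exists k, psi0, f; split=> //.
apply: (@ideal_int_closure_morph _ _ (quot_proj
  (antensor_rel psi0 psi0 (iota_frac iota) (iota_frac iota))) (diagonal_ideal Gamma)) Lf.
move=> F JF; rewrite /I_Delta /= tensor_surjE.
rewrite -(rmorph0 (quot_proj (antensor_rel psi0 psi0 (@tofrac A) (@tofrac A)))).
apply/quot_projE; rewrite subr0.
have [l [a [s [sJ ->]]]] := JF; exists l, a, s; split=> // i.
have [b bG ->] := sJ i; have [x xb] := (psi0_A b).2 bG.
by exists x, b, b.
Qed.

(** Any presentation [psi] factors through [psi0]; doubling this factorization
    maps the tensor products of [psi] to [C{t, t'}] and [I_Delta] into the ideal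
    of [diagonal_gen]. *)
Lemma saturation_sub_lipschitz F : lipschitz_saturation iota F ->
  exists2 f, psi0 f = F & lipschitz Gamma f.
Proof.
case=> nF [n [psi [h [[psiC psi_range] hF dh]]]].
have [|||||pi piP] := @rmorphism_of_relation _ _
  (fun (x : cps R[i] n) (y : cps R[i] k) => psi0 y = psi x).
- move=> x; have : range psi0 (psi x) by rewrite psi0_range -psi_range; exists x.
  by case=> y _ yx; exists y.
- by move=> x y y' <- /psi0_inj.
- by move=> x x' y y' xy xy'; rewrite !rmorphB xy xy'.
- by move=> x x' y y' xy xy'; rewrite !rmorphM xy xy'.
- by rewrite !rmorph1.
have piC : const_compat (cps_const k) pi.
  by move=> c; apply: psi0_inj; rewrite piP psiC psi0C.
have [Psi [PsiL PsiR]] := hom_double piC.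
pose rC := antensor_rel psi psi (iota_frac iota) (iota_frac iota).
have Psi_rC f : ideal_gen rC f -> Psi f = 0.
  move=> [l [a [s [sr ->]]]]; rewrite rmorph_sum big1 // => i _.
  have [c [h1 [h2 [e1 e2 ->]]]] := sr i; rewrite rmorphM rmorphB PsiL PsiR.
  have -> : pi h1 = cps_const k c by apply: psi0_inj; rewrite piP e1 psi0C.
  have -> : pi h2 = cps_const k c by apply: psi0_inj; rewrite piP e2 psi0C.
  by rewrite cps_inl_const cps_inr_const subrr mulr0.
have Psi_repr f : Psi (repr (quot_proj rC f)) = Psi f.
  apply/eqP; rewrite -subr_eq0 -rmorphB; apply/eqP/Psi_rC.
  by apply/quot_projE; rewrite quot_proj_repr.
pose theta (t : tensorC iota psi) := Psi (repr t).
have thetaB : zmod_morphism theta.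
  move=> s t.
  have -> : s - t = quot_proj rC (repr s - repr t) by rewrite rmorphB /= !quot_proj_repr.
  by rewrite /theta Psi_repr rmorphB.
have thetaM : monoid_morphism theta.
  split=> [|s t]; first by rewrite /theta Psi_repr rmorph1.
  have -> : s * t = quot_proj rC (repr s * repr t) by rewrite rmorphM /= !quot_proj_repr.
  by rewrite /theta Psi_repr rmorphM.
pose Theta : {rmorphism tensorC iota psi -> cps R[i] (k + k)} := HB.pack theta
  (GRing.isZmodMorphism.Build _ _ theta thetaB) (GRing.isMonoidMorphism.Build _ _ theta thetaM).
exists (pi h); first by rewrite piP.
have := @ideal_int_closure_morph _ _ Theta (I_Delta psi) (diagonal_ideal Gamma) _ _ dh.
rewrite /= /theta Psi_repr rmorphB PsiL PsiR; apply=> t It.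
have : ideal_gen (antensor_rel psi psi (@tofrac A) (@tofrac A)) (repr t).
  by rewrite -[repr t]subr0; apply/quot_projE; rewrite rmorph0.
rewrite /= /theta; apply: ideal_gen_morph; [|exact: ideal_genD|exact: ideal_genMl].
move=> G [a [h1 [h2 [e1 e2 ->]]]].
have h12 : pi h1 = pi h2 by apply: psi0_inj; rewrite !piP e1 e2.
apply: ideal_gen_mem; exists (pi h1); last by rewrite rmorphB PsiL PsiR -h12.
by apply/psi0_A; exists a; rewrite piP.
Qed.

End LipschitzSaturation.

(** A cone in the positive orthant is strongly convex. *)
Lemma semigroup_toric_generators (R : realType) k l (g : 'I_l -> 'X_{1..k}) :
    (forall i, g i != 0%MM) ->
    (forall i : 'I_k, exists2 b, range (mon g) b & range (mon g) (b + U_(i))%MM) ->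
  toric_generators R (fun i => \row_j (g i j)%:Z).
Proof.
move=> g0 gen; pose gamma i : 'rV[int]_k := \row_j (g i j)%:Z.
have gammaE (a : 'X_{1..l}) : \sum_i (a i)%:Z *: gamma i = \row_j (mon g a j)%:Z.
  apply/rowP => j; rewrite summxE mxE /mon mnm_sumE (big_morph Posz PoszD (erefl _)).
  by apply: eq_bigr => i _; rewrite !mxE mulmnE PoszM mulrC.
split.
- move=> i; apply: contra_neq (g0 i) => /rowP gi; apply/mnmP => j.
  by have := gi j; rewrite !mxE mnm0E => -[].
- move=> e; have ex i : exists c : 'I_l -> int, delta_mx 0 i = \sum_j c j *: gamma j.
    have [b [x _ xb] [y _ yb]] := gen i; exists (fun j => (y j)%:Z - (x j)%:Z).
    under eq_bigr do rewrite scalerBl; rewrite sumrB !gammaE xb yb.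
    apply/rowP => j; rewrite !mxE mnmDE mnm1E eqxx /= [j == i]eq_sym.
    by case: (i == j) => /=; lia.
  have [c cE] := choice ex; exists (fun j => \sum_i e 0 i * c i j).
  rewrite {1}(row_sum_delta e); under eq_bigr do rewrite cE scaler_sumr.
  rewrite exchange_big; apply: eq_bigr => j _; rewrite scaler_suml.
  by apply: eq_bigr => i _; rewrite scalerA.
- have ge0 v : real_cone gamma v -> forall j, 0 <= (v : 'rV[R]_k) 0 j.
    move=> [r [r0 ->]] j; rewrite summxE sumr_ge0 // => i _.
    by rewrite !mxE mulr_ge0 // ler0z.
  move=> v /ge0 v0 /ge0 nv0; apply/rowP => j; rewrite mxE; apply/eqP.
  by rewrite eq_le v0 andbT -oppr_ge0; have := nv0 j; rewrite mxE.
Qed.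

Theorem theorem3p2 (R : realType) (d : nat) (A : idomainType)
    (iota : {rmorphism R[i] -> A})
    (A_toric : toric_algebra iota [set: A])
    (A_dim : krull_dim A d)
    (A_smooth : smooth_normalization iota) :
  toric_algebra (iota_frac iota) (lipschitz_saturation iota).
Proof.
have [d' [n [gamma [phi [gammaT [phiC phi_range] ker_phi]]]]] := A_toric.
have [q [g [g0 gammag]]] := toric_embedding gammaT.
have [mu [muC muE]] := @monomial_subst R[i] n q g g0.
have phi_surj a : exists f, phi f = a.
  by have : [set: A]%classic a by []; rewrite -phi_range => -[f _ fa]; exists f.
have [j [j_inj jphi]] : exists j : {rmorphism A -> cps R[i] q},
    injective j /\ forall f, j (phi f) = mu f.
  apply: rmorphism_factor => // f h.
  by rewrite ker_phi; apply: iff_sym; exact: toric_series_eq g0 gammag muE f h.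
have jC c : j (iota c) = cps_const q c by rewrite -phiC jphi muC.
have j_range f : (exists a, j a = f) <-> supported f (range (mon g)).
  split=> [[a <-]|fG].
    by have [h <-] := phi_surj a; rewrite jphi; exact: monomial_subst_supported muE.
  by have [h hf] := monomial_subst_lift g0 muE fG; exists (phi h); rewrite jphi.
have [e [psi [[psiC psi_range] psi_inj]]] := A_smooth.
have psi_int F : (exists f, psi f = F) <-> integralOver (@tofrac A) F.
  split=> [[f <-]|iF]; first by have : normalization (psi f) by rewrite -psi_range; exists f.
  by have : normalization F by []; rewrite -psi_range => -[f _ fF]; exists f.
have [k [h [h0 h_sat h_inj]]] := smooth_saturation_free j_inj jC j_range psiC psi_int psi_inj.
have [nu [nuC nuE]] := @monomial_subst R[i] k q h h0.
have [psi0 [psi0C psi0_int psi0_inj psi0_A]] :=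
  normalization_coordinates j_inj jC j_range h0 h_sat h_inj nuC nuE.
set Gamma := pulled_back g h in psi0_A.
have [N N0 Gamma_mul] : exists2 N, (0 < N)%N &
    forall m : 'X_{1..k}, (forall i, N %| m i)%N -> Gamma m.
  exact: common_multiple h_sat.
have psi0_range : range psi0 = normalization (A := A).
  by apply/seteqP; split=> F; [move=> [f _ <-]; apply/psi0_int; exists f |
    move=> /psi0_int[f <-]; exists f].
have roots p : (0 < p)%N -> exists z : R[i], p.-primitive_root z.
  exact: primitive_root_exists.
have [l [s [s0 s_lip]]] := lipschitz_semigroup_generated R[i] N0 Gamma_mul.
have [rho [rhoC rhoE]] := @monomial_subst R[i] l k s s0.
exists k, l, (fun i => \row_j (s i j)%:Z), (psi0 \o rho : {rmorphism _ -> _}).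
split.
(* Each [h_i] is a difference of elements of [Gamma], so [Gamma] generates [Z^k]. *)
- apply: semigroup_toric_generators => // i.
  have [_ [b Gb Gbi]] : saturation g (h i) by apply/h_sat; exists U_(i)%MM; rewrite mon1.
  have [b' bE] : exists b', mon h b' = b by apply/h_sat/Gamma_saturation.
  by exists b'; apply/s_lip/Gamma_lipschitz; rewrite /Gamma /pulled_back /= ?monD ?mon1 bE.
- split=> [c|]; first by rewrite /= rhoC psi0C.
  apply/seteqP; split=> F.
    move=> [f _ <-] /=; apply: (lipschitz_sub_saturation psi0C) => //.
    apply/(lipschitzE roots N0 Gamma_mul); apply: supportedW (monomial_subst_supported rhoE).
    by move=> m /s_lip.
  move=> /(saturation_sub_lipschitz psi0C psi0_range psi0_inj psi0_A)[f <-].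
  move=> /(lipschitzE roots N0 Gamma_mul) fL.
  have [|f' f'E] := monomial_subst_lift s0 rhoE (f := f).
    by apply: supportedW fL => m /s_lip.
  by exists f'; rewrite //= f'E.
- move=> f f'; rewrite /= -(toric_series_eq s0 _ rhoE) => [|a b].
    by split=> [/psi0_inj|->].
  have sE (c : 'X_{1..l}) : \sum_i (\row_j (s i j)%:Z : 'rV[int]_k) *+ c i =
      \row_j (mon s c j)%:Z.
    apply/rowP => x; rewrite summxE mxE /mon mnm_sumE (big_morph Posz PoszD (erefl _)).
    by apply: eq_bigr => i _; rewrite mulmxnE mxE mulmnE PoszM -mulr_natr natz.
  rewrite !sE; split=> [/rowP ab|->//]; apply/mnmP => x.
  by have := ab x; rewrite !mxE => -[].
Qed.
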